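(* $\widetilde{H}_{W,V}(\mathbb{T})=H_{W,V}(\mathbb{T})$ as sets, where $\widetilde{H}_{W,V}(\mathbb{T})$ is the space of functions in $L^2_V(\mathbb{T})$ having a $W$-left weak derivative in $L^2_{W,0}(\mathbb{T})$ and $H_{W,V}(\mathbb{T})$ is the energetic space of $I-D_V^+D_W^-$.
   Context: Setting. $\mathbb{T}=\mathbb{R}/\mathbb{Z}$, identified with $[0,1)$ with tagged point $0$. Càdlàg = right-continuous with left limits; càglàd = left-continuous with right limits. $W,V:\mathbb{R}\to\mathbb{R}$ are strictly increasing, $W$ càdlàg, $V$ càglàd, with $W(x+1)-W(x)=W(1)-W(0)$ and $V(x+1)-V(x)=V(1)-V(0)$ for all $x$; both are continuous at $0$ and $W(0)=V(0)=0$. They induce finite Borel measures on $\mathbb{T}$ with $dW((a,b])=W(b)-W(a)$, $dV([a,b))=V(b)-V(a)$ (atoms allowed). $L^2_V,L^2_W$ are the corresponding $L^2$ spaces with norms $\|\cdot\|_V,\|\cdot\|_W$; $L^2_{W,0}(\mathbb{T})=\{H\in L^2_W(\mathbb{T}):\int_{\mathbb{T}}H\,dW=0\}$. One-sided derivatives: $D_W^-f(x)=\lim_{h\to0^-}\frac{f(x+h)-f(x)}{W(x+h)-W(x)}$, $D_V^+g(x)=\lim_{h\to0^+}\frac{g(x+h)-g(x)}{V(x+h)-V(x)}$, required to exist at every $x\in\mathbb{T}$. $\mathfrak{D}_{W,V}(\mathbb{T})$ is the set of càdlàg $f:\mathbb{T}\to\mathbb{R}$ such that $D_W^-f$ exists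 and is càglàd and $D_V^+D_W^-f$ exists and is càdlàg. On it put $\|f\|_{1,2}^2=\langle f-D_V^+D_W^-f,f\rangle_V=\|f\|_V^2+\|D_W^-f\|_W^2$. $H_{W,V}(\mathbb{T})$ is the set of $f\in L^2_V(\mathbb{T})$ for which there is a sequence $f_n\in\mathfrak{D}_{W,V}(\mathbb{T})$ with $f_n\to f$ in $L^2_V(\mathbb{T})$ and $(f_n)$ Cauchy for $\|\cdot\|_{1,2}$. Test functions: $C^\infty_{V,W,0}(\mathbb{T})$ is the set of càglàd $g:\mathbb{T}\to\mathbb{R}$ with $\int_{\mathbb{T}} g\,dW=0$ such that all iterated derivatives $D_V^+g,\ D_W^-D_V^+g,\ D_V^+D_W^-D_V^+g,\ldots$ exist, those with an odd number of factors being càdlàg with zero $dV$-integral and those with an even number of factors being càglàd with zero $dW$-integral. $C^\infty_{V,W}(\mathbb{T})=\langle1\rangle\oplus C^\infty_{V,W,0}(\mathbb{T})$ (adding constants). Weak derivative: $f\in L^2_V(\mathbb{T})$ has a $W$-left weak derivative if there exists $F\in L^2_W(\mathbb{T})$ with $\int_{\mathbb{T}}f\,D_V^+g\,dV=-\int_{\mathbb{T}}F g\,dW$ for every $g\in C^\infty_{V,W}(\mathbb{T})$; then $F$ is unique, is denoted $\partial_W^-f$, and (taking $g\equiv1$) lies in $L^2_{W,0}(\mathbb{T})$. $\widetilde H_{W,V}(\mathbb{T})=\{f\in L^2_V(\mathbb{T}):\partial_W^-f\in L^2_{W,0}(\mathbb{T})\text{ exists}\}$. *)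

(* Defs.v *)
From HB Require Import structures.
From mathcomp Require Import all_boot all_order all_algebra.
From mathcomp Require Import all_classical all_reals all_analysis.
Set Implicit Arguments.
Unset Strict Implicit.
Unset Printing Implicit Defensive.
Import Order.TTheory GRing.Theory Num.Theory.
Import numFieldNormedType.Exports.
Local Open Scope classical_set_scope.
Local Open Scope ring_scope.

(* A function on the torus R/Z is encoded as a 1-periodic function on R, and a
   measure on the torus as a Borel measure on R concentrated on [0, 1). For L^2
   classes no periodicity is needed: values outside [0, 1) are negligible. *)

Section one_sided.
Context {R : realType}.
Implicit Types f W V : R -> R.

Definition cadlag f :=
  forall x, f y @[y --> x^'+] --> f x /\ cvg (f y @[y --> x^'-]).

Definition caglad f :=
  forall x, f y @[y --> x^'-] --> f x /\ cvg (f y @[y --> x^'+]).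

Definition diff_quotient W f x h := (f (x + h) - f x) / (W (x + h) - W x).

(* As with the library's [derivable] and ['D_v f], the derivatives [lderive]
   and [rderive] are total functions, meaningful under [lderivable] and
   [rderivable], which require a finite limit at every point. *)
Definition lderivable W f :=
  forall x, cvg (diff_quotient W f x h @[h --> 0^'-]).
Definition lderive W f x := lim (diff_quotient W f x h @[h --> 0^'-]).

Definition rderivable V f :=
  forall x, cvg (diff_quotient V f x h @[h --> 0^'+]).
Definition rderive V f x := lim (diff_quotient V f x h @[h --> 0^'+]).

End one_sided.

Record cadlag_driver (R : realType) := CadlagDriver {
  cadlag_fun :> R -> R ;
  cadlag_driver_incr : {homo cadlag_fun : x y / x < y} ;
  cadlag_driver_cadlag : cadlag cadlag_fun ;
  cadlag_driver_shift : forall x,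
    cadlag_fun (x + 1) - cadlag_fun x = cadlag_fun 1 - cadlag_fun 0 ;
  cadlag_driver_cont0 : {for 0, continuous cadlag_fun} ;
  cadlag_driver0 : cadlag_fun 0 = 0 }.

Record caglad_driver (R : realType) := CagladDriver {
  caglad_fun :> R -> R ;
  caglad_driver_incr : {homo caglad_fun : x y / x < y} ;
  caglad_driver_caglad : caglad caglad_fun ;
  caglad_driver_shift : forall x,
    caglad_fun (x + 1) - caglad_fun x = caglad_fun 1 - caglad_fun 0 ;
  caglad_driver_cont0 : {for 0, continuous caglad_fun} ;
  caglad_driver0 : caglad_fun 0 = 0 }.

Section measures.
Context {R : realType}.
Variables (W : cadlag_driver R) (V : caglad_driver R).

Let W_nd : {homo (W : R -> R) : x y / x <= y}.
Proof. exact/ltW_homo/cadlag_driver_incr. Qed.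

Let W_rc : right_continuous (W : R -> R).
Proof. by move=> x; have [] := cadlag_driver_cadlag W x. Qed.

HB.instance Definition _ := isCumulative.Build R _ R (cadlag_fun W) W_nd W_rc.

Definition reflected (x : R) := - V (- x).

Let reflected_nd : {homo reflected : x y / x <= y}.
Proof.
by move=> x y xy; rewrite lerN2 (ltW_homo (@caglad_driver_incr _ V))// lerN2.
Qed.

Let reflected_rc : right_continuous reflected.
Proof.
move=> x; apply: cvgN.
have [+ _] := caglad_driver_caglad V (- x).
by move/cvg_at_leftNP; rewrite opprK.
Qed.

HB.instance Definition _ :=
  isCumulative.Build R _ R reflected reflected_nd reflected_rc.

Definition fundamental_domain : set (measurableTypeR R) := `[0, 1[%classic.

Lemma measurable_fundamental_domain : measurable fundamental_domain.
Proof. exact: measurable_itv. Qed.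

Definition measW : set (measurableTypeR R) -> \bar R :=
  mrestr (lebesgue_stieltjes_measure W) measurable_fundamental_domain.
HB.instance Definition _ := Measure.on measW.

(* The measure giving V b - V a to [a, b) is the image under x |-> - x of the
   Lebesgue-Stieltjes measure of the right-continuous function
   x |-> - V (- x), which gives V b - V a to (- b, - a]. *)
Definition left_stieltjes : set (measurableTypeR R) -> \bar R :=
  pushforward (lebesgue_stieltjes_measure reflected)
    (-%R : measurableTypeR R -> measurableTypeR R).

Let left_stieltjes0 : left_stieltjes set0 = 0%E.
Proof. by rewrite /left_stieltjes /pushforward preimage_set0 measure0. Qed.

Let left_stieltjes_ge0 A : (0 <= left_stieltjes A)%E.
Proof. exact: measure_ge0. Qed.

Let left_stieltjes_sigma_additive : semi_sigma_additive left_stieltjes.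
Proof.
have mN : measurable_fun [set: measurableTypeR R]
    (-%R : measurableTypeR R -> measurableTypeR R) by [].
exact: (@measure_semi_sigma_additive _ _ _
  (pushforward (lebesgue_stieltjes_measure reflected) _ : {measure set _ -> \bar R})).
Qed.

HB.instance Definition _ := isMeasure.Build _ _ _ left_stieltjes
  left_stieltjes0 left_stieltjes_ge0 left_stieltjes_sigma_additive.

Definition measV : set (measurableTypeR R) -> \bar R :=
  mrestr left_stieltjes measurable_fundamental_domain.
HB.instance Definition _ := Measure.on measV.

(* b = 1 is excluded: the endpoint of the arc would be the base point of the
   torus, which is represented by 0. *)
Lemma measW_itv a b : 0 <= a -> a <= b -> b < 1 ->
  measW `]a, b] = (W b - W a)%:E.
Proof.
move=> a0 ab b1; rewrite /measW /= /mrestr setIidl; last first.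
  move=> x; rewrite /fundamental_domain/= !in_itv/= => /andP[ax xb].
  by rewrite (le_trans a0 (ltW ax)) (le_lt_trans xb b1).
rewrite /lebesgue_stieltjes_measure /measure_extension/=.
by rewrite measurable_mu_extE/= ?wlength_itv_bnd//; exact: is_ocitv.
Qed.

Lemma measV_itv a b : 0 <= a -> a <= b -> b <= 1 ->
  measV `[a, b[ = (V b - V a)%:E.
Proof.
move=> a0 ab b1; rewrite /measV /= /mrestr setIidl; last first.
  move=> x; rewrite /fundamental_domain/= !in_itv/= => /andP[ax xb].
  by rewrite (le_trans a0 ax) (lt_le_trans xb b1).
rewrite /left_stieltjes /pushforward opp_preimage_itvbndbnd/=.
rewrite /lebesgue_stieltjes_measure /measure_extension/=.
rewrite measurable_mu_extE/= ?wlength_itv_bnd ?lerN2//; last exact: is_ocitv.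
by rewrite /reflected !opprK addrC.
Qed.

End measures.

Section spaces.
Context {R : realType}.
Variables (W : cadlag_driver R) (V : caglad_driver R).

Local Notation dW := (measW W).
Local Notation dV := (measV V).
Local Notation L2 mu := (LspaceType2 mu).

Definition strong_domain : set (R -> R) := [set f |
  [/\ periodic f 1,
      cadlag f,
      lderivable W f /\ caglad (lderive W f) &
      rderivable V (lderive W f) /\ cadlag (rderive V (lderive W f))]].

(* The energy <f - D_V^+ D_W^- f, f>_V, which on [strong_domain] equals
   ||f||_V^2 + ||D_W^- f||_W^2 by integration by parts. *)
Definition energy (f : R -> R) : R :=
  \int[dV]_x ((f x - rderive V (lderive W f) x) * f x).

Definition energy_norm (f : R -> R) : R := Num.sqrt (energy f).

(* An element of [L2 mu] is a class of almost everywhere equal functions, and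
   its coercion to functions picks a representative. The conditions below do
   not depend on this choice. *)
Definition energetic_space : set (L2 dV) := [set f : L2 dV |
  exists f_ : nat -> R -> R,
  [/\ forall n, strong_domain (f_ n),
      'N[dV]_2%:E[EFin \o (f_ n \- f)%R]%E @[n --> \oo] --> 0%E &
      forall e : R, 0 < e -> exists N, forall m n, (N <= m)%N -> (N <= n)%N ->
        energy_norm (f_ m \- f_ n) < e]].

(* g, D_V^+ g, D_W^- D_V^+ g, D_V^+ D_W^- D_V^+ g, etc. *)
Fixpoint iter_derive (n : nat) (g : R -> R) : R -> R :=
  if n is k.+1 then
    if odd k then lderive W (iter_derive k g) else rderive V (iter_derive k g)
  else g.

Definition test_functions0 : set (R -> R) := [set g |
  periodic g 1 /\
  forall n, let h := iter_derive n g in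
    if odd n then [/\ cadlag h, \int[dV]_x h x = 0 & lderivable W h]
    else [/\ caglad h, \int[dW]_x h x = 0 & rderivable V h]].

Definition test_functions : set (R -> R) := [set g |
  exists c g0, test_functions0 g0 /\ g = cst c \+ g0].

Definition L2_zero_mean : set (L2 dW) :=
  [set F : L2 dW | \int[dW]_x F x = 0].

Definition is_weak_lderive (f : L2 dV) (F : L2 dW) :=
  forall g, test_functions g ->
  \int[dV]_x (f x * rderive V g x) =
  - \int[dW]_x (F x * g x).

Definition weak_space : set (L2 dV) := [set f : L2 dV |
  exists F : L2 dW, L2_zero_mean F /\ is_weak_lderive f F].

End spaces.

Arguments energetic_space {R} W V.
Arguments weak_space {R} W V.

(* Main.v *)
(* Let T ([prim2] below) be the inverse of D_V^+ D_W^- on mean-zero functions, that is, two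
   successive primitives, each recentered.  The W-primitive and the V-primitive
   are minus each other's adjoint (Fubini), and both have dense range among
   mean-zero L^2 functions, because differences of steep ramps approximate
   indicators of half-lines.

   Test functions are exactly the starting points of infinite backward orbits
   g_n = T g_(n+1).  As T maps L^2 boundedly into bounded functions and has
   dense range, a Mittag-Leffler argument makes these starting points dense.

   If f has the weak derivative F, then f minus the W-primitive of F is
   orthogonal to D_V^+ g for all test functions g, hence is constant almost
   everywhere; approximating F by functions T k gives a sequence in the strong
   domain.  Conversely the energy of a strong f is ||f||^2 + ||D_W^- f||^2, by a
   fundamental theorem of calculus for one-sided derivatives, so a Cauchy
   sequence for the energy has convergent W-derivatives (Riesz-Fischer), and
   integration by parts passes to the limit. *)

(* The obstacle is the lack of ready-made test functions. [W] and [V] may have atoms or be singular,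
   so ordinary smooth functions are in general not differentiable in the required sense, and the
   only way to produce derivatives is to integrate. Finitely many integrations would leave a last
   function without derivatives; a backward orbit has no last function.

   The conventions of the two primitives fit together: the W-primitive is right continuous, which is
   what the right V-derivative of the next primitive needs, and the V-primitive is left continuous,
   which is what the left W-derivative needs.

   Moving between the torus and [0, 1) is harmless because neither measure charges 0: the primitive
   of a mean-zero function has equal values at 0 and 1, and integrals do not notice a change at the
   base point or outside the domain. Constants are invisible both to derivatives and to pairings
   with mean-zero functions, so density is always stated for recentered functions. *)
Require Import Defs.
From HB Require Import structures.
From mathcomp Require Import all_boot all_order all_algebra.
From mathcomp Require Import all_classical all_reals all_analysis.
From mathcomp Require Import measurable_realfun.
From mathcomp Require Import ring lra.
Set Implicit Arguments.
Unset Strict Implicit.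
Unset Printing Implicit Defensive.
Import Order.TTheory GRing.Theory Num.Theory.
Import numFieldNormedType.Exports.
Local Open Scope classical_set_scope.
Local Open Scope ring_scope.

(** * Square-integrable functions *)

Section L2.
Context d (T : measurableType d) (R : realType).
Variable m : {finite_measure set T -> \bar R}.
Implicit Types (f g h : T -> R) (a c e : R).

Definition L2 f := f \in Lfun m 2%:E.
Definition ip f g := \int[m]_x (f x * g x).
Definition nrm f := Num.sqrt (ip f f).
Definition mean f := (\int[m]_x f x) / fine (m setT).
Definition ctr f x := f x - mean f.
Definition bounded_mfun f := measurable_fun setT f /\ exists M : R, forall x, `|f x| <= M.

Lemma L2_measurable f : L2 f -> measurable_fun setT f.
Proof. by rewrite /L2 inE => /andP[]; rewrite inE. Qed.

Lemma L2D f g : L2 f -> L2 g -> L2 (fun x => f x + g x).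
Proof. by move=> fL gL; apply: (Lfun_addr_closed m (lee1n 2)).2. Qed.

Lemma L2_cst c : L2 (fun=> c).
Proof. exact: Lfun_cst. Qed.

Lemma L2Z a f : L2 f -> L2 (fun x => a * f x).
Proof.
move=> fL; have := (Lfun_submod_closed m (lee1n 2)).2 a f (cst 0) fL (L2_cst 0).
by rewrite addr0.
Qed.

Lemma L2N f : L2 f -> L2 (fun x => - f x).
Proof.
by move=> /(L2Z (-1)); congr (L2 _); apply/funext => x; rewrite mulN1r.
Qed.

Lemma L2B f g : L2 f -> L2 g -> L2 (fun x => f x - g x).
Proof. by move=> fL gL; apply: L2D => //; exact: L2N. Qed.

Lemma L2_integrable f : L2 f -> m.-integrable setT (EFin \o f).
Proof.
by move=> fL; apply/Lfun1_integrable/Lfun_subset12 => //; exact: fin_num_measure.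
Qed.

Lemma L2_integrableM f g : L2 f -> L2 g ->
  m.-integrable setT (EFin \o (fun x => f x * g x)).
Proof. by move=> fL gL; apply/Lfun1_integrable; exact: Lfun2_mul_Lfun1. Qed.

Lemma bounded_L2 f : bounded_mfun f -> L2 f.
Proof.
move=> [mf [M fM]]; rewrite /L2 inE; apply/andP; split; rewrite inE//=.
rewrite /finite_norm unlock /Lnorm poweR_lty//.
apply: (@le_lt_trans _ _ (\int[m]_x ((M ^+ 2)%:E))%E).
  apply: ge0_le_integral => //.
  - by move=> x _; rewrite poweR_ge0.
  - apply/measurable_EFinP.
    apply: (@measurableT_comp _ _ _ _ _ _ (@powR R ^~ 2)) => //.
    exact: measurableT_comp.
  - move=> x _ /=; rewrite lee_fin powR_mulrn//.
    by rewrite lerXn2r// ?nnegrE ?(le_trans _ (fM x)).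
rewrite integral_cst// ltey_eq fin_numM//; exact: fin_num_measure.
Qed.

Lemma ip_ge0 f : 0 <= ip f f.
Proof. by apply: Rintegral_ge0 => x _; rewrite -expr2 sqr_ge0. Qed.

Lemma nrm_ge0 f : 0 <= nrm f. Proof. exact: sqrtr_ge0. Qed.

Lemma nrm_sqr f : nrm f ^+ 2 = ip f f.
Proof. by rewrite sqr_sqrtr ?ip_ge0. Qed.

Lemma ipC f g : ip f g = ip g f.
Proof. by apply: eq_Rintegral => x _; rewrite mulrC. Qed.

Lemma ipDl f g h : L2 f -> L2 g -> L2 h ->
  ip (fun x => f x + g x) h = ip f h + ip g h.
Proof.
move=> fL gL hL; rewrite /ip -RintegralD//; [|exact: L2_integrableM..].
by apply: eq_Rintegral => x _; rewrite mulrDl.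
Qed.

Lemma ipZl a f h : L2 f -> L2 h -> ip (fun x => a * f x) h = a * ip f h.
Proof.
move=> fL hL; rewrite /ip -RintegralZl//; last exact: L2_integrableM.
by apply: eq_Rintegral => x _; rewrite mulrA.
Qed.

Lemma ipBl f g h : L2 f -> L2 g -> L2 h ->
  ip (fun x => f x - g x) h = ip f h - ip g h.
Proof.
move=> fL gL hL; rewrite /ip -RintegralB//; [|exact: L2_integrableM..].
by apply: eq_Rintegral => x _; rewrite mulrBl.
Qed.

Lemma ipDr f g h : L2 f -> L2 g -> L2 h ->
  ip h (fun x => f x + g x) = ip h f + ip h g.
Proof. by move=> *; rewrite ipC ipDl// !(ipC h). Qed.

Lemma ipBr f g h : L2 f -> L2 g -> L2 h ->
  ip h (fun x => f x - g x) = ip h f - ip h g.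
Proof. by move=> *; rewrite ipC ipBl// !(ipC h). Qed.

Lemma ipZr a f h : L2 f -> L2 h -> ip h (fun x => a * f x) = a * ip h f.
Proof. by move=> *; rewrite ipC ipZl// (ipC h). Qed.

Lemma CauchySchwarz f g : L2 f -> L2 g -> `|ip f g| <= nrm f * nrm g.
Proof.
move=> fL gL.
suff H : (ip f g) ^+ 2 <= ip f f * ip g g.
  rewrite -(@ler_pXn2r _ 2)// ?nnegrE ?mulr_ge0 ?nrm_ge0//.
  by rewrite exprMn !nrm_sqr real_normK// num_real.
have Q t : 0 <= ip f f + t * (2 * ip f g + t * ip g g).
  have := ip_ge0 (fun x => f x + t * g x).
  have tgL : L2 (fun x => t * g x) by exact: L2Z.
  rewrite ipDl ?ipDr ?ipZl ?ipZr//; last exact: L2D.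
  by rewrite (ipC g f) => /le_trans; apply; rewrite le_eqVlt; apply/orP; left; apply/eqP; ring.
(* If [ip g g] is 0, the quadratic is affine in t and, unless [ip f g] vanishes too, takes the value
   -1 at the chosen t. Otherwise t is its minimizer. *)
have := ip_ge0 g; rewrite le_eqVlt => /orP[/eqP g0|g0].
  rewrite -g0 mulr0; have [->|n0] := eqVneq (ip f g) 0; first by rewrite expr0n.
  have := Q (- (ip f f + 1) / (2 * ip f g)); rewrite -g0 mulr0 addr0.
  by rewrite divfK ?mulf_neq0//; lra.
have := Q (- ip f g / ip g g).
rewrite (_ : _ + _ = ip f f - ip f g ^+ 2 / ip g g); last by field; lra.
by rewrite subr_ge0 ler_pdivrMr.
Qed.

Lemma nrmD f g : L2 f -> L2 g -> nrm (fun x => f x + g x) <= nrm f + nrm g.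
Proof.
move=> fL gL; rewrite -(@ler_pXn2r _ 2)// ?nnegrE ?addr_ge0 ?nrm_ge0//.
rewrite nrm_sqr ipDl ?ipDr//; last exact: L2D.
have := CauchySchwarz fL gL; rewrite ler_norml => /andP[_].
by rewrite sqrrD !nrm_sqr (ipC g f) mulr2n; lra.
Qed.

Lemma nrmZ a f : L2 f -> nrm (fun x => a * f x) = `|a| * nrm f.
Proof.
move=> fL; rewrite /nrm ipZl ?ipZr//; last exact: L2Z.
by rewrite mulrA -expr2 sqrtrM ?sqr_ge0// sqrtr_sqr.
Qed.

Lemma eq_nrm f g : f =1 g -> nrm f = nrm g.
Proof. by move=> /funext ->. Qed.

Lemma nrmB f g : L2 f -> L2 g -> nrm (fun x => f x - g x) <= nrm f + nrm g.
Proof.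
move=> fL gL; have := nrmD fL (L2Z (-1) gL); rewrite nrmZ// normrN1 mul1r.
by rewrite (@eq_nrm _ (fun x => f x - g x))// => x; rewrite mulN1r.
Qed.

Lemma nrmC f g : nrm (fun x => f x - g x) = nrm (fun x => g x - f x).
Proof.
by rewrite /nrm; congr Num.sqrt; apply: eq_Rintegral => x _; rewrite -mulrNN !opprB.
Qed.

Lemma nrm_triangle h f g : L2 f -> L2 g -> L2 h ->
  nrm (fun x => f x - g x) <= nrm (fun x => f x - h x) + nrm (fun x => h x - g x).
Proof.
move=> fL gL hL; have := nrmD (L2B fL hL) (L2B hL gL).
by rewrite (@eq_nrm _ (fun x => f x - g x))// => x; rewrite subrKA.
Qed.

Lemma fine_mT_ge0 : 0 <= fine (m setT).
Proof. exact/fine_ge0/measure_ge0. Qed.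

Lemma nrm_cst c : nrm (fun=> c) = `|c| * Num.sqrt (fine (m setT)).
Proof. by rewrite /nrm /ip Rintegral_cst// -expr2 sqrtrM ?sqr_ge0// sqrtr_sqr. Qed.

Lemma le_nrm f g : L2 f -> L2 g -> (forall x, `|f x| <= `|g x|) -> nrm f <= nrm g.
Proof.
move=> fL gL fg; apply: ler_wsqrtr; apply: le_Rintegral => //; [exact: L2_integrableM..|].
move=> x _; rewrite -!expr2 -(real_normK (num_real (f x))).
by rewrite -(real_normK (num_real (g x))) lerXn2r.
Qed.

Lemma nrm_le_sup f M : measurable_fun setT f -> (forall x, `|f x| <= M) ->
  nrm f <= M * Num.sqrt (fine (m setT)).
Proof.
move=> mf fM.
have [M0|M0] := leP 0 M.
  rewrite -[X in _ <= X * _](ger0_norm M0) -nrm_cst; apply: le_nrm.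
  - by apply: bounded_L2; split => //; exists M.
  - exact: L2_cst.
  - by move=> x; rewrite (ger0_norm M0).
(* A negative M contradicts the bound at any point, and [T] is pointed. *)
suff : exists x : T, True by move=> [x _]; have := le_lt_trans (fM x) M0; rewrite normr_lt0.
by exists point.
Qed.

Lemma L2_norm f : L2 f -> L2 (fun x => `|f x|).
Proof.
move=> fL; have := fL; rewrite /L2 !inE => /andP[mf].
rewrite inE/= /finite_norm => H; apply/andP; split.
  by rewrite inE; apply: measurableT_comp => //; exact: L2_measurable.
rewrite inE/= /finite_norm.
by under [X in ('N[_]__[X])%E]eq_fun => x do rewrite /= -abse_EFin; rewrite Lnorm_abse.
Qed.

(** Cauchy-Schwarz against the constant 1. *)
Lemma L1_le_nrm f : L2 f -> \int[m]_x `|f x| <= Num.sqrt (fine (m setT)) * nrm f.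
Proof.
move=> fL; have := CauchySchwarz (L2_norm fL) (L2_cst 1).
rewrite nrm_cst normr1 mul1r mulrC.
have -> : nrm (fun x => `|f x|) = nrm f.
  by rewrite /nrm; congr Num.sqrt; apply: eq_Rintegral => x _; rewrite -!expr2 real_normK ?num_real.
apply: le_trans; apply: le_trans (ler_norm _).
by rewrite le_eqVlt; apply/orP; left; apply/eqP/eq_Rintegral => x _; rewrite mulr1.
Qed.

Lemma int_le_nrm f : L2 f -> `|\int[m]_x f x| <= Num.sqrt (fine (m setT)) * nrm f.
Proof.
move=> fL; apply: le_trans (L1_le_nrm fL); apply: le_normr_Rintegral => //.
exact: L2_integrable.
Qed.

Lemma meanK f : fine (m setT) != 0 -> fine (m setT) * mean f = \int[m]_x f x.
Proof. by move=> n0; rewrite /mean mulrC divfK. Qed.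

Lemma L2_ctr f : L2 f -> L2 (ctr f).
Proof. by move=> fL; apply: L2B => //; exact: L2_cst. Qed.

Lemma meanD f g : L2 f -> L2 g -> mean (fun x => f x + g x) = mean f + mean g.
Proof. by move=> *; rewrite /mean RintegralD ?mulrDl//; exact: L2_integrable. Qed.

Lemma meanZ a f : L2 f -> mean (fun x => a * f x) = a * mean f.
Proof. by move=> *; rewrite /mean RintegralZl ?mulrA//; exact: L2_integrable. Qed.

Lemma meanB f g : L2 f -> L2 g -> mean (fun x => f x - g x) = mean f - mean g.
Proof. by move=> *; rewrite /mean RintegralB ?mulrBl//; exact: L2_integrable. Qed.

Lemma ctrB f g : L2 f -> L2 g ->
  ctr (fun x => f x - g x) = (fun x => ctr f x - ctr g x).
Proof. by move=> fL gL; apply/funext => x; rewrite /ctr meanB//; ring. Qed.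

Lemma ctr_cst c : fine (m setT) != 0 -> ctr (fun=> c) = (fun=> 0).
Proof.
by move=> n0; apply/funext => x; rewrite /ctr /mean Rintegral_cst// mulfK// subrr.
Qed.

(** Centering is the orthogonal projection away from the constants: for nonzero mass, the squared
    norm drops by the total mass times the squared mean. *)
Lemma nrm_ctr f : L2 f -> nrm (ctr f) <= nrm f.
Proof.
move=> fL; apply: ler_wsqrtr.
(* With zero total mass the division in [mean] returns 0 and centering does nothing. *)
have [T0|n0] := eqVneq (fine (m setT)) 0.
  rewrite (_ : ctr f = f)//; apply/funext => x.
  by rewrite /ctr /mean T0 invr0 mulr0 subr0.
have cL := L2_cst (mean f).
rewrite /ctr (ipBl fL cL (L2_ctr fL)) (ipBr fL cL fL) (ipBr fL cL cL).
rewrite {4}/ip Rintegral_cst// (ipC f).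
have -> : ip (fun=> mean f) f = mean f * \int[m]_x f x.
  by rewrite /ip RintegralZl//; exact: L2_integrable.
rewrite -meanK//.
have := fine_mT_ge0; set M := fine _; set a := mean f => M0.
have : 0 <= M * a ^+ 2 by rewrite mulr_ge0 ?sqr_ge0.
by lra.
Qed.

Lemma EFin_ip f g : L2 f -> L2 g -> (\int[m]_x (f x * g x)%:E)%E = (ip f g)%:E.
Proof.
move=> fL gL; rewrite /ip /Rintegral fineK//.
exact/integrable_fin_num/L2_integrableM.
Qed.

Lemma LnormE f : L2 f -> 'N[m]_2%:E[EFin \o f]%E = (nrm f)%:E.
Proof.
move=> fL; rewrite unlock /Lnorm.
under eq_integral => x _ do rewrite /= powR_mulrn// real_normK ?num_real// expr2.
rewrite EFin_ip// poweR_EFin powR12_sqrt//; exact: ip_ge0.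
Qed.

Lemma le_nrm_ae f g : L2 f -> L2 g -> {ae m, forall x, `|f x| <= `|g x|} -> nrm f <= nrm g.
Proof.
move=> fL gL fg; apply: ler_wsqrtr; rewrite -lee_fin -!EFin_ip//.
apply: ae_ge0_le_integral => //.
- by move=> x _; rewrite lee_fin -expr2 sqr_ge0.
- by apply/measurable_EFinP; apply: measurable_funM; exact: (L2_measurable fL).
- by move=> x _; rewrite lee_fin -expr2 sqr_ge0.
- by apply/measurable_EFinP; apply: measurable_funM; exact: (L2_measurable gL).
case: fg => N [mN N0 sN]; exists N; split => // x /= Hx; apply: sN => /= fgx.
apply: Hx => _; rewrite lee_fin -!expr2 -(real_normK (num_real (f x))).
by rewrite -(real_normK (num_real (g x))) lerXn2r.
Qed.

Lemma sqr_integrable_L2 f : measurable_fun setT f ->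
  (\int[m]_x (f x ^+ 2)%:E < +oo)%E -> L2 f.
Proof.
move=> mf foo; rewrite /L2 inE; apply/andP; split; rewrite inE//=.
rewrite /finite_norm unlock /Lnorm poweR_lty//.
by under eq_integral => x _ do rewrite /= powR_mulrn// real_normK ?num_real//.
Qed.

(** * The Riesz-Fischer theorem *)

Lemma summable_diff_cvgn (u : nat -> R) (M : R) :
  (forall n, \sum_(0 <= k < n) `|u k.+1 - u k| <= M) -> cvgn u.
Proof.
move=> uM.
have /normed_cvg H : cvgn [normed series (fun k => u k.+1 - u k)].
  apply: nondecreasing_is_cvgn; last by exists M => _ [n _ <-]; exact: uM.
  apply/nondecreasing_seqP => n. by rewrite [leRHS]seriesSr lerDl; exact: normr_ge0.
have -> : u = (fun n => u 0%N + series (fun k => u k.+1 - u k) n).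
  by apply/funext => n; rewrite /series/= telescope_sumr// addrC subrK.
by apply: is_cvgD => //; exact: is_cvg_cst.
Qed.

Lemma limn_einf_le (u : (\bar R)^nat) (l : \bar R) N :
  (forall n, (N <= n)%N -> (u n <= l)%E) -> (limn_einf u <= l)%E.
Proof.
move=> ul; rewrite limn_einf_lim; apply: lime_le; first exact: is_cvg_einfs.
near=> n; apply: (@le_trans _ _ (u (maxn N n))); last by apply: ul; exact: leq_maxl.
by apply: ereal_inf_lbound; exists (maxn N n) => //=; exact: leq_maxr.
Unshelve. all: by end_near. Qed.

(** A subsequence v whose consecutive distances are below 1 / 2^(k+1) has increments with an
    integrable absolute sum. This sum is finite almost everywhere, and v converges there. Fatou's
    lemma then turns Cauchy bounds into bounds on the distance to the limit. *)
Lemma RieszFischer (u : nat -> T -> R) : (forall n, L2 (u n)) ->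
  (forall e : R, 0 < e -> exists N, forall i j, (N <= i)%N -> (N <= j)%N ->
    nrm (fun x => u i x - u j x) < e) ->
  exists F, L2 F /\ forall e : R, 0 < e -> exists N, forall n, (N <= n)%N ->
    nrm (fun x => u n x - F x) <= e.
Proof.
move=> uL uC.
have /choice[N0 N0P] (k : nat) : exists N : nat, forall i j, (N <= i)%N -> (N <= j)%N ->
    nrm (fun x => u i x - u j x) < (1 / (2 ^ (k + 1))%:R).
  by apply: uC; rewrite divr_gt0// ltr0n expn_gt0.
(* The maximum puts [phi k] past every threshold up to k; the summand k gives [phi k] at least k, so
   the Cauchy property of u also compares late terms of v with late terms of u. *)
pose phi k := (k + \max_(i < k.+1) N0 i)%N.
have phiP k i : (k <= i)%N -> (N0 k <= phi i)%N.
  move=> ki; apply: leq_trans (leq_addl _ _).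
  exact: (leq_bigmax (Ordinal (ki : (k < i.+1)%N))).
pose v k := u (phi k).
have vL k : L2 (v k) by exact: uL.
pose g x := (\sum_(k <oo) (`|v k.+1 x - v k x|)%:E)%E.
have mdv k : measurable_fun setT (fun x => (`|v k.+1 x - v k x|)%:E).
  apply/measurable_EFinP; apply: measurableT_comp => //.
  exact/(L2_measurable (L2B (vL _) (vL _))).
have mg : measurable_fun setT g by apply: ge0_emeasurable_sum.
have g0 x : (0 <= g x)%E by apply: nneseries_ge0.
pose C := Num.sqrt (fine (m setT)).
have gfin : (\int[m]_x g x < +oo)%E.
  rewrite /g integral_nneseries//.
  apply: (@le_lt_trans _ _ (C%:E * (1 / 2 ^+ 0)%:E)%E); last by rewrite -EFinM ltry.
  rewrite -(cvg_lim _ (@cvg_geometric_eseries_half R 1 0))//.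
  rewrite -nneseriesZl//.
  apply: lee_nneseries => [k _ _|k _]; first exact: integral_ge0.
  have dL := L2B (vL k.+1) (vL k).
  have := L1_le_nrm dL => H.
  rewrite -[X in (X <= _)%E]fineK; last first.
    exact/integrable_fin_num/L2_integrable/L2_norm.
  rewrite -EFinM lee_fin; apply: (le_trans H); rewrite ler_wpM2l ?sqrtr_ge0//.
  by apply/ltW/N0P; exact: phiP.
have gint : m.-integrable setT g.
  apply/integrableP; split => //.
  by under eq_integral => x _ do rewrite gee0_abs//.
pose E := [set x | (g x < +oo)%E].
have mE : measurable E.
  by rewrite -[E]setTI; exact: emeasurable_fun_infty_o.
have vE x : E x -> cvgn (v^~ x).
  move=> Ex; apply: (@summable_diff_cvgn _ (fine (g x))) => n.
  rewrite -lee_fin fineK ?ge0_fin_numE//.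
  by rewrite -sumEFin; apply: nneseries_lim_ge.
have aeE : {ae m, forall x, E x}.
  have := integrable_ae measurableT gint; apply: filterS => x /(_ I).
  by rewrite ge0_fin_numE.
(* Cutting off outside E gives convergence at every point, hence a measurable limit. *)
pose w k x := v k x * \1_E x.
pose F x := lim (w k x @[k --> \oo]).
have mw k : measurable_fun setT (w k).
  by apply: measurable_funM; [exact: L2_measurable (vL k)|exact: measurable_indic].
have wF x : w k x @[k --> \oo] --> F x.
  rewrite /F /w indicE; have [/set_mem xE|xE] := boolP (x \in E).
    by apply: is_cvgMl; exact: vE.
  by under eq_fun do rewrite mulr0; exact: is_cvg_cst.
have mF : measurable_fun setT F.
  by apply: (measurable_fun_cvg mw) => x _; exact: wF.
(* The distance from [F] to a term of u is bounded by any eventual bound on the distances from v to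
   that term. Membership of [F] in L^2 is then read off from one such difference. *)
have key n e N : 0 <= e -> (forall k, (N <= k)%N -> nrm (fun x => v k x - u n x) <= e) ->
    (\int[m]_x ((F x - u n x) ^+ 2)%:E <= (e ^+ 2)%:E)%E.
  move=> e0 Ne.
  have mh k : measurable_fun setT (fun x => ((w k x - u n x) ^+ 2)%:E).
    apply/measurable_EFinP/measurable_funX/measurable_funB => //.
    exact: L2_measurable.
  have := @fatou _ _ _ m setT measurableT (fun k x => ((w k x - u n x) ^+ 2)%:E) mh.
  move=> /(_ (fun _ _ _ => sqr_ge0 _)).
  rewrite (_ : (\int[m]_x limn_einf _ = \int[m]_x ((F x - u n x) ^+ 2)%:E)%E); last first.
    apply: eq_integral => x _; apply: (cvg_limn_einf_sup _).1.
    apply: cvg_EFin; first by apply: nearW.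
    rewrite (_ : fine \o _ = (fun k => (w k x - u n x) ^+ 2))//.
    by rewrite expr2; under eq_fun do rewrite expr2; apply: cvgM;
       (apply: cvgB; [exact: wF|exact: cvg_cst]).
  move=> /le_trans; apply; apply: (@limn_einf_le _ _ N) => k Nk.
  rewrite (_ : (\int[m]_x _)%E = (\int[m]_x ((v k x - u n x) * (v k x - u n x))%:E)%E).
    rewrite EFin_ip; [|exact: L2B..].
    by rewrite lee_fin -nrm_sqr lerXn2r ?nnegrE ?nrm_ge0 ?Ne.
  apply: ge0_ae_eq_integral => //.
  - apply/measurable_EFinP; apply: measurable_funM;
      exact: L2_measurable (L2B (vL _) (uL _)).
  - by move=> x _; rewrite lee_fin sqr_ge0.
  - by move=> x _; rewrite lee_fin -expr2 sqr_ge0.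
  apply: filterS aeE => x Ex _.
  by rewrite /w indicE mem_set// mulr1 expr2.
have FuL n e N : 0 <= e -> (forall k, (N <= k)%N -> nrm (fun x => v k x - u n x) <= e) ->
    L2 (fun x => F x - u n x) /\ nrm (fun x => F x - u n x) <= e.
  move=> e0 Ne.
  have H := key _ _ _ e0 Ne.
  have L : L2 (fun x => F x - u n x).
    apply: sqr_integrable_L2; last exact: le_lt_trans H (ltry _).
    by apply: measurable_funB => //; exact: L2_measurable.
  split => //; rewrite -(@ler_pXn2r _ 2)// ?nnegrE ?nrm_ge0//.
  by rewrite nrm_sqr -lee_fin -EFin_ip//; under eq_integral do rewrite -expr2.
have vu e : 0 < e -> exists N, forall n, (N <= n)%N ->
    forall k, (N <= k)%N -> nrm (fun x => v k x - u n x) <= e.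
  move=> e0; have [N NP] := uC _ e0; exists N => n Nn k Nk.
  by apply/ltW/NP => //; apply: (leq_trans Nk); exact: leq_addr.
exists F; split.
  have [N NP] := vu _ ltr01; have [L _] := FuL _ _ _ ler01 (NP _ (leqnn N)).
  by have := L2D L (uL N); congr L2; apply/funext => x; rewrite subrK.
move=> e e0; have [N NP] := vu _ e0; exists N => n Nn.
by rewrite nrmC; exact: (FuL _ _ _ (ltW e0) (NP _ Nn)).2.
Qed.

Lemma indic_L2 (A : set T) : measurable A -> L2 \1_A.
Proof.
move=> mA; apply: bounded_L2; split; first exact: measurable_indic.
by exists 1 => x; rewrite indicE; case: (_ \in _); rewrite /= ?normr1 ?normr0.
Qed.

Lemma nrm_dominated_cvg (u : nat -> T -> R) f g :
  L2 g -> L2 f -> (forall n, L2 (u n)) -> (forall n x, `|u n x - f x| <= `|g x|) ->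
  (forall x, u n x @[n --> \oo] --> f x) ->
  forall e : R, 0 < e -> exists n, nrm (fun x => u n x - f x) < e.
Proof.
move=> gL fL uL ug uf e e0.
have dL n : L2 (fun x => u n x - f x) by exact: L2B.
have [| | | | |_ _] := @dominated_convergence _ _ _ m setT measurableT
  (fun n x => ((u n x - f x) * (u n x - f x))%:E) (fun=> 0%E)
  (fun x => (g x * g x)%:E).
- by move=> n; apply/measurable_EFinP; apply: measurable_funM; exact: L2_measurable (dL n).
- exact: measurable_cst.
- apply: nearW => x _; apply: cvg_EFin; first exact: nearW.
  rewrite (_ : fine \o _ = (fun k => (u k x - f x) * (u k x - f x)))//.
  have -> : 0%R = (f x - f x) * (f x - f x) :> R by rewrite subrr mul0r.
  by apply: cvgM; apply: cvgB; [exact: uf|exact: cvg_cst|exact: uf|exact: cvg_cst].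
- exact: L2_integrableM.
- apply: nearW => x n _; rewrite /= lee_fin -!expr2 normrX.
  by rewrite -[leRHS]real_normK ?num_real// lerXn2r.
rewrite integral0 => /fine_cvgP[_]/cvgrPdist_lt/(_ (e ^+ 2)); rewrite exprn_gt0// => /(_ isT).
move=> [N _ /(_ N (leqnn N))] /=.
rewrite sub0r normrN => H; exists N.
rewrite -(@ltr_pXn2r _ 2)// ?nnegrE ?nrm_ge0 ?ltW// nrm_sqr.
by apply: le_lt_trans H; exact: ler_norm.
Qed.

(** * Dense subspaces *)

Section density.
Variable A : set (T -> R).
Hypotheses (AD : forall f g, L2 f -> L2 g -> A f -> A g -> A (fun x => f x + g x))
  (AZ : forall a f, L2 f -> A f -> A (fun x => a * f x))
  (A1 : A (fun=> 1))
  (Acl : forall f, L2 f ->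
    (forall e, 0 < e -> exists g, [/\ L2 g, A g & nrm (fun x => g x - f x) < e]) -> A f).

Lemma A0 : A (fun=> 0).
Proof. by have := AZ 0 (L2_cst 1) A1; congr A; apply/funext => x; rewrite mul0r. Qed.

Lemma Asum (I : Type) (s : seq I) (u : I -> T -> R) :
  (forall i, L2 (u i)) -> (forall i, A (u i)) ->
  L2 (fun x => \sum_(i <- s) u i x) /\ A (fun x => \sum_(i <- s) u i x).
Proof.
move=> uL uA; elim: s => [|i s [IHL IHA]].
  rewrite (_ : (fun x => _) = (fun=> 0)); last by apply/funext => x; rewrite big_nil.
  by split; [exact: L2_cst|exact: A0].
rewrite (_ : (fun x => _) = (fun x => u i x + \sum_(i <- s) u i x)).
  by split; [exact: L2D|exact: AD].
by apply/funext => x; rewrite big_cons.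
Qed.

(** Dynkin's theorem: complements come from 1 - 1_S, and the indicator of a disjoint union is the
    limit of partial sums dominated by 1. *)
Lemma A_indic (G : set (set T)) : @measurable _ T = <<s G >> -> setI_closed G ->
  (forall B, G B -> A \1_B) -> forall B, measurable B -> A \1_B.
Proof.
move=> GE GI GA B; rewrite GE.
apply: (@dynkin_induction _ T G (fun B => A \1_B)) => //.
- by rewrite indicT.
- move=> S mS AS.
  have := AD (L2_cst 1) (L2Z (-1) (indic_L2 mS)) A1 (AZ (-1) (indic_L2 mS) AS).
  congr A; apply/funext => x; rewrite !indicE in_setC.
  by case: (_ \in _) => /=; rewrite ?mulr1 ?mulr0 ?subrr ?addr0.
- move=> F mF tF AF.
  pose u n x : R := \sum_(0 <= i < n) \1_(F i) x.
  have uLA n : L2 (u n) /\ A (u n).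
    by apply: Asum => // i; exact: indic_L2.
  apply: Acl => [|e e0]; first by apply: indic_L2; exact: bigcupT_measurable.
  (* By disjointness at most one summand is nonzero at x, so the partial sum is 0 or 1 and jumps
     once, just after the index of the set containing x. *)
  have uE x n : (exists2 i, F i x & u n x = (i < n)%:R) \/ (~ (\bigcup_k F k) x) /\ u n x = 0.
    have [[i _ Fix]|nF] := pselect ((\bigcup_k F k) x); [left; exists i => //|right; split=> //].
      rewrite /u; elim: n => [|n IHn]; first by rewrite big_nil.
      rewrite big_nat_recr//= IHn indicE ltnS [in RHS]leq_eqVlt.
      have [<-|ni] := eqVneq i n; first by rewrite ltnn mem_set// add0r.
      rewrite memNset ?addr0// => Fnx; move/eqP: ni; apply.
      by apply: tF => //; exists x.
    rewrite /u big1// => i _; rewrite indicE memNset// => Fx; apply: nF.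
    by exists i.
  have mU : measurable (\bigcup_k F k) by exact: bigcupT_measurable.
  have [||n nP] := @nrm_dominated_cvg u \1_(\bigcup_k F k) (fun=> 1)
    (L2_cst 1) (indic_L2 mU) (fun n => (uLA n).1) _ _ e e0.
  - move=> n x; rewrite normr1 indicE.
    case: (uE x n) => [[i Fix ->]|[nF ->]].
      by rewrite mem_set; [case: (_ < _)%N; rewrite ?subrr ?sub0r ?normrN ?normr0 ?normr1|exists i].
    by rewrite memNset// subrr normr0.
  - move=> x; rewrite indicE; have [|[nF _]] := uE x 0.
      move=> [i Fix _]; rewrite mem_set; last by exists i.
      apply/cvgrPdist_lt => r r0; exists i.+1 => // n /= ni.
      case: (uE x n) => [[j Fjx ->]|[nF _]]; last by exfalso; apply: nF; exists i.
      have -> : j = i by apply: tF => //; exists x.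
      by rewrite ni subrr normr0.
    rewrite memNset//; apply/cvgrPdist_lt => r r0; exists 0 => // n _.
    case: (uE x n) => [[j Fjx _]|[_ ->]]; last by rewrite subrr normr0.
    by exfalso; apply: nF; exists j.
  by exists (u n); split; [exact: (uLA n).1|exact: (uLA n).2|].
Qed.

Import HBNNSimple.

(** From indicators to simple functions by linearity, to nonnegative functions by monotone
    approximation under the domination of f itself, and to all functions by positive and negative
    parts. *)
Theorem L2_density (G : set (set T)) : @measurable _ T = <<s G >> -> setI_closed G ->
  (forall B, G B -> A \1_B) -> forall f, L2 f -> A f.
Proof.
move=> GE GI GA.
have AI := A_indic GE GI GA.
have Asf (f : {nnsfun T >-> R}) : L2 f /\ A f.
  have -> : (f : T -> R) = (fun x =>
      \sum_(r <- finmap.enum_fset (fset_set (range f))) r * \1_(f @^-1` [set r]) x).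
    apply/funext => x; rewrite [LHS]fimfunE fsbig_finite//=.
  have mB r : measurable (f @^-1` [set r]) by exact: measurable_funPTI.
  apply: (@Asum _ _ (fun r x => r * \1_(f @^-1` [set r]) x)) => r.
    exact/L2Z/indic_L2.
  by apply: AZ; [exact: indic_L2|exact: AI].
have Apos f : L2 f -> (forall x, 0 <= f x) -> A f.
  move=> fL f0; apply: Acl => // e e0.
  have mf : measurable_fun setT (EFin \o f) by exact/measurable_EFinP/(L2_measurable fL).
  pose u n := nnsfun_approx measurableT mf n.
  have uf x : u n x @[n --> \oo] --> f x.
    have /fine_cvgP[_] := cvg_nnsfun_approx measurableT mf (fun x _ => f0 x) (I : setT x).
    exact.
  have uM x : {homo u ^~ x : i j / (i <= j)%N >-> i <= j}.
    by move=> i j ij; apply/lefP/nd_nnsfun_approx.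
  have ule n x : u n x <= f x.
    rewrite -(cvg_lim _ (uf x))//; apply: nondecreasing_cvgn_le => //.
    by apply/cvg_ex; exists (f x).
  have [||n nP] := @nrm_dominated_cvg u f f fL fL (fun n => (Asf (u n)).1) _ _ e e0.
  - move=> n x; rewrite distrC !ger0_norm ?subr_ge0//.
    by rewrite lerBlDr lerDl.
  - exact: uf.
  by exists (u n); split; [exact: (Asf _).1|exact: (Asf _).2|].
move=> f fL.
have absL := L2_norm fL.
have pL : L2 (fun x => 2^-1 * (`|f x| + f x)) by apply/L2Z/L2D.
have qL : L2 (fun x => 2^-1 * (`|f x| - f x)) by apply/L2Z/L2B.
have Ap := Apos _ pL; have Aq := Apos _ qL.
have -> : f = (fun x => 2^-1 * (`|f x| + f x) + (-1) * (2^-1 * (`|f x| - f x))).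
  by apply/funext => x; field.
apply: AD => //; first exact: L2Z.
- apply: Ap => x; rewrite mulr_ge0// addrC -lerBlDr sub0r.
  by have := lerNnormlW (lexx `|f x|); rewrite lerNl.
- by apply: AZ => //; apply: Aq => x; rewrite mulr_ge0// subr_ge0 ler_norm.
Qed.

End density.

End L2.

(** * Primitives and their adjointness *)

Section primitives.
Context (R : realType).
Local Notation TR := (measurableTypeR R).
Implicit Types (m : {finite_measure set TR -> \bar R}) (f g h k : R -> R).

(* The atom at [x] itself is left out by [prim_lt], which makes it caglad, and
   included by [prim_le], which makes it cadlag. *)
Definition prim_lt m h x := \int[m]_y (\1_(`]-oo, x[) y * h y).
Definition prim_le m k x := \int[m]_y (\1_(`]-oo, x]) y * k y).

Lemma L2_mul_indic m (A : set TR) k : measurable A -> L2 m k ->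
  L2 m (fun x => \1_A x * k x).
Proof.
move=> mA kL; have := kL; rewrite /L2 !inE => /andP[mk].
rewrite inE/= => fk; apply/andP; split.
  by rewrite inE; apply: measurable_funM;
    [exact: measurable_indic|exact: (L2_measurable kL)].
rewrite inE/= /finite_norm; apply: le_lt_trans fk.
rewrite unlock /Lnorm gt0_ler_poweR//.
- by rewrite in_itv/= leey integral_ge0// => x _; rewrite poweR_ge0.
- by rewrite in_itv/= leey integral_ge0// => x _; rewrite poweR_ge0.
apply: ge0_le_integral => //.
- by move=> x _; rewrite poweR_ge0.
- apply/measurable_EFinP.
  apply: (@measurableT_comp _ _ _ _ _ _ (@powR R ^~ 2)) => //.
  apply: measurableT_comp => //.
  by apply: measurable_funM;
    [exact: measurable_indic|exact: (L2_measurable kL)].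
- apply/measurable_EFinP.
  apply: (@measurableT_comp _ _ _ _ _ _ (@powR R ^~ 2)) => //.
  by apply: measurableT_comp => //; exact: (L2_measurable kL).
- move=> x _ /=; rewrite lee_fin ge0_ler_powR// ?nnegrE// normrM indicE.
  by case: (_ \in _); rewrite ?normr1 ?normr0 ?mul1r ?mul0r.
Qed.

Lemma measurable_ray_lt (x : R) : measurable (`]-oo, x[%classic : set TR).
Proof. exact: measurable_itv. Qed.

Lemma measurable_ray_le (x : R) : measurable (`]-oo, x]%classic : set TR).
Proof. exact: measurable_itv. Qed.

Lemma integrable_lt m x h : L2 m h ->
  m.-integrable setT (EFin \o (fun y => \1_(`]-oo, x[) y * h y)).
Proof. by move=> hL; apply: L2_integrable; apply: L2_mul_indic => //; exact: measurable_ray_lt. Qed.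

Lemma integrable_le m x h : L2 m h ->
  m.-integrable setT (EFin \o (fun y => \1_(`]-oo, x]) y * h y)).
Proof. by move=> hL; apply: L2_integrable; apply: L2_mul_indic => //; exact: measurable_ray_le. Qed.

Lemma indic_ray_le (x : R) (y : TR) : \1_(`]-oo, x]) y = ((y : R) <= x)%R%:R :> R.
Proof. by rewrite indicE mem_setE in_itv. Qed.

Lemma indic_ray_lt (x : R) (y : TR) : \1_(`]-oo, x[) y = ((y : R) < x)%R%:R :> R.
Proof. by rewrite indicE mem_setE in_itv. Qed.

Lemma int_indic_le m (A : set TR) k : measurable A -> L2 m k ->
  `|\int[m]_x (\1_A x * k x)| <= \int[m]_x `|k x|.
Proof.
move=> mA kL; have kA := L2_mul_indic mA kL.
apply: (le_trans (le_normr_Rintegral measurableT (L2_integrable kA))).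
apply: le_Rintegral => //; [exact/L2_integrable/L2_norm..|].
move=> x _; rewrite normrM indicE.
by case: (_ \in _); rewrite ?normr1 ?normr0 ?mul1r ?mul0r.
Qed.

Lemma prim_lt_bound m h x : L2 m h ->
  `|prim_lt m h x| <= Num.sqrt (fine (m setT)) * nrm m h.
Proof.
by move=> hL; apply: le_trans (L1_le_nrm hL); apply: int_indic_le => //; exact: measurable_ray_lt.
Qed.

Lemma prim_le_bound m h x : L2 m h ->
  `|prim_le m h x| <= Num.sqrt (fine (m setT)) * nrm m h.
Proof.
by move=> hL; apply: le_trans (L1_le_nrm hL); apply: int_indic_le => //; exact: measurable_ray_le.
Qed.

Lemma prim_ltB m h g : L2 m h -> L2 m g ->
  prim_lt m (fun x => h x - g x) = (fun x => prim_lt m h x - prim_lt m g x).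
Proof.
move=> hL gL; apply/funext => x; rewrite /prim_lt -RintegralB//; [|exact: integrable_lt..].
by apply: eq_Rintegral => y _; rewrite mulrBr.
Qed.

Lemma prim_leB m h g : L2 m h -> L2 m g ->
  prim_le m (fun x => h x - g x) = (fun x => prim_le m h x - prim_le m g x).
Proof.
move=> hL gL; apply/funext => x; rewrite /prim_le -RintegralB//; [|exact: integrable_le..].
by apply: eq_Rintegral => y _; rewrite mulrBr.
Qed.

Lemma prim_ltZ m a h : L2 m h ->
  prim_lt m (fun x => a * h x) = (fun x => a * prim_lt m h x).
Proof.
move=> hL; apply/funext => x; rewrite /prim_lt -RintegralZl//; last exact: integrable_lt.
by apply: eq_Rintegral => y _; rewrite mulrCA.
Qed.

Lemma prim_leZ m a h : L2 m h ->
  prim_le m (fun x => a * h x) = (fun x => a * prim_le m h x).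
Proof.
move=> hL; apply/funext => x; rewrite /prim_le -RintegralZl//; last exact: integrable_le.
by apply: eq_Rintegral => y _; rewrite mulrCA.
Qed.

Lemma prim_ltB_itv m h x y : L2 m h -> x <= y ->
  prim_lt m h y - prim_lt m h x = \int[m]_t (\1_(`[x, y[) t * h t).
Proof.
move=> hL xy; rewrite /prim_lt -RintegralB//; [|exact: integrable_lt..].
apply: eq_Rintegral => t _; rewrite -mulrBl; congr (_ * _).
rewrite !indicE !mem_setE !in_itv/=.
have [tx|xt] := ltP t x; first by rewrite (lt_le_trans tx xy) subrr.
by rewrite subr0.
Qed.

Lemma prim_leB_itv m h x y : L2 m h -> x <= y ->
  prim_le m h y - prim_le m h x = \int[m]_t (\1_(`]x, y]) t * h t).
Proof.
move=> hL xy; rewrite /prim_le -RintegralB//; [|exact: integrable_le..].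
apply: eq_Rintegral => t _; rewrite -mulrBl; congr (_ * _).
rewrite !indicE !mem_setE !in_itv/=.
have [tx|xt] := leP t x; first by rewrite (le_trans tx xy) subrr.
by rewrite subr0.
Qed.

Lemma measurable_le2 : measurable_fun setT (fun z : TR * TR => ((z.1 : R) <= z.2)%R%:R : R).
Proof.
rewrite (_ : (fun z => _) = (fun z : TR * TR => if ((z.1 : R) <= z.2)%R then 1 else 0)).
  apply: measurable_fun_ifT => //.
  by apply: measurable_fun_ler; [exact: measurable_fst|exact: measurable_snd].
by apply/funext => z; case: ifP.
Qed.

(** [prim_le] integrates the kernel 1(x <= y) in its first variable, and [prim_lt] is complementary
    to its integral in the second. Tonelli bounds the integral of the absolute value by a product of
    two L^1 norms. *)
Lemma integrable_kernel m1 m2 k h : L2 m1 k -> L2 m2 h ->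
  (m1 \x m2)%E.-integrable setT
    (fun z : TR * TR => (((z.1 : R) <= z.2)%R%:R * k z.1 * h z.2)%:E).
Proof.
move=> kL hL.
have mk1 : measurable_fun setT (fun z : TR * TR => k z.1).
  by apply: (measurableT_comp (L2_measurable kL)); exact: measurable_fst.
have mh2 : measurable_fun setT (fun z : TR * TR => h z.2).
  by apply: (measurableT_comp (L2_measurable hL)); exact: measurable_snd.
apply/integrable12ltyP.
  apply/measurable_EFinP; apply: measurable_funM => //.
  by apply: measurable_funM => //; exact: measurable_le2.
pose H := \int[m2]_y `|h y|; pose K := \int[m1]_x `|k x|.
have HE : (\int[m2]_y `|h y|%:E)%E = H%:E.
  by rewrite /H /Rintegral fineK//; exact/integrable_fin_num/L2_integrable/L2_norm.
have KE : (\int[m1]_y `|k y|%:E)%E = K%:E.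
  by rewrite /K /Rintegral fineK//; exact/integrable_fin_num/L2_integrable/L2_norm.
apply: (@le_lt_trans _ _ (\int[m1]_x (H%:E * `|k x|%:E))%E); last first.
  rewrite ge0_integralZl//; first by rewrite KE -EFinM ltry.
    apply/measurable_EFinP; apply: measurableT_comp => //; exact: L2_measurable kL.
  by rewrite lee_fin; exact: Rintegral_ge0.
apply: ge0_le_integral => //.
- by move=> x _; exact: integral_ge0.
- apply: (@measurable_fun_fubini_tonelli_F _ _ _ _ _ m2
    (fun z : TR * TR => (`|(((z.1 : R) <= z.2)%R%:R * k z.1 * h z.2)%:E|)%E)) => //.
  apply: measurableT_comp => //; apply/measurable_EFinP; apply: measurable_funM => //.
  by apply: measurable_funM => //; exact: measurable_le2.
- apply/measurable_EFinP; apply: measurable_funM => //.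
  by apply: measurableT_comp => //; exact: L2_measurable kL.
- move=> x _ /=; rewrite muleC -HE -ge0_integralZl//; last first.
    by apply/measurable_EFinP; apply: measurableT_comp => //; exact: L2_measurable hL.
  apply: ge0_le_integral => //.
  + apply/measurable_EFinP; apply: measurableT_comp => //; apply: measurable_funM => //;
      last exact: L2_measurable hL.
    apply: measurable_funM => //.
    rewrite (_ : (fun _ => _) = \1_(`[x, +oo[)); first exact: measurable_indic.
    by apply/funext => y; rewrite indicE mem_setE in_itv/= andbT.
  + apply/measurable_EFinP; apply: measurable_funM => //.
    by apply: measurableT_comp => //; exact: L2_measurable hL.
  + move=> y _; rewrite -EFinM lee_fin !normrM.
    set b := (X in `|(nat_of_bool X)%:R|); case: b;
      rewrite ?mulr1n ?mulr0n ?normr1 ?normr0 ?mul1r ?mul0r// mulr_ge0.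
Qed.

Lemma measurable_prim_le m k : L2 m k -> measurable_fun setT (prim_le m k).
Proof.
move=> kL; have := measurable_fubini_G (integrable_kernel kL (L2_cst m 1)).
move=> /(measurableT_comp (fine_measurable measurableT)).
congr (measurable_fun _ _); apply/funext => y; congr fine.
by apply: eq_integral => x _; rewrite /= indic_ray_le mulr1.
Qed.

(** The Fubini section at x integrates over [x, +oo); [prim_lt] is the total integral minus it. *)
Lemma measurable_prim_lt m k : L2 m k -> measurable_fun setT (prim_lt m k).
Proof.
move=> kL.
have H : measurable_fun setT (fun x : TR => \int[m]_y (((x : R) <= y)%R%:R * k y)).
  have := measurable_fubini_F (integrable_kernel (L2_cst m 1) kL).
  move=> /(measurableT_comp (fine_measurable measurableT)).
  congr (measurable_fun _ _); apply/funext => x; congr fine.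
  by apply: eq_integral => y _; rewrite /= mulr1.
have -> : prim_lt m k =
    (fun x => \int[m]_y k y - \int[m]_y (((x : R) <= y)%R%:R * k y)).
  apply/funext => x; rewrite -RintegralB//; last 2 first.
  - exact: L2_integrable.
  - apply/L2_integrable; have := L2B kL (L2_mul_indic (measurable_ray_lt x) kL).
    congr (L2 _ _); apply/funext => y; rewrite indic_ray_lt ltNge.
    by case: (x <= y)%R; rewrite /= ?mul1r ?mul0r ?subr0 ?subrr.
  apply: eq_Rintegral => y _; rewrite indic_ray_lt ltNge.
  by case: (x <= y)%R; rewrite /= ?mul1r ?mul0r ?subr0 ?subrr.
by apply: measurable_funB => //; exact: measurable_cst.
Qed.

Lemma bounded_prim_le m k : L2 m k -> bounded_mfun (prim_le m k : TR -> R).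
Proof.
move=> kL; split; first exact: measurable_prim_le.
by eexists => x; exact: prim_le_bound.
Qed.

Lemma bounded_prim_lt m k : L2 m k -> bounded_mfun (prim_lt m k : TR -> R).
Proof.
move=> kL; split; first exact: measurable_prim_lt.
by eexists => x; exact: prim_lt_bound.
Qed.

(** For fixed x, the y with x <= y form the complement of the open ray below x, so exchanging the
    integrals produces a total integral minus [prim_lt], without a diagonal correction at common
    atoms. The product term disappears as soon as one factor has mean zero. *)
Lemma prim_Fubini m1 m2 k h : L2 m1 k -> L2 m2 h ->
  ip m2 (prim_le m1 k) h = \int[m1]_x k x * \int[m2]_x h x - ip m1 k (prim_lt m2 h).
Proof.
move=> kL hL.
have F := Fubini (integrable_kernel kL hL).
have E1 (y : R) : (\int[m1]_x (((x : R) <= y)%R%:R * k x * h y)%:E = (prim_le m1 k y * h y)%:E)%E.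
  transitivity (\int[m1]_x ((h y)%:E * (\1_(`]-oo, y]) x * k x)%:E))%E.
    by apply: eq_integral => x _; rewrite -EFinM indic_ray_le mulrC.
  rewrite integralZl//; last exact: integrable_le.
  rewrite muleC EFinM; congr (_ * _)%E.
  rewrite /prim_le /Rintegral fineK//.
  exact/integrable_fin_num/integrable_le.
have E2 (x : R) : (\int[m2]_y (((x : R) <= y)%R%:R * k x * h y)%:E =
    (k x * (\int[m2]_y h y - prim_lt m2 h x))%:E)%E.
  transitivity (\int[m2]_y ((k x)%:E * (h y - \1_(`]-oo, x[) y * h y)%:E))%E.
    apply: eq_integral => y _; rewrite -EFinM indic_ray_lt ltNge.
    by case: (x <= y)%R; rewrite /= ?mul1r ?mul0r ?subr0 ?subrr ?mulr0.
  have I2 := L2_integrable (L2B hL (L2_mul_indic (measurable_ray_lt x) hL)).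
  rewrite integralZl// EFinM; congr (_ * _)%E.
  rewrite -RintegralB//; [|exact: L2_integrable|exact: integrable_lt].
  by rewrite /Rintegral fineK//; exact: integrable_fin_num.
have {}F : \int[m1]_x (k x * (\int[m2]_y h y - prim_lt m2 h x)) = ip m2 (prim_le m1 k) h.
  have := congr1 fine F; congr (fine _ = fine _); apply: eq_integral => x _.
    by rewrite -E2.
  by rewrite -E1.
have PL : L2 m1 (prim_lt m2 h) by exact/bounded_L2/bounded_prim_lt.
rewrite -F mulrC -RintegralZl//; last exact: L2_integrable.
rewrite /ip -RintegralB//.
- by apply: eq_Rintegral => x _; ring.
- exact/L2_integrable/L2Z.
- exact: L2_integrableM.
Qed.

End primitives.

(** * The Stieltjes measures of the drivers *)

Section stieltjes.
Context (R : realType).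
Variables (W : cadlag_driver R) (V : caglad_driver R).
Local Notation TR := (measurableTypeR R).
Implicit Types (f g h k : R -> R).

(** Only an inequality, because the measure is cut to [0, 1) while x and y are arbitrary. It is
    enough to bound the mass of intervals that cross 0. *)
Lemma measW_itv_le (x y : R) : x <= y -> (measW W `]x, y] <= (W y - W x)%:E)%E.
Proof.
move=> xy; rewrite /measW/= /mrestr.
apply: (@le_trans _ _ (lebesgue_stieltjes_measure W `]x, y])).
  by apply: le_measure => //; rewrite ?inE//; apply: measurableI => //; exact: measurable_itv.
rewrite /lebesgue_stieltjes_measure /measure_extension/=.
by rewrite measurable_mu_extE/= ?wlength_itv_bnd//; exact: is_ocitv.
Qed.

Lemma measV_itv_le (x y : R) : x <= y -> (measV V `[x, y[ <= (V y - V x)%:E)%E.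
Proof.
move=> xy; rewrite /measV/= /mrestr.
apply: (@le_trans _ _ (left_stieltjes V `[x, y[)).
  by apply: le_measure => //; rewrite ?inE//; apply: measurableI => //; exact: measurable_itv.
rewrite /left_stieltjes /pushforward opp_preimage_itvbndbnd/=.
rewrite /lebesgue_stieltjes_measure /measure_extension/=.
rewrite measurable_mu_extE/= ?wlength_itv_bnd ?lerN2//; last exact: is_ocitv.
by rewrite /reflected !opprK addrC.
Qed.

Lemma measW_out (A : set TR) : A `&` fundamental_domain = set0 -> measW W A = 0%E.
Proof. by move=> A0; rewrite /measW /= /mrestr A0 measure0. Qed.

Lemma measV_out (A : set TR) : A `&` fundamental_domain = set0 -> measV V A = 0%E.
Proof. by move=> A0; rewrite /measV /= /mrestr A0 measure0. Qed.

Lemma measW_finite : fin_num_fun (measW W).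
Proof.
move=> A mA; rewrite ge0_fin_numE//.
(* The interval starts below 0 because []0, 1]] would miss the base point. *)
apply: (@le_lt_trans _ _ (measW W (`]-1, 1] : set TR))); last first.
  apply: (@le_lt_trans _ _ (W 1 - W (-1))%:E); last exact: ltry.
  by apply: measW_itv_le; lra.
rewrite /measW /mrestr/=; apply: le_measure; rewrite ?inE.
- by apply: measurableI => //; exact: measurable_fundamental_domain.
- by apply: measurableI; [exact: measurable_itv|exact: measurable_fundamental_domain].
- move=> x [_ Dx]; split => //; move: Dx; rewrite /fundamental_domain/= !in_itv/=.
  by move=> /andP[x0 /ltW ->]; rewrite andbT (lt_le_trans _ x0)// ltrN10.
Qed.

Lemma measV_finite : fin_num_fun (measV V).
Proof.
move=> A mA; rewrite ge0_fin_numE//.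
apply: (@le_lt_trans _ _ (measV V (`[0, 1[ : set TR))); last first.
  by apply: (le_lt_trans (measV_itv_le _)); rewrite ?ltry.
rewrite /measV /mrestr/=; apply: le_measure; rewrite ?inE.
- by apply: measurableI => //; exact: measurable_fundamental_domain.
- by apply: measurableI; [exact: measurable_itv|exact: measurable_fundamental_domain].
- by move=> x [_ Dx].
Qed.

HB.instance Definition _ :=
  @Measure_isFinite.Build _ TR R (measW W) measW_finite.
HB.instance Definition _ :=
  @Measure_isFinite.Build _ TR R (measV V) measV_finite.

Lemma W_le (x y : R) : x <= y -> W x <= W y.
Proof. exact/ltW_homo/cadlag_driver_incr. Qed.

Lemma V_le (x y : R) : x <= y -> V x <= V y.
Proof. exact/ltW_homo/caglad_driver_incr. Qed.

Lemma W_cont1 : {for 1, continuous W}.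
Proof.
have -> : (W : R -> R) = (fun x => W (x - 1) + (W 1 - W 0)).
  by apply/funext => x; rewrite -(cadlag_driver_shift W (x - 1)) subrK addrC subrK.
have s : x - 1 @[x --> (1 : R)] --> (1 - 1 : R).
  by apply: cvgB; [exact: cvg_id|exact: cvg_cst].
have c0 : W x @[x --> (0 : R)] --> W 0 := @cadlag_driver_cont0 _ W.
have H : W (x - 1) @[x --> (1 : R)] --> W (1 - 1).
  rewrite subrr in s *. exact: (@cvg_comp _ _ _ (fun x : R => x - 1) (W : R -> R) _ _ _ s c0).
exact: (cvgD H (cvg_cst _)).
Qed.

Lemma W_near1 (e : R) : 0 < e -> exists d : R, [/\ 0 < d, d < 1 &
  forall x, 1 - d < x -> x <= 1 -> W 1 - W x < e].
Proof.
move=> e0; have /cvgrPdist_lt/(_ e e0) [/= d d0 H] := W_cont1.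
exists (Num.min d (1/2)); split.
- by rewrite lt_min d0/=; lra.
- by rewrite gt_min; apply/orP; right; lra.
- move=> x x1 x1'; have := H x; rewrite /ball/=.
  have -> : `|1 - x| < d.
    rewrite ger0_norm ?subr_ge0// ltrBlDr -ltrBlDl.
    by apply: le_lt_trans x1; rewrite lerB// ge_min lexx.
  by move=> /(_ isT); apply: le_lt_trans; exact: ler_norm.
Qed.

Lemma W_near0 (e : R) : 0 < e -> exists2 d : R, 0 < d &
  forall x, `|x| < d -> `|W x| < e.
Proof.
move=> e0; have /cvgrPdist_lt/(_ e e0) [/= d d0 H] := @cadlag_driver_cont0 _ W.
exists d => // x xd; have := H x.
by rewrite /ball/= cadlag_driver0 !sub0r !normrN; apply.
Qed.

Lemma V_near0 (e : R) : 0 < e -> exists2 d : R, 0 < d &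
  forall x, `|x| < d -> `|V x| < e.
Proof.
move=> e0; have /cvgrPdist_lt/(_ e e0) [/= d d0 H] := @caglad_driver_cont0 _ V.
exists d => // x xd; have := H x.
by rewrite /ball/= caglad_driver0 !sub0r !normrN; apply.
Qed.

(** The cut measure does not see the point 1, but [W] is continuous there by periodicity of its
    increments, so intervals ending just before 1 already exhaust the mass. *)
Lemma measW_oc (a b : R) : 0 <= a -> a <= b -> b <= 1 ->
  measW W `]a, b] = (W b - W a)%:E.
Proof.
move=> a0 ab b1; have [b1'|b1'] := ltP b 1; first exact: measW_itv.
have {b1'}b1 : b = 1 by apply/eqP; rewrite eq_le b1 b1'.
rewrite {b}b1 in ab *.
apply/eqP; rewrite eq_le measW_itv_le//=.
have [->|an1] := eqVneq a 1; first by rewrite subrr.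
have a1 : a < 1 by rewrite lt_neqAle an1.
apply/lee_addgt0Pr => e e0; have [d [d0 d1 H]] := W_near1 e0.
pose b := Num.max a (1 - d / 2).
have a_b : a <= b by rewrite le_max lexx.
have b1 : b < 1 by rewrite gt_max a1/=; lra.
have {}H : W 1 - W b < e.
  by apply: H; [rewrite lt_max; apply/orP; right; lra|exact: ltW].
apply: (@le_trans _ _ ((W b - W a)%:E + e%:E)%E).
  by rewrite -EFinD lee_fin; lra.
rewrite leeD2r// -measW_itv//; apply: le_measure; rewrite ?inE; [exact: measurable_itv..|].
by move=> x/=; rewrite !in_itv/= => /andP[-> /=] /le_trans; apply; exact: ltW.
Qed.

Lemma measW0 : measW W [set 0] = 0%E.
Proof.
apply/eqP; rewrite eq_le measure_ge0 andbT.
apply/lee_addgt0Pr => e e0; have [d d0 H] := W_near0 e0; rewrite add0e.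
apply: (@le_trans _ _ (measW W (`](- (d/2)), 0] : set TR))).
  apply: le_measure; rewrite ?inE; [exact: measurable_set1|exact: measurable_itv|].
  by move=> x /= ->; rewrite in_itv/= lexx andbT; lra.
apply: (le_trans (measW_itv_le _)); first lra.
rewrite lee_fin cadlag_driver0 sub0r; have := H (- (d/2)).
rewrite normrN ger0_norm; last lra.
by rewrite -normrN => /(_ ltac:(lra)) /ltW; apply: le_trans; exact: ler_norm.
Qed.

Lemma measV0 : measV V [set 0] = 0%E.
Proof.
apply/eqP; rewrite eq_le measure_ge0 andbT.
apply/lee_addgt0Pr => e e0; have [d d0 H] := V_near0 e0; rewrite add0e.
apply: (@le_trans _ _ (measV V (`[0, (d/2)[ : set TR))).
  apply: le_measure; rewrite ?inE; [exact: measurable_set1|exact: measurable_itv|].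
  by move=> x /= ->; rewrite in_itv/= lexx /=; lra.
apply: (le_trans (measV_itv_le _)); first lra.
rewrite lee_fin caglad_driver0 subr0; have := H (d/2).
rewrite ger0_norm; last lra.
by move=> /(_ ltac:(lra)) /ltW; apply: le_trans; exact: ler_norm.
Qed.

(** Integrals see only the open interval (0, 1), which is what allows a function to be replaced by
    its periodization. *)
Lemma ae_measW : {ae measW W, forall x : TR, 0 < (x : R) < 1}.
Proof.
exists (~` `]0, 1[); split.
- by apply: measurableC; exact: measurable_itv.
- have -> : (~` `]0, 1[ : set TR) = [set 0] `|` (~` `[0, 1[).
    apply/seteqP; split => x/=; rewrite !in_itv/=.
      move=> H; have [->|x0] := eqVneq (x : R) 0; [by left|right].
      by rewrite le_eqVlt eq_sym (negbTE x0).
    by move=> [->|H /andP[/ltW x0 x1]]; [rewrite ltxx|apply: H; rewrite x0].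
  have m0 : measurable ([set 0] : set TR) by exact: measurable_set1.
  have m1 : measurable (~` `[0, 1[ : set TR).
    by apply: measurableC; exact: measurable_itv.
  have n1 : measW W (~` `[0, 1[ : set TR) = 0%E.
    by apply: measW_out; rewrite setICl.
  by rewrite measureU0//; exact: measW0.
- by move=> x /=; rewrite in_itv.
Qed.

Lemma ae_measV : {ae measV V, forall x : TR, 0 < (x : R) < 1}.
Proof.
exists (~` `]0, 1[); split.
- by apply: measurableC; exact: measurable_itv.
- have -> : (~` `]0, 1[ : set TR) = [set 0] `|` (~` `[0, 1[).
    apply/seteqP; split => x/=; rewrite !in_itv/=.
      move=> H; have [->|x0] := eqVneq (x : R) 0; [by left|right].
      by rewrite le_eqVlt eq_sym (negbTE x0).
    by move=> [->|H /andP[/ltW x0 x1]]; [rewrite ltxx|apply: H; rewrite x0].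
  have m0 : measurable ([set 0] : set TR) by exact: measurable_set1.
  have m1 : measurable (~` `[0, 1[ : set TR).
    by apply: measurableC; exact: measurable_itv.
  have n1 : measV V (~` `[0, 1[ : set TR) = 0%E.
    by apply: measV_out; rewrite setICl.
  by rewrite measureU0//; exact: measV0.
- by move=> x /=; rewrite in_itv.
Qed.

End stieltjes.

(** * One-sided limits and derivatives *)

Section one_sided_limits.
Context (R : realType).
Local Notation TR := (measurableTypeR R).
Implicit Types (f g U phi : R -> R) (x y l e d : R).

Lemma cvg_rightP f x l : f y @[y --> x^'+] --> l <->
  forall e, 0 < e -> exists2 d, 0 < d & forall y, x < y -> y < x + d -> `|f y - l| < e.
Proof.
split=> [/cvgrPdist_lt H e e0|H].
  have [d /= d0 dH] := H _ e0; exists d => // y xy yd.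
  rewrite distrC; apply: dH => //=.
  by rewrite distrC ger0_norm ?subr_ge0 ?ltW// ltrBlDl.
apply/cvgrPdist_lt => e e0; have [d d0 dH] := H _ e0; exists d => //= y.
rewrite /ball/= distrC => yd xy; rewrite distrC; apply: dH => //.
by rewrite -ltrBlDl; apply: le_lt_trans yd; exact: ler_norm.
Qed.

Lemma cvg_leftP f x l : f y @[y --> x^'-] --> l <->
  forall e, 0 < e -> exists2 d, 0 < d & forall y, x - d < y -> y < x -> `|f y - l| < e.
Proof.
split=> [/cvgrPdist_lt H e e0|H].
  have [d /= d0 dH] := H _ e0; exists d => // y yd yx.
  rewrite distrC; apply: dH => //=.
  by rewrite ger0_norm ?subr_ge0 ?ltW// ltrBlDr addrC -ltrBlDr.
apply/cvgrPdist_lt => e e0; have [d d0 dH] := H _ e0; exists d => //= y.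
rewrite /ball/= => yd yx; rewrite distrC; apply: dH => //.
by rewrite ltrBlDr -ltrBlDl; apply: le_lt_trans yd; exact: ler_norm.
Qed.

Lemma cvg_right_shift f x l a : f y @[y --> (x + a)^'+] --> l <->
  f (y + a) @[y --> x^'+] --> l.
Proof.
rewrite !cvg_rightP; split => H e e0; have [d d0 dH] := H e e0; exists d => // y xy yd.
  by apply: dH; rewrite ?ltrD2r// addrAC ltrD2r.
have := dH (y - a); rewrite subrK; apply.
  by rewrite ltrBrDr.
by rewrite ltrBlDr addrAC.
Qed.

Lemma cvg_left_shift f x l a : f y @[y --> (x + a)^'-] --> l <->
  f (y + a) @[y --> x^'-] --> l.
Proof.
rewrite !cvg_leftP; split => H e e0; have [d d0 dH] := H e e0; exists d => // y xy yd.
  by apply: dH; rewrite ?ltrD2r// addrAC ltrD2r.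
have := dH (y - a); rewrite subrK; apply.
  by rewrite ltrBrDr addrAC.
by rewrite ltrBlDr.
Qed.

Lemma shift_ind (P : R -> Prop) : (forall x, P (x + 1) <-> P x) ->
  (forall x, 0 <= x -> x < 1 -> P x) -> forall x, P x.
Proof.
move=> Psh P01 x.
have Pn n y : P (y + n%:R) <-> P y.
  elim: n => [|n IHn]; first by rewrite addr0.
  by rewrite -natr1 addrA Psh.
have Pz (z : int) y : P (y + z%:~R) <-> P y.
  case: z => n; first by rewrite -pmulrn; exact: Pn.
  by rewrite NegzE mulrNz -[X in _ <-> P X](subrK n.+1%:R) -pmulrn Pn.
rewrite -(subrK (Num.floor x)%:~R x) Pz; apply: P01.
  by rewrite subr_ge0 ge_floor.
by rewrite ltrBlDl; have := floorD1_gt x; rewrite rmorphD rmorph1.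
Qed.

(** The period (0, 1] suits left limits: each of its points has a left neighbourhood inside
    [0, 1]. *)
Lemma shift_ind_oc (P : R -> Prop) : (forall x, P (x + 1) <-> P x) ->
  (forall x, 0 < x -> x <= 1 -> P x) -> forall x, P x.
Proof.
move=> Psh P01; apply: shift_ind => // x; rewrite le_eqVlt => /predU1P[<- _|x0 x1].
  by rewrite -Psh add0r; apply: P01.
by apply: P01 => //; exact: ltW.
Qed.

(* The bound |phi b - phi y| <= e (U b - U y) holds down to the infimum of its
   range by right continuity, and then below it by the left derivative, so
   that this infimum is [a]. *)
Lemma left_derivative0_cst phi U a b : a <= b ->
  (forall x, a <= x -> x < b -> phi y @[y --> x^'+] --> phi x) ->
  (forall x, a <= x -> x < b -> U y @[y --> x^'+] --> U x) ->
  (forall x, a < x -> x <= b -> forall e, 0 < e -> exists2 d, 0 < d &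
     forall y, x - d < y -> y < x -> `|phi x - phi y| <= e * (U x - U y)) ->
  phi a = phi b.
Proof.
move=> ab phic Uc H.
have key e : 0 < e -> `|phi b - phi a| <= e * (U b - U a).
  move=> e0.
  pose S := [set x | a <= x <= b /\
    forall y, x <= y -> y <= b -> `|phi b - phi y| <= e * (U b - U y)].
  have Sb : S b.
    split; first by rewrite ab lexx.
    move=> y yb yb'; have -> : y = b by apply/eqP; rewrite eq_le yb yb'.
    by rewrite !subrr normr0 mulr0.
  have hS : has_inf S by split; [exists b|exists a => x [/andP[]]].
  have Sle x : S x -> inf S <= x by move=> Sx; apply: ge_inf => //; exact: hS.2.
  have aS : a <= inf S by apply: lb_le_inf; [exists b|move=> x [/andP[]]].
  have Sb' : inf S <= b by exact: Sle.
  have Sgt y : inf S < y -> y <= b -> `|phi b - phi y| <= e * (U b - U y).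
    move=> sy yb; have [x [_ Sx] xy] := inf_lt hS.1 sy.
    by apply: Sx => //; exact: ltW.
  have Ss : `|phi b - phi (inf S)| <= e * (U b - U (inf S)).
    have [->|sb] := eqVneq (inf S) b; first by rewrite !subrr normr0 mulr0.
    have {}sb : inf S < b by rewrite lt_neqAle sb.
    (* A gap g at the infimum would persist slightly to its right, where phi and e U have changed by
       less than g / 2 each; but there the bound holds. *)
    rewrite leNgt; apply/negP => gap.
    pose g := `|phi b - phi (inf S)| - e * (U b - U (inf S)).
    have g0 : 0 < g by rewrite subr_gt0.
    have /cvg_rightP/(_ (g / 2)) := phic _ aS sb; case; first lra.
    move=> d1 d10 D1.
    have /cvg_rightP/(_ (g / 2 / e)) := Uc _ aS sb; case; first by rewrite divr_gt0//; lra.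
    move=> d2 d20 D2.
    pose m := Num.min (b - inf S) (Num.min d1 d2).
    have m0 : 0 < m by rewrite !lt_min subr_gt0 sb d10.
    have [mb [m1 m2]] : m <= b - inf S /\ m <= d1 /\ m <= d2.
      by rewrite /m !ge_min !lexx !orbT.
    pose y := inf S + m / 2.
    have H1 := D1 y ltac:(rewrite /y; lra) ltac:(rewrite /y; lra).
    have H2 := D2 y ltac:(rewrite /y; lra) ltac:(rewrite /y; lra).
    have H3 := Sgt y ltac:(rewrite /y; lra) ltac:(rewrite /y; lra).
    have : `|phi b - phi (inf S)| <= `|phi b - phi y| + `|phi y - phi (inf S)|.
      by apply: le_trans (ler_normD _ _); rewrite addrA subrK.
    have H4 : e * (U (inf S) - U y) < g / 2.
      rewrite mulrC -ltr_pdivlMr//; apply: le_lt_trans H2.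
      by rewrite distrC; exact: ler_norm.
    have : e * (U b - U y) = e * (U b - U (inf S)) + e * (U (inf S) - U y) by ring.
    rewrite /g in H1 H4 *; lra.
  have [as_|] := eqVneq a (inf S); first by rewrite as_.
  move=> ne; have {}ne : a < inf S by rewrite lt_neqAle ne.
  have [d d0 D] := H _ ne Sb' e e0.
  pose t := Num.max a (inf S - d / 2).
  have ts : t < inf S by rewrite gt_max ne/=; lra.
  have St : S t.
    split; first by rewrite le_max lexx/= (le_trans (ltW ts)).
    move=> y ty yb; have [ys|sy] := ltP y (inf S); last first.
      move: sy; rewrite le_eqVlt => /predU1P[<- //|sy]; exact: Sgt.
    have := D y; have -> : inf S - d < y.
      by apply: lt_le_trans ty; rewrite lt_max; apply/orP; right; lra.
    move=> /(_ isT ys) H1.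
    have : `|phi b - phi y| <= `|phi b - phi (inf S)| + `|phi (inf S) - phi y|.
      by apply: le_trans (ler_normD _ _); rewrite addrA subrK.
    have : e * (U b - U y) = e * (U b - U (inf S)) + e * (U (inf S) - U y) by ring.
    lra.
  by have := Sle _ St; rewrite leNgt ts.
apply/eqP; rewrite eq_sym -subr_eq0 -normr_le0 leNgt; apply/negP => p0.
(* The case e = 1 shows that [U b - U a] is positive. Taking for e half the slope then bounds the
   positive number |phi b - phi a| by its half. *)
have := key 1 ltr01; rewrite mul1r => /(lt_le_trans p0) U0.
have := key (`|phi b - phi a| / (U b - U a) / 2).
rewrite !divr_gt0// => /(_ isT).
rewrite mulrAC divfK ?gt_eqF//; lra.
Qed.

End one_sided_limits.

Section regulated.
Context (R : realType).
Local Notation TR := (measurableTypeR R).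
Implicit Types (f g U phi : R -> R) (x y l e d : R).

(** The reflection y -> a + b - y exchanges the two sides; [U] is also negated so that its
    increments keep their sign. *)
Lemma right_derivative0_cst phi U a b : a <= b ->
  (forall x, a < x -> x <= b -> phi y @[y --> x^'-] --> phi x) ->
  (forall x, a < x -> x <= b -> U y @[y --> x^'-] --> U x) ->
  (forall x, a <= x -> x < b -> forall e, 0 < e -> exists2 d, 0 < d &
     forall y, x < y -> y < x + d -> `|phi y - phi x| <= e * (U y - U x)) ->
  phi a = phi b.
Proof.
move=> ab phic Uc H.
have L f x : a <= x -> x < b -> (forall x, a < x -> x <= b -> f y @[y --> x^'-] --> f x) ->
    f (a + b - y) @[y --> x^'+] --> f (a + b - x).
  move=> ax xb fc; apply/cvg_rightP => e e0.
  have fx := fc (a + b - x) ltac:(lra) ltac:(lra).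
  have /cvg_leftP/(_ e e0)[d d0 D] := fx.
  by exists d => // y xy yd; apply: D; lra.
have /= := @left_derivative0_cst R (fun y => phi (a + b - y)) (fun y => - U (a + b - y)) a b ab.
rewrite addrAC subrr add0r addrK => -> //.
- by move=> x ax xb; exact: L.
- by move=> x ax xb; apply: cvgN; exact: L.
- move=> x ax xb e e0; have [||d d0 D] := H (a + b - x) _ _ e e0; [lra|lra|].
  exists d => // y yd yx; rewrite distrC opprK (addrC (- _) (U _)).
  by apply: D; lra.
Qed.

(** * Regulated functions: uniform approximation, boundedness, measurability *)

Definition regulated f := forall x,
  cvg (f y @[y --> x^'-]) /\ cvg (f y @[y --> x^'+]).

Lemma cadlag_regulated f : cadlag f -> regulated f.
Proof. by move=> fc x; have [r l] := fc x; split=> //; apply: cvgP r. Qed.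

Lemma caglad_regulated f : caglad f -> regulated f.
Proof. by move=> fc x; have [r l] := fc x; split=> //; apply: cvgP r. Qed.

(* The right end of the interval on which such an [s] exists can always be pushed
   past the supremum, using the one-sided limits there. *)
Lemma regulated_approx f a b e : regulated f -> a <= b -> 0 < e ->
  exists2 s : TR -> R, bounded_mfun s & forall x, a <= x -> x <= b -> `|f x - s x| <= e.
Proof.
move=> fr ab e0.
pose S := [set t | a <= t <= b /\ exists2 s : TR -> R, bounded_mfun s &
   forall x, a <= x -> x <= t -> `|f x - s x| <= e].
have bcst (c : R) : bounded_mfun (fun=> c : R) (T := TR).
  by split; [exact: measurable_cst|exists `|c|].
have Sa : S a.
  split; first by rewrite lexx.
  exists (fun=> f a) => // x ax xa; have -> : x = a by apply/eqP; rewrite eq_le xa ax.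
  by rewrite subrr normr0 ltW.
have hS : has_sup S by split; [exists a|exists b => x [/andP[]]].
have leS x : S x -> x <= sup S by move=> Sx; apply: ub_le_sup => //; exact: hS.2.
have asup : a <= sup S by exact: leS.
have supb : sup S <= b by apply: sup_le_ub; [exists a|move=> x [/andP[]]].
have bif (t : R) (s1 s2 : TR -> R) : bounded_mfun s1 -> bounded_mfun s2 ->
    bounded_mfun (fun x : TR => if (x : R) <= t then s1 x else s2 x).
  move=> [m1 [M1 b1]] [m2 [M2 b2]]; split.
    apply: measurable_fun_ifT => //; apply: measurable_fun_ler => //.
  exists (Num.max M1 M2) => x; case: ifP => _; rewrite le_max; apply/orP; [left|right] => //.
have bif' (t : R) (s1 s2 : TR -> R) : bounded_mfun s1 -> bounded_mfun s2 ->
    bounded_mfun (fun x : TR => if (x : R) < t then s1 x else s2 x).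
  move=> [m1 [M1 b1]] [m2 [M2 b2]]; split.
    apply: measurable_fun_ifT => //; apply: measurable_fun_ltr => //.
  exists (Num.max M1 M2) => x; case: ifP => _; rewrite le_max; apply/orP; [left|right] => //.
have [/cvg_ex[/= l /cvg_leftP/(_ e e0)[d1 d10 D1]]] := fr (sup S).
move=> /cvg_ex[/= r /cvg_rightP/(_ e e0)[d2 d20 D2]].
have [t St ts] := sup_gt hS.1 (ltac:(lra) : sup S - d1 < sup S).
have tsup := leS _ St.
have [/andP[at_ tb] [s bs sP]] := St.
(* Beyond t the approximant is continued by the left limit, the value and the right limit of f at
   [sup S], each on the piece where it is within e of f. *)
pose s' (x : TR) : R := if (x : R) <= t then s x else
  if (x : R) < sup S then l else if (x : R) <= sup S then f (sup S) else r.
have bs' : bounded_mfun s' by apply: (bif) => //; apply: (bif') => //; apply: (bif) => //.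
have s'P x : a <= x -> x < sup S + d2 -> `|f x - s' x| <= e.
  move=> ax xs; rewrite /s'; have [xt|tx] := leP x t; first exact: sP.
  have [xs'|sx] := ltP x (sup S); first by apply/ltW/D1 => //; exact: lt_trans tx.
  have [xs'|sx'] := leP x (sup S); last exact/ltW/D2.
  have -> : x = sup S by apply/eqP; rewrite eq_le xs' sx.
  by rewrite subrr normr0 ltW.
pose u := Num.min b (sup S + d2 / 2).
have us : u < sup S + d2 by rewrite gt_min; apply/orP; right; lra.
have Su : S u.
  split; first by rewrite le_min ab/= ge_min lexx/= andbT; lra.
  by exists s' => // x ax xu; apply: s'P => //; exact: le_lt_trans us.
(* Otherwise u would be [sup S + d2 / 2], an element of S above its supremum. *)
have ub : u = b.
  apply/eqP; rewrite eq_le ge_min lexx/= le_min lexx/=; have := leS _ Su.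
  by rewrite ge_min => /orP[]; lra.
by rewrite ub in Su; have [_ [s1 bs1 s1P]] := Su; exists s1.
Qed.

Lemma regulated_bounded f a b : regulated f -> a <= b ->
  exists M : R, forall x, a <= x -> x <= b -> `|f x| <= M.
Proof.
move=> fr ab; have [s [ms [M sM]] sP] := regulated_approx fr ab ltr01.
exists (1 + M) => x ax xb; have := sP x ax xb; have := sM x.
by have := ler_normD (f x - s x) (s x); rewrite subrK; lra.
Qed.

(** On each [-n, n] f is a limit of measurable functions, and these intervals cover the line. *)
Lemma regulated_measurable f : regulated f -> measurable_fun setT (f : TR -> R).
Proof.
move=> fr.
have -> : [set: TR] = \bigcup_n (`[- n%:R, n%:R]%classic : set TR).
  apply/seteqP; split => // x _; exists (Num.truncn `|x : R|).+1 => //=.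
  rewrite in_itv/= -ler_norml; apply/ltW; exact: truncnS_gt.
apply/measurable_fun_bigcup; first by move=> n; exact: measurable_itv.
move=> n.
have H (k : nat) : exists s : TR -> R, bounded_mfun s /\
    forall x, - n%:R <= x -> x <= n%:R -> `|f x - s x| <= k.+1%:R^-1.
  have [||s s1 s2] := @regulated_approx f (- n%:R) n%:R (k.+1%:R^-1) fr.
  - by rewrite lerNl (le_trans _ (ler0n R n))// oppr_le0.
  - by rewrite invr_gt0.
  - by exists s.
have [s sP] := choice H.
apply: (@measurable_fun_cvg _ _ _ _ s).
  by move=> k; apply: measurable_funTS; exact: (sP k).1.1.
move=> x; rewrite /= in_itv/= => /andP[xn1 xn2].
apply/cvgrPdist_le => e e0; near=> k.
apply: le_trans ((sP k).2 x xn1 xn2) _.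
apply: ltW; near: k; exact: (near_infty_natSinv_lt (PosNum e0)).
Unshelve. all: by end_near. Qed.

(** * Periodization of a function on [0, 1) *)

Definition per f x := f (x - (Num.floor x)%:~R).

Lemma per_periodic f : periodic (per f) 1.
Proof.
move=> x; rewrite /per floorDrz ?floor1 ?int_num1// rmorphD/= rmorph1.
by congr f; ring.
Qed.

Lemma perE f x : 0 <= x -> x < 1 -> per f x = f x.
Proof.
move=> x0 x1; rewrite /per (_ : Num.floor x = 0) ?subr0//.
by apply/floor_def; rewrite x0.
Qed.

Lemma perE1 f x : f 0 = f 1 -> 0 <= x -> x <= 1 -> per f x = f x.
Proof.
move=> f01 x0; rewrite le_eqVlt => /predU1P[->|]; last exact: perE.
by rewrite -[X in per f X]add0r per_periodic perE.
Qed.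

Lemma periodic_bounded_mfun f : periodic f 1 -> regulated f ->
  bounded_mfun (f : TR -> R).
Proof.
move=> pf fr; split; first exact: regulated_measurable.
have [M MP] := regulated_bounded fr ler01; exists M.
by apply: shift_ind => [x|x x0 x1]; [rewrite pf|apply: MP => //; exact: ltW].
Qed.

End regulated.

(** * The fundamental theorem of calculus *)

Section indefinite_integrals.
Context (R : realType).
Variables (W : cadlag_driver R) (V : caglad_driver R).
Local Notation TR := (measurableTypeR R).
Local Notation mu := (measW W).
Local Notation nu := (measV V).
Implicit Types (f g h k : R -> R).

Lemma int_indic_bound (m : {finite_measure set TR -> \bar R}) (A : set TR)
    (k : TR -> R) (M : R) : measurable A -> L2 m k ->
  (forall x, A x -> `|k x| <= M) ->
  `|\int[m]_x (\1_A x * k x)| <= M * fine (m A).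
Proof.
move=> mA kL kM; have kA := L2_mul_indic mA kL.
apply: (le_trans (le_normr_Rintegral measurableT (L2_integrable kA))).
have -> : M * fine (m A) = \int[m]_x (M * \1_A x).
  rewrite RintegralZl//; last exact/L2_integrable/indic_L2.
  by congr (_ * _); rewrite /Rintegral integral_indic// setIT.
apply: le_Rintegral => //.
- exact/L2_integrable/L2_norm.
- exact/L2_integrable/L2Z/indic_L2.
- move=> x _; rewrite normrM indicE; have [/set_mem Ax|_] := boolP (x \in A).
    by rewrite normr1 mul1r mulr1 kM.
  by rewrite normr0 mul0r mulr0.
Qed.

Lemma Rintegral_indic (m : {finite_measure set TR -> \bar R}) (A : set TR) :
  measurable A -> \int[m]_x (\1_A x) = fine (m A).
Proof. by move=> mA; rewrite /Rintegral integral_indic// setIT. Qed.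

Lemma int_indicW (z y : R) : 0 <= z -> z <= y -> y <= 1 ->
  \int[mu]_t \1_(`]z, y]) t = W y - W z.
Proof.
move=> z0 zy y1; apply: (eq_trans (Rintegral_indic mu (measurable_itv `]z, y]))).
exact: (congr1 fine (measW_oc W z0 zy y1)).
Qed.

Lemma int_indicV (z y : R) : 0 <= z -> z <= y -> y <= 1 ->
  \int[nu]_t \1_(`[z, y[) t = V y - V z.
Proof.
move=> z0 zy y1; apply: (eq_trans (Rintegral_indic nu (measurable_itv `[z, y[))).
exact: (congr1 fine (measV_itv V z0 zy y1)).
Qed.

(** Stated through increments inside [0, 1], so that it is insensitive to additive constants and
    also holds for periodic functions, which differ from [prim_le mu k] outside this interval. *)
Definition is_primW f k := forall z y, 0 <= z -> z <= y -> y <= 1 ->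
  f y - f z = prim_le mu k y - prim_le mu k z.

Definition is_primV f k := forall z y, 0 <= z -> z <= y -> y <= 1 ->
  f y - f z = prim_lt nu k y - prim_lt nu k z.

(** The bound on k is asked only on ]z, y], so that it can be made small near a given point; this
    yields both one-sided continuity and derivatives. *)
Lemma primW_lip f k (M : R) z y : bounded_mfun (k : TR -> R) -> is_primW f k ->
  0 <= z -> z <= y -> y <= 1 -> (forall x, z < x -> x <= y -> `|k x| <= M) ->
  `|f y - f z| <= M * (W y - W z).
Proof.
move=> bk fk z0 zy y1 kM.
rewrite fk// prim_leB_itv//; last exact: bounded_L2.
have -> : W y - W z = fine (mu `]z, y]) by rewrite measW_oc.
apply: int_indic_bound; [exact: measurable_itv|exact: bounded_L2|].
by move=> x; rewrite /= in_itv/= => /andP[]; exact: kM.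
Qed.

Lemma primV_lip f k (M : R) z y : bounded_mfun (k : TR -> R) -> is_primV f k ->
  0 <= z -> z <= y -> y <= 1 -> (forall x, z <= x -> x < y -> `|k x| <= M) ->
  `|f y - f z| <= M * (V y - V z).
Proof.
move=> bk fk z0 zy y1 kM.
rewrite fk// prim_ltB_itv//; last exact: bounded_L2.
have -> : V y - V z = fine (nu `[z, y[) by rewrite measV_itv.
apply: int_indic_bound; [exact: measurable_itv|exact: bounded_L2|].
by move=> x; rewrite /= in_itv/= => /andP[]; exact: kM.
Qed.

(** f is the difference of f + M U and M U, both of which are nondecreasing. *)
Lemma lip_cvg_left f U (M x : R) : 0 < x ->
  (forall z y, 0 <= z -> z <= y -> y <= x -> `|f y - f z| <= M * (U y - U z)) ->
  (forall z y, z <= y -> U z <= U y) ->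
  cvg (f y @[y --> x^'-]) .
Proof.
move=> x0 fU Uinc.
have HM g : (forall z y, 0 <= z -> z <= y -> y <= x -> g z <= g y) ->
    cvg (g y @[y --> x^'-]).
  move=> ginc; apply: nondecreasing_at_left_is_cvgr; near=> t.
    move=> z y; rewrite !in_itv/= => /andP[tz zx] /andP[ty yx] zy; apply: ginc => //.
      by rewrite (le_trans _ (ltW tz))//; near: t; exact: nbhs_left_ge.
    exact: ltW.
  exists (g x) => _ [y + <-]; rewrite /= in_itv/= => /andP[ty yx]; apply: ginc => //.
    by rewrite (le_trans _ (ltW ty))//; near: t; exact: nbhs_left_ge.
  exact: ltW.
have c1 : cvg (f y + M * U y @[y --> x^'-]).
  apply: HM => z y z0 zy yx; have := fU z y z0 zy yx.
  by rewrite ler_norml mulrBr => /andP[]; lra.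
have c2 : cvg (M * U y @[y --> x^'-]).
  apply: is_cvgMr; apply: HM => z y _ zy _; exact: Uinc.
have -> : f = (fun y => (f y + M * U y) - M * U y) by apply/funext => y; rewrite addrK.
exact: (is_cvgB c1 c2).
Unshelve. all: by end_near. Qed.

Lemma lip_cvg_right f U (M x : R) : x < 1 ->
  (forall z y, x <= z -> z <= y -> y <= 1 -> `|f y - f z| <= M * (U y - U z)) ->
  (forall z y, z <= y -> U z <= U y) ->
  cvg (f y @[y --> x^'+]) .
Proof.
move=> x1 fU Uinc.
have /cvg_ex[l /cvg_leftP H] : cvg (f (1 - y) @[y --> (1 - x)^'-]).
  apply: (@lip_cvg_left (fun y => f (1 - y)) (fun y => - U (1 - y)) M).
  - by rewrite subr_gt0.
  - by move=> z y z0 zy yx; rewrite distrC opprK (addrC (- _) (U _)); apply: fU; lra.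
  - by move=> z y zy; rewrite lerN2; apply: Uinc; rewrite lerB.
apply/cvg_ex; exists l; apply/cvg_rightP => e /H [d d0 D].
exists d => // y xy yd; have := D (1 - y); rewrite subKr; apply; lra.
Qed.

Lemma primW_cvg_right f k (x : R) : bounded_mfun (k : TR -> R) -> is_primW f k ->
  0 <= x -> x < 1 -> f y @[y --> x^'+] --> f x.
Proof.
move=> bk fk x0 x1; have [_ [M kM]] := bk.
have M0 : 0 <= M by exact: le_trans (kM 0).
have Lip z y : 0 <= z -> z <= y -> y <= 1 -> `|f y - f z| <= M * (W y - W z).
  by move=> *; apply: (primW_lip bk fk).
apply/cvg_rightP => e e0.
(* M may be 0, hence the denominator M + 1. *)
have [/cvg_rightP/(_ (e / (M + 1))) + _] := cadlag_driver_cadlag W x.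
rewrite divr_gt0//; last lra.
move=> /(_ isT) [d d0 D].
exists (Num.min d (1 - x)); first by rewrite lt_min d0 subr_gt0.
move=> y xy; rewrite -ltrBlDl lt_min !ltrBlDl => /andP[yd].
rewrite addrC subrK => y1.
apply: le_lt_trans (Lip x y x0 (ltW xy) (ltW y1)) _.
have := D y xy yd; rewrite ltr_pdivlMr; last lra.
apply: le_lt_trans; have a0 : 0 <= W y - W x by rewrite subr_ge0 W_le ?ltW.
by rewrite ger0_norm//; move: a0; set a := W y - W x => a0; lra.
Qed.

Lemma cadlag_primW f k : periodic f 1 -> bounded_mfun (k : TR -> R) ->
  is_primW f k -> cadlag f.
Proof.
move=> pf bk fk; have [_ [M kM]] := bk.
have M0 : 0 <= M by exact: le_trans (kM 0).
have Lip z y : 0 <= z -> z <= y -> y <= 1 -> `|f y - f z| <= M * (W y - W z).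
  by move=> *; apply: (primW_lip bk fk).
have fR : forall x, f y @[y --> x^'+] --> f x.
  apply: shift_ind => [x|x x0 x1]; last exact: primW_cvg_right bk fk x0 x1.
  by rewrite cvg_right_shift pf; under eq_fun do rewrite pf.
move=> x; split => //; move: x; apply: shift_ind_oc => [x|x x0 x1].
  split=> /cvg_ex[l].
    by move=> /cvg_left_shift H; apply/cvg_ex; exists l; move: H; under eq_fun do rewrite pf.
  move=> H; apply/cvg_ex; exists l; apply/cvg_left_shift.
  by under eq_fun do rewrite pf.
apply: (@lip_cvg_left _ W M) => // [z y z0 zy yx|]; last exact: W_le.
by apply: Lip => //; exact: le_trans x1.
Qed.

Lemma primV_cvg_left f k (x : R) : bounded_mfun (k : TR -> R) -> is_primV f k ->
  0 < x -> x <= 1 -> f y @[y --> x^'-] --> f x.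
Proof.
move=> bk fk x0 x1; have [_ [M kM]] := bk.
have M0 : 0 <= M by exact: le_trans (kM 0).
have Lip z y : 0 <= z -> z <= y -> y <= 1 -> `|f y - f z| <= M * (V y - V z).
  by move=> *; apply: (primV_lip bk fk).
apply/cvg_leftP => e e0.
have [/cvg_leftP/(_ (e / (M + 1))) + _] := caglad_driver_caglad V x.
rewrite divr_gt0//; last lra.
move=> /(_ isT) [d d0 D].
exists (Num.min d x); first by rewrite lt_min d0.
move=> y; rewrite ltrBlDl -ltrBlDr lt_min !ltrBlDr -!ltrBlDl => /andP[yd].
rewrite subrr => y0 yx.
rewrite distrC; apply: le_lt_trans (Lip y x (ltW y0) (ltW yx) x1) _.
have := D y yd yx; rewrite ltr_pdivlMr; last lra.
apply: le_lt_trans; have a0 : 0 <= V x - V y by rewrite subr_ge0 V_le ?ltW.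
by rewrite distrC ger0_norm//; move: a0; set a := V x - V y => a0; lra.
Qed.

Lemma caglad_primV f k : periodic f 1 -> bounded_mfun (k : TR -> R) ->
  is_primV f k -> caglad f.
Proof.
move=> pf bk fk; have [_ [M kM]] := bk.
have M0 : 0 <= M by exact: le_trans (kM 0).
have Lip z y : 0 <= z -> z <= y -> y <= 1 -> `|f y - f z| <= M * (V y - V z).
  by move=> *; apply: (primV_lip bk fk).
have fL : forall x, f y @[y --> x^'-] --> f x.
  apply: shift_ind_oc => [x|x x0 x1]; last exact: primV_cvg_left bk fk x0 x1.
  by rewrite cvg_left_shift pf; under eq_fun do rewrite pf.
move=> x; split => //; move: x; apply: shift_ind => [x|x x0 x1].
  split=> /cvg_ex[l].
    by move=> /cvg_right_shift H; apply/cvg_ex; exists l; move: H; under eq_fun do rewrite pf.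
  move=> H; apply/cvg_ex; exists l; apply/cvg_right_shift.
  by under eq_fun do rewrite pf.
apply: (@lip_cvg_right _ V M) => // [z y z0 zy yx|]; last exact: V_le.
by apply: Lip => //; exact: le_trans z0.
Qed.

Lemma W_shift (x : R) : W (x + 1) = W x + (W 1 - W 0).
Proof. by have := cadlag_driver_shift W x; lra. Qed.

Lemma V_shift (x : R) : V (x + 1) = V x + (V 1 - V 0).
Proof. by have := caglad_driver_shift V x; lra. Qed.

(** Subtracting [k x * W] from f leaves a primitive of [k - k x]. This integrand is small just
    before x by left continuity and vanishes at x itself, so an atom of [W] at x does no harm. *)
Lemma primW_lderive f k (x : R) : bounded_mfun (k : TR -> R) -> is_primW f k ->
  0 < x -> x <= 1 -> k y @[y --> x^'-] --> k x ->
  diff_quotient W f x h @[h --> 0^'-] --> k x.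
Proof.
move=> bk fk x0 x1 kL.
apply/cvg_leftP => e e0.
have /cvg_leftP/(_ (e / 2))[|d d0 D] := kL; first lra.
exists (Num.min d x); first by rewrite lt_min d0.
move=> h; rewrite sub0r ltrNl lt_min => /andP[hd hx] h0.
have Wp : 0 < W x - W (x + h) by rewrite subr_gt0; apply: cadlag_driver_incr; lra.
have bc : bounded_mfun ((fun t => k t - k x) : TR -> R).
  have [mk [M kM]] := bk; split.
    by apply: measurable_funB => //; exact: measurable_cst.
  exists (M + M) => t; apply: (le_trans (ler_normB _ _)); rewrite lerD//.
have H : `|f x - k x * W x - (f (x + h) - k x * W (x + h))| <= e / 2 * (W x - W (x + h)).
  apply: (@primW_lip (fun t => f t - k x * W t) (fun t => k t - k x)) => //.
  - move=> z y z0 zy y1.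
    rewrite !prim_leB; [|exact: bounded_L2|exact: L2_cst].
    rewrite [RHS](_ : _ = (prim_le mu k y - prim_le mu k z) -
       (prim_le mu (fun=> k x) y - prim_le mu (fun=> k x) z)); last by ring.
    rewrite -fk// [in RHS]prim_leB_itv//; last exact: L2_cst.
    have -> : \int[mu]_t (\1_(`]z, y]) t * k x) = (W y - W z) * k x.
      rewrite RintegralZr//; last by apply: L2_integrable; apply: indic_L2; exact: measurable_itv.
      by rewrite int_indicW.
    by ring.
  - lra.
  - lra.
  - move=> t t1 t2; have [->|tx] := eqVneq t x; first by rewrite subrr normr0; lra.
    by apply/ltW/D; [lra|rewrite lt_neqAle tx].
rewrite /diff_quotient.
have -> : (f (x + h) - f x) / (W (x + h) - W x) - k x =
    (f x - k x * W x - (f (x + h) - k x * W (x + h))) / (W x - W (x + h)).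
  by field; rewrite ?subr_eq0; apply/andP; split; apply/eqP; lra.
rewrite normrM normfV (gtr0_norm Wp) ltr_pdivrMr//; apply: le_lt_trans H _.
by rewrite ltr_pM2r//; lra.
Qed.

Lemma diff_quotient_shift f U x : periodic f 1 -> (forall x, U (x + 1) = U x + (U 1 - U 0)) ->
  diff_quotient U f (x + 1) = diff_quotient U f x.
Proof.
move=> pf US; apply/funext => h; rewrite /diff_quotient addrAC !pf !US.
by congr (_ / _); ring.
Qed.

Lemma lderive_primW f k : periodic f 1 -> periodic k 1 ->
  bounded_mfun (k : TR -> R) -> is_primW f k ->
  (forall x, k y @[y --> x^'-] --> k x) ->
  forall x, diff_quotient W f x h @[h --> 0^'-] --> k x.
Proof.
move=> pf pk bk fk kL; apply: shift_ind_oc => [x|x x0 x1]; last exact: primW_lderive.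
by rewrite pk diff_quotient_shift//; exact: W_shift.
Qed.

Lemma primV_rderive f k (x : R) : bounded_mfun (k : TR -> R) -> is_primV f k ->
  0 <= x -> x < 1 -> k y @[y --> x^'+] --> k x ->
  diff_quotient V f x h @[h --> 0^'+] --> k x.
Proof.
move=> bk fk x0 x1 kL.
apply/cvg_rightP => e e0.
have /cvg_rightP/(_ (e / 2))[|d d0 D] := kL; first lra.
exists (Num.min d (1 - x)); first by rewrite lt_min d0 subr_gt0.
move=> h h0; rewrite add0r lt_min => /andP[hd hx].
have Vp : 0 < V (x + h) - V x by rewrite subr_gt0; apply: caglad_driver_incr; lra.
have bc : bounded_mfun ((fun t => k t - k x) : TR -> R).
  have [mk [M kM]] := bk; split.
    by apply: measurable_funB => //; exact: measurable_cst.
  exists (M + M) => t; apply: (le_trans (ler_normB _ _)); rewrite lerD//.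
have H : `|f (x + h) - k x * V (x + h) - (f x - k x * V x)| <= e / 2 * (V (x + h) - V x).
  apply: (@primV_lip (fun t => f t - k x * V t) (fun t => k t - k x)) => //.
  - move=> z y z0 zy y1.
    rewrite !prim_ltB; [|exact: bounded_L2|exact: L2_cst].
    rewrite [RHS](_ : _ = (prim_lt nu k y - prim_lt nu k z) -
       (prim_lt nu (fun=> k x) y - prim_lt nu (fun=> k x) z)); last by ring.
    rewrite -fk// [in RHS]prim_ltB_itv//; last exact: L2_cst.
    have -> : \int[nu]_t (\1_(`[z, y[) t * k x) = (V y - V z) * k x.
      rewrite RintegralZr//; last by apply: L2_integrable; apply: indic_L2; exact: measurable_itv.
      by rewrite int_indicV.
    by ring.
  - lra.
  - lra.
  - move=> t t1 t2; have [->|tx] := eqVneq t x; first by rewrite subrr normr0; lra.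
    by apply/ltW/D; [rewrite lt_neqAle eq_sym tx|lra].
rewrite /diff_quotient.
have -> : (f (x + h) - f x) / (V (x + h) - V x) - k x =
    (f (x + h) - k x * V (x + h) - (f x - k x * V x)) / (V (x + h) - V x).
  by field; lra.
rewrite normrM normfV (gtr0_norm Vp) ltr_pdivrMr//; apply: le_lt_trans H _.
by rewrite ltr_pM2r//; lra.
Qed.

Lemma rderive_primV f k : periodic f 1 -> periodic k 1 ->
  bounded_mfun (k : TR -> R) -> is_primV f k ->
  (forall x, k y @[y --> x^'+] --> k x) ->
  forall x, diff_quotient V f x h @[h --> 0^'+] --> k x.
Proof.
move=> pf pk bk fk kL; apply: shift_ind => [x|x x0 x1]; last exact: primV_rderive.
by rewrite pk diff_quotient_shift//; exact: V_shift.
Qed.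

Lemma prim_le_sub_const f k z : is_primW f k -> 0 <= z -> z <= 1 ->
  f z = prim_le mu k z + (f 0 - prim_le mu k 0).
Proof. by move=> fk z0 z1; have := fk 0 z (lexx _) z0 z1; lra. Qed.

Lemma prim_lt_sub_const f k z : is_primV f k -> 0 <= z -> z <= 1 ->
  f z = prim_lt nu k z + (f 0 - prim_lt nu k 0).
Proof. by move=> fk z0 z1; have := fk 0 z (lexx _) z0 z1; lra. Qed.

Lemma eq_intW (f g : TR -> R) : measurable_fun setT f -> measurable_fun setT g ->
  (forall x : R, 0 < x < 1 -> f x = g x) -> \int[mu]_x f x = \int[mu]_x g x.
Proof.
move=> mf mg fg; congr fine; apply: ae_eq_integral => //; [exact/measurable_EFinP..|].
by apply: filterS (ae_measW W) => x x01 _; rewrite fg.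
Qed.

Lemma eq_intV (f g : TR -> R) : measurable_fun setT f -> measurable_fun setT g ->
  (forall x : R, 0 < x < 1 -> f x = g x) -> \int[nu]_x f x = \int[nu]_x g x.
Proof.
move=> mf mg fg; congr fine; apply: ae_eq_integral => //; [exact/measurable_EFinP..|].
by apply: filterS (ae_measV V) => x x01 _; rewrite fg.
Qed.

(** The closed ray contains 0, but 0 has no mass. *)
Lemma prim_le0 k : L2 mu k -> prim_le mu k 0 = 0.
Proof.
move=> kL; rewrite /prim_le (@eq_intW _ (fun=> 0)) ?Rintegral_cst ?mul0r//.
  exact: L2_measurable (L2_mul_indic (measurable_ray_le 0) kL).
by move=> x /andP[x0 _]; rewrite indic_ray_le leNgt x0 mul0r.
Qed.

Lemma prim_le1 k : L2 mu k -> prim_le mu k 1 = \int[mu]_x k x.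
Proof.
move=> kL; apply: eq_intW => //.
- exact: L2_measurable (L2_mul_indic (measurable_ray_le 1) kL).
- exact: L2_measurable kL.
- by move=> x /andP[_ x1]; rewrite indic_ray_le ltW// mul1r.
Qed.

Lemma prim_lt0 k : L2 nu k -> prim_lt nu k 0 = 0.
Proof.
move=> kL; rewrite /prim_lt (@eq_intV _ (fun=> 0)) ?Rintegral_cst ?mul0r//.
  exact: L2_measurable (L2_mul_indic (measurable_ray_lt 0) kL).
by move=> x /andP[x0 _]; rewrite indic_ray_lt ltNge ltW// mul0r.
Qed.

Lemma prim_lt1 k : L2 nu k -> prim_lt nu k 1 = \int[nu]_x k x.
Proof.
move=> kL; apply: eq_intV => //.
- exact: L2_measurable (L2_mul_indic (measurable_ray_lt 1) kL).
- exact: L2_measurable kL.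
- by move=> x /andP[_ x1]; rewrite indic_ray_lt x1 mul1r.
Qed.

Lemma lderive_periodic f : periodic f 1 -> periodic (lderive W f) 1.
Proof.
by move=> pf x; rewrite /lderive diff_quotient_shift//; exact: W_shift.
Qed.

Lemma rderive_periodic f : periodic f 1 -> periodic (rderive V f) 1.
Proof.
by move=> pf x; rewrite /rderive diff_quotient_shift//; exact: V_shift.
Qed.

(** f and the primitive of [lderive W f] have the same left W-derivative, since this derivative is
    left continuous; so their difference is constant on [0, 1]. The zero mean expresses f 1 = f
    0. *)
Lemma FTC_W f : periodic f 1 -> cadlag f -> lderivable W f -> caglad (lderive W f) ->
  [/\ bounded_mfun (lderive W f : TR -> R), is_primW f (lderive W f) &
      \int[mu]_x lderive W f x = 0].
Proof.
move=> pf fc df dc; set F := lderive W f.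
have bF : bounded_mfun (F : TR -> R).
  apply: periodic_bounded_mfun; first exact: lderive_periodic.
  exact: caglad_regulated.
have JF : is_primW (prim_le mu F) F by [].
have fF : is_primW f F.
  move=> z y z0 zy y1.
  suff : f z - prim_le mu F z = f y - prim_le mu F y by lra.
  apply: (@left_derivative0_cst _ (fun x => f x - prim_le mu F x) W) => //.
  - move=> x zx xy; apply: cvgB; first by have [] := fc x.
    by apply: (primW_cvg_right bF JF); [exact: le_trans zx|exact: lt_le_trans y1].
  - by move=> x _ _; have [] := cadlag_driver_cadlag W x.
  - move=> x zx xy e e0.
    have x0 : 0 < x by exact: le_lt_trans zx.
    have x1 : x <= 1 by exact: le_trans y1.
    have D1 : diff_quotient W f x h @[h --> 0^'-] --> F x by exact: df.
    have D2 : diff_quotient W (prim_le mu F) x h @[h --> 0^'-] --> F x.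
      by apply: (primW_lderive bF JF) => //; have [] := dc x.
    have /cvg_leftP/(_ e e0)[d d0 D] : diff_quotient W f x h -
        diff_quotient W (prim_le mu F) x h @[h --> 0^'-] --> (0 : R).
      by rewrite -[X in _ --> X](subrr (F x)); exact: (cvgB D1 D2).
    exists d => // t xt tx.
    have := D (t - x); rewrite subr0 /= /diff_quotient (addrC x) subrK.
    have Wp : 0 < W x - W t by rewrite subr_gt0; exact: cadlag_driver_incr.
    have -> : (f t - f x) / (W t - W x) -
        (prim_le mu F t - prim_le mu F x) / (W t - W x) =
        (f x - prim_le mu F x - (f t - prim_le mu F t)) / (W x - W t).
      by field; apply/andP; split; apply/eqP; lra.
    rewrite normrM normfV (gtr0_norm Wp) ltr_pdivrMr// => H.
    by apply/ltW/H; lra.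
split => //; rewrite -prim_le1; last exact: bounded_L2.
have := fF 0 1 (lexx _) ler01 (lexx _).
rewrite prim_le0; last exact: bounded_L2.
by rewrite -[X in f X]add0r pf subrr subr0.
Qed.

Lemma FTC_V f : periodic f 1 -> caglad f -> rderivable V f -> cadlag (rderive V f) ->
  [/\ bounded_mfun (rderive V f : TR -> R), is_primV f (rderive V f) &
      \int[nu]_x rderive V f x = 0].
Proof.
move=> pf fc df dc; set F := rderive V f.
have bF : bounded_mfun (F : TR -> R).
  apply: periodic_bounded_mfun; first exact: rderive_periodic.
  exact: cadlag_regulated.
have JF : is_primV (prim_lt nu F) F by [].
have fF : is_primV f F.
  move=> z y z0 zy y1.
  suff : f z - prim_lt nu F z = f y - prim_lt nu F y by lra.
  apply: (@right_derivative0_cst _ (fun x => f x - prim_lt nu F x) V) => //.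
  - move=> x zx xy; apply: cvgB; first by have [] := fc x.
    by apply: (primV_cvg_left bF JF); [exact: le_lt_trans zx|exact: le_trans y1].
  - by move=> x _ _; have [] := caglad_driver_caglad V x.
  - move=> x zx xy e e0.
    have x0 : 0 <= x by exact: le_trans zx.
    have x1 : x < 1 by exact: lt_le_trans y1.
    have D1 : diff_quotient V f x h @[h --> 0^'+] --> F x by exact: df.
    have D2 : diff_quotient V (prim_lt nu F) x h @[h --> 0^'+] --> F x.
      by apply: (primV_rderive bF JF) => //; have [] := dc x.
    have /cvg_rightP/(_ e e0)[d d0 D] : diff_quotient V f x h -
        diff_quotient V (prim_lt nu F) x h @[h --> 0^'+] --> (0 : R).
      by rewrite -[X in _ --> X](subrr (F x)); exact: (cvgB D1 D2).
    exists d => // t xt tx.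
    have := D (t - x); rewrite subr0 /= /diff_quotient (addrC x) subrK.
    have Vp : 0 < V t - V x by rewrite subr_gt0; exact: caglad_driver_incr.
    have -> : (f t - f x) / (V t - V x) -
        (prim_lt nu F t - prim_lt nu F x) / (V t - V x) =
        (f t - prim_lt nu F t - (f x - prim_lt nu F x)) / (V t - V x).
      by field; lra.
    rewrite normrM normfV (gtr0_norm Vp) ltr_pdivrMr// => H.
    by apply/ltW/H; lra.
split => //; rewrite -prim_lt1; last exact: bounded_L2.
have := fF 0 1 (lexx _) ler01 (lexx _).
rewrite prim_lt0; last exact: bounded_L2.
by rewrite -[X in f X]add0r pf subrr subr0.
Qed.

End indefinite_integrals.

(** * Density of the ranges of the primitives *)

Section range_density.
Context d (T : measurableType d) (T0 : Type) (R : realType).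
Variable m : {finite_measure set T -> \bar R}.
Variables (K : set (T0 -> R)) (L : (T0 -> R) -> T -> R).
Hypotheses (mT : fine (m setT) != 0)
  (K0 : K (fun=> 0))
  (KD : forall f g a, K f -> K g -> K (fun x => a * f x + g x))
  (LL2 : forall k, K k -> L2 m (L k))
  (Llin : forall f g a, K f -> K g ->
     L (fun x => a * f x + g x) = (fun x => a * L f x + L g x)).

(** The target is recentered inside the definition: the functions satisfying it then form a subspace
    containing the constants, as the density theorem requires, and indicators, which are not
    centered, can be used as generators. *)
Definition in_closure (F : T -> R) := forall e : R, 0 < e ->
  exists2 k, K k & nrm m (fun x => L k x - ctr m F x) < e.

Lemma range0 : L (fun=> 0) = (fun=> 0).
Proof.
have H := Llin (-1) K0 K0.
have E : (fun _ : T0 => -1 * 0 + 0 : R) = (fun=> 0).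
  by apply/funext => x; rewrite mulr0 addr0.
by rewrite -[in LHS]E H; apply/funext => x; rewrite mulN1r addNr.
Qed.

Lemma in_closure_cst c : in_closure (fun=> c).
Proof.
move=> e e0; exists (fun=> 0) => //.
rewrite range0 ctr_cst// (@eq_nrm _ _ _ _ _ (fun=> 0)) ?nrm_cst ?normr0 ?mul0r//.
by move=> x; rewrite subrr.
Qed.

Lemma in_closureD (f g : T -> R) a : L2 m f -> L2 m g -> in_closure f -> in_closure g ->
  in_closure (fun x => a * f x + g x).
Proof.
move=> fL gL cf cg e e0.
(* The added 1 keeps the denominator positive when a = 0. *)
have [|k1 K1 H1] := cf (e / 2 / (`|a| + 1)).
  by apply: divr_gt0; [lra|rewrite ltr_wpDl].
have [|k2 K2 H2] := cg (e / 2); first lra.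
exists (fun x => a * k1 x + k2 x); first exact: KD.
have aL := L2Z a fL.
rewrite Llin// (@eq_nrm _ _ _ _ _
   (fun x => a * (L k1 x - ctr m f x) + (L k2 x - ctr m g x))); last first.
  by move=> x; rewrite /ctr meanD// meanZ//; ring.
have d1 := L2B (LL2 K1) (L2_ctr fL); have d2 := L2B (LL2 K2) (L2_ctr gL).
apply: le_lt_trans (nrmD (L2Z a d1) d2) _; rewrite nrmZ//.
move: H1; rewrite ltr_pdivlMr ?ltr_wpDl//.
have := nrm_ge0 m (fun x => L k1 x - ctr m f x).
set n := nrm _ _; lra.
Qed.

Lemma in_closure_closed f : L2 m f ->
  (forall e : R, 0 < e -> exists g, [/\ L2 m g, in_closure g &
     nrm m (fun x => g x - f x) < e]) -> in_closure f.
Proof.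
move=> fL H e e0; have e2 : 0 < e / 2 by lra.
have [g [gL cg gf]] := H _ e2; have [k Kk kg] := cg _ e2.
exists k => //.
apply: le_lt_trans (nrm_triangle (LL2 Kk) (L2_ctr fL) (L2_ctr gL)) _.
have -> : (fun x => ctr m g x - ctr m f x) = ctr m (fun x => g x - f x).
  by rewrite (ctrB gL fL).
rewrite [e]splitr; apply: ltrD; first exact: kg.
exact: le_lt_trans (nrm_ctr (L2B gL fL)) gf.
Qed.

Lemma in_closure_dense (G : set (set T)) : @measurable _ T = <<s G >> -> setI_closed G ->
  (forall B, G B -> in_closure \1_B) -> forall f, L2 m f -> in_closure f.
Proof.
move=> GE GI GA; apply: (L2_density _ _ _ _ GE GI GA).
- move=> f g fL gL cf cg; have := in_closureD 1 fL gL cf cg.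
  by congr in_closure; apply/funext => x; rewrite mul1r.
- move=> a f fL cf; have := in_closureD a fL (L2_cst m 0) cf (in_closure_cst 0).
  by congr in_closure; apply/funext => x; rewrite addr0.
- exact: in_closure_cst.
- exact: in_closure_closed.
Qed.

End range_density.

(** * Ramps and half-lines for [W] and [V] *)

Section dense_ranges.
Context (R : realType).
Variables (W : cadlag_driver R) (V : caglad_driver R).
Local Notation TR := (measurableTypeR R).
Local Notation mu := (measW W).
Local Notation nu := (measV V).
Implicit Types (f g h k : R -> R).

Lemma massW_neq0 : fine (mu setT) != 0.
Proof.
rewrite gt_eqF//; apply: (@lt_le_trans _ _ (W (1/2) - W 0)).
  by rewrite subr_gt0; apply: cadlag_driver_incr; lra.
rewrite -lee_fin fineK; last exact: fin_num_measure.
rewrite -(@measW_oc _ W); [|lra..].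
by apply: le_measure; rewrite ?inE; [exact: measurable_itv|exact: measurableT|exact: subsetT].
Qed.

Lemma massV_neq0 : fine (nu setT) != 0.
Proof.
rewrite gt_eqF//; apply: (@lt_le_trans _ _ (V (1/2) - V 0)).
  by rewrite subr_gt0; apply: caglad_driver_incr; lra.
rewrite -lee_fin fineK; last exact: fin_num_measure.
rewrite -(@measV_itv _ V); [|lra..].
by apply: le_measure; rewrite ?inE; [exact: measurable_itv|exact: measurableT|exact: subsetT].
Qed.

Definition centered_bounded k := bounded_mfun (k : TR -> R) /\ \int[mu]_x k x = 0.

Lemma bounded_mfunD (a : R) f g : bounded_mfun (f : TR -> R) -> bounded_mfun (g : TR -> R) ->
  bounded_mfun ((fun x => a * f x + g x) : TR -> R).
Proof.
move=> [mf [M fM]] [mg [N gN]]; split.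
  by apply: measurable_funD => //; apply: measurable_funM => //; exact: measurable_cst.
exists (`|a| * M + N) => x; apply: (le_trans (ler_normD _ _)).
by rewrite lerD// normrM ler_wpM2l.
Qed.

Lemma bounded_mfun_cst (c : R) : bounded_mfun ((fun=> c) : TR -> R).
Proof. by split; [exact: measurable_cst|exists `|c|]. Qed.

Lemma centered_boundedD f g (a : R) : centered_bounded f -> centered_bounded g ->
  centered_bounded (fun x => a * f x + g x).
Proof.
move=> [bf f0] [bg g0]; split; first exact: bounded_mfunD.
have fL := bounded_L2 mu bf; have gL := bounded_L2 mu bg.
rewrite RintegralD//; [|exact/L2_integrable/L2Z|exact: L2_integrable].
by rewrite RintegralZl ?f0 ?g0 ?mulr0 ?addr0//; exact: L2_integrable.
Qed.

Lemma centered_bounded0 : centered_bounded (fun=> 0).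
Proof. by split; [exact: bounded_mfun_cst|rewrite Rintegral_cst// mul0r]. Qed.

(* On centered functions, [cprimW] inverts D_W^- and [prim2] inverts
   D_V^+ D_W^-. *)
Definition cprimW k := ctr nu (prim_le mu k).
Definition prim2 k := ctr mu (prim_lt nu (cprimW k)).

Lemma ctr_lin (m : {finite_measure set TR -> \bar R}) f g (a : R) :
  L2 m f -> L2 m g -> ctr m (fun x => a * f x + g x) = (fun x => a * ctr m f x + ctr m g x).
Proof.
move=> fL gL; apply/funext => x; rewrite /ctr meanD ?meanZ//; last exact: L2Z.
by ring.
Qed.

Lemma prim_le_lin (m : {finite_measure set TR -> \bar R}) f g (a : R) :
  L2 m f -> L2 m g ->
  prim_le m (fun x => a * f x + g x) = (fun x => a * prim_le m f x + prim_le m g x).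
Proof.
move=> fL gL.
have -> : (fun x => a * f x + g x) = (fun x => g x - (- a) * f x).
  by apply/funext => x; rewrite mulNr opprK addrC.
rewrite (prim_leB gL (L2Z _ fL)) (prim_leZ _ fL); apply/funext => x.
by rewrite mulNr opprK addrC.
Qed.

Lemma prim_lt_lin (m : {finite_measure set TR -> \bar R}) f g (a : R) :
  L2 m f -> L2 m g ->
  prim_lt m (fun x => a * f x + g x) = (fun x => a * prim_lt m f x + prim_lt m g x).
Proof.
move=> fL gL.
have -> : (fun x => a * f x + g x) = (fun x => g x - (- a) * f x).
  by apply/funext => x; rewrite mulNr opprK addrC.
rewrite (prim_ltB gL (L2Z _ fL)) (prim_ltZ _ fL); apply/funext => x.
by rewrite mulNr opprK addrC.
Qed.

Lemma L2_prim_le (m : {finite_measure set TR -> \bar R}) k : L2 mu k -> L2 m (prim_le mu k).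
Proof. by move=> kL; exact/bounded_L2/bounded_prim_le. Qed.

Lemma L2_prim_lt (m : {finite_measure set TR -> \bar R}) h : L2 nu h -> L2 m (prim_lt nu h).
Proof. by move=> kL; exact/bounded_L2/bounded_prim_lt. Qed.

Lemma bounded_ctr (m : {finite_measure set TR -> \bar R}) f :
  bounded_mfun (f : TR -> R) -> bounded_mfun (ctr m f : TR -> R).
Proof.
move=> bf; have := bounded_mfunD 1 bf (bounded_mfun_cst (- mean m f)).
by congr bounded_mfun; apply/funext => x; rewrite mul1r.
Qed.

Lemma L2_cprimW (m : {finite_measure set TR -> \bar R}) k : L2 mu k -> L2 m (cprimW k).
Proof. by move=> kL; apply/bounded_L2/bounded_ctr/bounded_prim_le. Qed.

Lemma cprimW_lin f g (a : R) : L2 mu f -> L2 mu g ->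
  cprimW (fun x => a * f x + g x) = (fun x => a * cprimW f x + cprimW g x).
Proof. by move=> fL gL; rewrite /cprimW prim_le_lin// ctr_lin//; exact: L2_prim_le. Qed.

Lemma prim2_lin f g (a : R) : L2 mu f -> L2 mu g ->
  prim2 (fun x => a * f x + g x) = (fun x => a * prim2 f x + prim2 g x).
Proof.
move=> fL gL; rewrite /prim2 cprimW_lin// prim_lt_lin//; [|exact: L2_cprimW..].
by rewrite ctr_lin//; apply: L2_prim_lt; exact: L2_cprimW.
Qed.

Lemma bounded_prim2 k : L2 mu k -> bounded_mfun (prim2 k : TR -> R).
Proof. by move=> kL; apply/bounded_ctr/bounded_prim_lt/L2_cprimW. Qed.

Lemma int_ctr (m : {finite_measure set TR -> \bar R}) f :
  fine (m setT) != 0 -> L2 m f -> \int[m]_x ctr m f x = 0.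
Proof.
move=> m0 fL; rewrite RintegralB//; [|exact: L2_integrable|exact/L2_integrable/L2_cst].
by rewrite Rintegral_cst// -meanK// mulrC subrr.
Qed.

Lemma centered_prim2 k : L2 mu k -> centered_bounded (prim2 k).
Proof.
move=> kL; split; first exact: bounded_prim2.
by apply: int_ctr; [exact: massW_neq0|apply/L2_prim_lt/L2_cprimW].
Qed.

Lemma prim_le_indic (m : {finite_measure set TR -> \bar R}) (A : set TR) y :
  measurable A -> 0 <= prim_le m \1_A y <= \int[m]_x \1_A x.
Proof.
move=> mA; have AL := indic_L2 m mA; apply/andP; split.
  by apply: Rintegral_ge0 => x _; rewrite !indicE mulr_ge0.
apply: le_Rintegral => //; [exact: integrable_le|exact: L2_integrable|].
by move=> x _; rewrite indic_ray_le ler_piMl// ?indicE// lern1; case: (_ <= _).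
Qed.

Lemma prim_lt_indic (m : {finite_measure set TR -> \bar R}) (A : set TR) y :
  measurable A -> 0 <= prim_lt m \1_A y <= \int[m]_x \1_A x.
Proof.
move=> mA; have AL := indic_L2 m mA; apply/andP; split.
  by apply: Rintegral_ge0 => x _; rewrite !indicE mulr_ge0.
apply: le_Rintegral => //; [exact: integrable_lt|exact: L2_integrable|].
by move=> x _; rewrite indic_ray_lt ler_piMl// ?indicE// lern1; case: (_ < _).
Qed.

Lemma bounded_indic (A : set TR) : measurable A -> bounded_mfun (\1_A : TR -> R).
Proof.
move=> mA; split; first exact: measurable_indic.
by exists 1 => x; rewrite indicE; case: (_ \in _); rewrite /= ?normr1 ?normr0.
Qed.

Lemma bounded_mfunZ (a : R) f : bounded_mfun (f : TR -> R) ->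
  bounded_mfun ((fun x => a * f x) : TR -> R).
Proof.
move=> bf; have := bounded_mfunD a bf (bounded_mfun_cst 0).
by congr bounded_mfun; apply/funext => x; rewrite addr0.
Qed.

(* The primitive of [k] is a ramp from 0 to 1 across ]z, t]. *)
Lemma ramp_le (z t : R) : 0 <= z -> z < t -> t <= 1 -> exists k,
  [/\ bounded_mfun (k : TR -> R), \int[mu]_x k x = 1,
      forall y, y <= z -> prim_le mu k y = 0,
      forall y, t <= y -> prim_le mu k y = 1 &
      forall y, 0 <= prim_le mu k y <= 1].
Proof.
move=> z0 zt t1.
have mA : measurable (`]z, t]%classic : set TR) by exact: measurable_itv.
have AL := indic_L2 mu mA.
have IA := int_indicW W z0 (ltW zt) t1.
have w0 : 0 < W t - W z by rewrite subr_gt0; exact: cadlag_driver_incr.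
exists (fun x => (W t - W z)^-1 * \1_(`]z, t]) x); split.
- exact/bounded_mfunZ/bounded_indic.
- by rewrite RintegralZl ?IA ?mulVf ?gt_eqF//; exact: L2_integrable.
- move=> y yz; rewrite prim_leZ// [X in _ * X](_ : _ = 0) ?mulr0//.
  rewrite /prim_le (@eq_Rintegral _ _ _ _ _ (fun=> 0)) ?Rintegral_cst ?mul0r// => x _.
  rewrite indic_ray_le indicE mem_setE in_itv/=.
  by have [xy|] := leP (x : R) y; [rewrite ltNge (le_trans xy yz) mulr0|rewrite mul0r].
- move=> y ty; rewrite prim_leZ// [X in _ * X](_ : _ = W t - W z) ?mulVf ?gt_eqF//.
  rewrite -IA; apply: eq_Rintegral => x _.
  rewrite indic_ray_le indicE mem_setE in_itv/=.
  have [xy|yx] := leP (x : R) y; first by rewrite mul1r.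
  by rewrite mul0r leNgt (le_lt_trans ty yx) andbF.
- move=> y; rewrite prim_leZ// mulrC; have /andP[p0 p1] := prim_le_indic mu y mA.
  by rewrite divr_ge0 ?(ltW w0)//= ler_pdivrMr// mul1r -IA.
Qed.

Lemma ramp_lt (z t : R) : 0 <= z -> z < t -> t <= 1 -> exists k,
  [/\ bounded_mfun (k : TR -> R), \int[nu]_x k x = 1,
      forall y, y <= z -> prim_lt nu k y = 0,
      forall y, t <= y -> prim_lt nu k y = 1 &
      forall y, 0 <= prim_lt nu k y <= 1].
Proof.
move=> z0 zt t1.
have mA : measurable (`[z, t[%classic : set TR) by exact: measurable_itv.
have AL := indic_L2 nu mA.
have IA := int_indicV V z0 (ltW zt) t1.
have w0 : 0 < V t - V z by rewrite subr_gt0; exact: caglad_driver_incr.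
exists (fun x => (V t - V z)^-1 * \1_(`[z, t[) x); split.
- exact/bounded_mfunZ/bounded_indic.
- by rewrite RintegralZl ?IA ?mulVf ?gt_eqF//; exact: L2_integrable.
- move=> y yz; rewrite prim_ltZ// [X in _ * X](_ : _ = 0) ?mulr0//.
  rewrite /prim_lt (@eq_Rintegral _ _ _ _ _ (fun=> 0)) ?Rintegral_cst ?mul0r// => x _.
  rewrite indic_ray_lt indicE mem_setE in_itv/=.
  by have [xy|] := ltP (x : R) y; [rewrite leNgt (lt_le_trans xy yz) mulr0|rewrite mul0r].
- move=> y ty; rewrite prim_ltZ// [X in _ * X](_ : _ = V t - V z) ?mulVf ?gt_eqF//.
  rewrite -IA; apply: eq_Rintegral => x _.
  rewrite indic_ray_lt indicE mem_setE in_itv/=.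
  have [xy|yx] := ltP (x : R) y; first by rewrite mul1r.
  by rewrite mul0r ltNge (le_trans ty yx) andbF.
- move=> y; rewrite prim_ltZ// mulrC; have /andP[p0 p1] := prim_lt_indic nu y mA.
  by rewrite divr_ge0 ?(ltW w0)//= ler_pdivrMr// mul1r -IA.
Qed.

Lemma nrm_indicV (z t : R) : 0 <= z -> z <= t -> t <= 1 ->
  nrm nu \1_(`[z, t[) = Num.sqrt (V t - V z).
Proof.
move=> z0 zt t1; rewrite /nrm; congr Num.sqrt; rewrite -int_indicV//.
by apply: eq_Rintegral => x _; rewrite indicE; case: (_ \in _); rewrite ?mulr1 ?mulr0.
Qed.

Lemma nrm_indicW (z t : R) : 0 <= z -> z <= t -> t <= 1 ->
  nrm mu \1_(`]z, t]) = Num.sqrt (W t - W z).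
Proof.
move=> z0 zt t1; rewrite /nrm; congr Num.sqrt; rewrite -int_indicW//.
by apply: eq_Rintegral => x _; rewrite indicE; case: (_ \in _); rewrite ?mulr1 ?mulr0.
Qed.

Lemma sqrt_lt_sqr (x e : R) : 0 < e -> x < e ^+ 2 -> Num.sqrt x < e.
Proof.
move=> e0 xe; rewrite -[X in _ < X](@gtr0_norm _ e)// -sqrtr_sqr.
by rewrite ltr_sqrt// exprn_gt0.
Qed.

Lemma eq_nrmV f g : L2 nu f -> L2 nu g -> (forall x, 0 < x < 1 -> f x = g x) ->
  nrm nu (fun x => f x - g x) = 0.
Proof.
move=> fL gL fg; apply/eqP; rewrite eq_le nrm_ge0 andbT.
have -> : 0 = nrm nu (fun=> 0) by rewrite nrm_cst normr0 mul0r.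
apply: le_nrm_ae; [exact: L2B|exact: L2_cst|].
by apply: filterS (ae_measV V) => x x01; rewrite fg// subrr.
Qed.

Lemma eq_nrmW f g : L2 mu f -> L2 mu g -> (forall x, 0 < x < 1 -> f x = g x) ->
  nrm mu (fun x => f x - g x) = 0.
Proof.
move=> fL gL fg; apply/eqP; rewrite eq_le nrm_ge0 andbT.
have -> : 0 = nrm mu (fun=> 0) by rewrite nrm_cst normr0 mul0r.
apply: le_nrm_ae; [exact: L2B|exact: L2_cst|].
by apply: filterS (ae_measW W) => x x01; rewrite fg// subrr.
Qed.

Lemma norm_1B (p : R) : 0 <= p <= 1 -> `|1 - p| <= 1.
Proof. by move=> /andP[p0 p1]; rewrite ger0_norm ?subr_ge0// lerBlDr lerDl. Qed.

(* The indicator of y < a differs from the ramp rising across ]0, d] minus the one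
   rising across ]a - d, a] only on [0, d) and [a - d, a), whose dV-mass tends
   to 0 with [d] because V is left continuous and has no atom at 0. *)
Lemma cprimW_dense f : L2 nu f -> in_closure nu centered_bounded cprimW f.
Proof.
have KL2 k : centered_bounded k -> L2 mu k by move=> [bk _]; exact: bounded_L2.
have CD := @in_closure_dense _ TR R R nu centered_bounded cprimW massV_neq0
  centered_bounded0 (fun f g a => @centered_boundedD f g a)
  (fun k Kk => L2_cprimW nu (KL2 _ Kk)) (fun f g a Kf Kg => cprimW_lin a (KL2 _ Kf) (KL2 _ Kg)).
have CC := @in_closure_closed _ TR R R nu centered_bounded cprimW
  (fun k Kk => L2_cprimW nu (KL2 _ Kk)).
have C1 c := @in_closure_cst _ TR R R nu centered_bounded cprimW massV_neq0
  centered_bounded0 (fun f g a Kf Kg => cprimW_lin a (KL2 _ Kf) (KL2 _ Kg)) c.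
(* The rays exclude their endpoint a: the error near a then lives on [a - d, a), which stays clear
   of a possible atom of [V] at a. *)
apply: (CD (@RGenInftyO.G R)).
- exact: RGenInftyO.measurableE.
- move=> _ _ [x ->] [y ->]; exists (Num.min x y).
  by apply/seteqP; split => z /=; rewrite !in_itv/= lt_min => /andP.
move=> _ [a ->].
have mA : measurable (`]-oo, a[%classic : set TR) by exact: measurable_itv.
have AL := indic_L2 nu mA.
(* A ray ending outside (0, 1) has an almost everywhere constant indicator. *)
have [a0|a0] := leP a 0.
  apply: CC => // e e0; exists (fun=> 0); split; [exact: L2_cst|exact: C1|].
  rewrite eq_nrmV//; first exact: L2_cst.
  by move=> x /andP[x0 _]; rewrite indic_ray_lt ltNge (le_trans a0 (ltW x0)).
have [a1|a1] := leP 1 a.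
  apply: CC => // e e0; exists (fun=> 1); split; [exact: L2_cst|exact: C1|].
  rewrite eq_nrmV//; first exact: L2_cst.
  by move=> x /andP[_ x1]; rewrite indic_ray_lt (lt_le_trans x1 a1).
move=> e e0; have e2 : 0 < e / 2 by lra.
have [d [d0 dad d1 ad0 ada] [H1 H2]] : exists2 d : R,
    [/\ 0 < d, d < a - d, d <= 1, 0 <= a - d & a - d < a] &
    Num.sqrt (V d - V 0) < e / 2 /\ Num.sqrt (V a - V (a - d)) < e / 2.
  clear -a0 a1 e2.
  have e20 : 0 < (e / 2) ^+ 2 by rewrite exprn_gt0.
  have [d1 d10 D1] := V_near0 V e20.
  have [/cvg_leftP/(_ _ e20)[d2 d20 D2] _] := caglad_driver_caglad V a.
  (* The bound a / 3 separates the two ramps; the halves leave room for strict inequalities. *)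
  pose d := Num.min (a / 3) (Num.min (d1 / 2) (d2 / 2)).
  have d0 : 0 < d by rewrite !lt_min !divr_gt0.
  have [da [dd1 dd2]] : d <= a / 3 /\ d <= d1 / 2 /\ d <= d2 / 2.
    by rewrite /d !ge_min !lexx !orbT.
  exists d; first by split; lra.
  split; apply: sqrt_lt_sqr => //; apply: le_lt_trans (ler_norm _) _.
    rewrite caglad_driver0 subr0; apply: D1.
    by rewrite gtr0_norm//; lra.
  by rewrite distrC; apply: D2; lra.
have [k1 [b1 i1 z1 o1 r1]] := ramp_le (lexx 0) d0 d1.
have [k2 [b2 i2 z2 o2 r2]] := ramp_le ad0 ada (ltW a1).
(* Both densities integrate to 1, so their difference is centered: the rise near 0 balances the fall
   before a. *)
have K : centered_bounded (fun x => (-1) * k2 x + k1 x).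
  split; first exact: bounded_mfunD.
  have L1 := bounded_L2 mu b1; have L2' := bounded_L2 mu b2.
  rewrite RintegralD//; [|exact/L2_integrable/L2Z|exact: L2_integrable].
  by rewrite RintegralZl ?i1 ?i2 ?mulr1 ?addNr//; exact: L2_integrable.
exists (fun x => (-1) * k2 x + k1 x) => //.
have kL := KL2 _ K.
have pL := L2_prim_le nu kL.
rewrite /cprimW -ctrB//; apply: le_lt_trans (nrm_ctr (L2B pL AL)) _.
have m1 : measurable (`[0, d[%classic : set TR) by exact: measurable_itv.
have m2 : measurable (`[a - d, a[%classic : set TR) by exact: measurable_itv.
have I1 := indic_L2 nu m1; have I2 := indic_L2 nu m2.
apply: (@le_lt_trans _ _ (nrm nu (fun x => \1_(`[0, d[) x + \1_(`[(a - d), a[) x))).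
  apply: le_nrm_ae; [exact: L2B|exact: L2D|].
  apply: filterS (ae_measV V) => y /andP[y0 y1].
  rewrite (prim_le_lin _ (bounded_L2 mu b2) (bounded_L2 mu b1)).
  rewrite !indicE !mem_setE !in_itv/= (ltW y0)/=.
  rewrite [leRHS]ger0_norm ?addr_ge0//.
  have [yd|dy] := ltP (y : R) d.
    have ya : (y : R) < a - d by exact: lt_trans dad.
    rewrite (z2 _ (ltW ya)) (lt_trans ya ada) mulr0 add0r distrC.
    by apply: (le_trans (norm_1B (r1 _))); rewrite lerDl ler0n.
  rewrite (o1 _ dy) add0r mulN1r (addrC (- _)).
  have [ya|ya] := leP (a - d) (y : R); last first.
    by rewrite (z2 _ (ltW ya)) (lt_trans ya ada) oppr0 addr0 subrr normr0.
  have [ya'|ya'] := ltP (y : R) a => /=; last by rewrite (o2 _ ya') subrr subr0 normr0.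
  by rewrite addrAC subrr add0r normrN; have /andP[p0 p1] := r2 y; rewrite ger0_norm.
apply: le_lt_trans (nrmD I1 I2) _.
by rewrite (nrm_indicV (lexx 0) (ltW d0) d1) (nrm_indicV ad0 (ltW ada) (ltW a1)) [e]splitr ltrD.
Qed.

(* Here 1_(b < y) is compared with the V-primitive of a function [h] concentrated
   on [b, b + d) and [1 - d, 1), and [h] is approximated by W-primitives. *)
Lemma prim2_dense f : L2 mu f -> in_closure mu centered_bounded prim2 f.
Proof.
have KL2 k : centered_bounded k -> L2 mu k by move=> [bk _]; exact: bounded_L2.
have TL2 k (Kk : centered_bounded k) : L2 mu (prim2 k).
  by apply: bounded_L2; exact: bounded_prim2 (KL2 _ Kk).
have CD := @in_closure_dense _ TR R R mu centered_bounded prim2 massW_neq0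
  centered_bounded0 (fun f g a => @centered_boundedD f g a)
  TL2 (fun f g a Kf Kg => prim2_lin a (KL2 _ Kf) (KL2 _ Kg)).
have CC := @in_closure_closed _ TR R R mu centered_bounded prim2 TL2.
have C1 c := @in_closure_cst _ TR R R mu centered_bounded prim2 massW_neq0
  centered_bounded0 (fun f g a Kf Kg => prim2_lin a (KL2 _ Kf) (KL2 _ Kg)) c.
(* Rays open on the left this time: the error after b lives on ]b, b + d], whose mass tends to 0 by
   right continuity of [W]. *)
apply: (CD (@RGenOInfty.G R)).
- exact: RGenOInfty.measurableE.
- move=> _ _ [x ->] [y ->]; exists (Num.max x y).
  by apply/seteqP; split => z /=; rewrite !in_itv/= !andbT gt_max => /andP.
move=> _ [b ->].
have mA : measurable (`]b, +oo[%classic : set TR) by exact: measurable_itv.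
have AL := indic_L2 mu mA.
have iA (x : TR) : \1_(`]b, +oo[) x = (b < (x : R))%R%:R :> R.
  by rewrite indicE mem_setE in_itv/= andbT.
have [b0|b0] := ltP b 0.
  apply: CC => // e e0; exists (fun=> 1); split; [exact: L2_cst|exact: C1|].
  rewrite eq_nrmW//; first exact: L2_cst.
  by move=> x /andP[x0 _]; rewrite iA (lt_trans b0 x0).
have [b1|b1] := leP 1 b.
  apply: CC => // e e0; exists (fun=> 0); split; [exact: L2_cst|exact: C1|].
  rewrite eq_nrmW//; first exact: L2_cst.
  by move=> x /andP[_ x1]; rewrite iA ltNge (ltW (lt_le_trans x1 b1)).
move=> e e0; have e2 : 0 < e / 2 by lra.
have e4 : 0 < e / 2 / 2 by lra.
have [d [d0 bd1 b_bd d10 d11] [H1 H2]] : exists2 d : R,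
    [/\ 0 < d, b + d < 1 - d, b < b + d, 0 <= 1 - d & 1 - d < 1] &
    Num.sqrt (W (b + d) - W b) < e / 2 / 2 /\ Num.sqrt (W 1 - W (1 - d)) < e / 2 / 2.
  clear -b0 b1 e4.
  have e20 : 0 < (e / 2 / 2) ^+ 2 by rewrite exprn_gt0.
  have [d1 [d10 d11 D1]] := W_near1 W e20.
  have [/cvg_rightP/(_ _ e20)[d2 d20 D2] _] := cadlag_driver_cadlag W b.
  pose d := Num.min ((1 - b) / 3) (Num.min (d1 / 2) (d2 / 2)).
  have d0 : 0 < d by rewrite !lt_min !divr_gt0// subr_gt0.
  have [db [dd1 dd2]] : d <= (1 - b) / 3 /\ d <= d1 / 2 /\ d <= d2 / 2.
    by rewrite /d !ge_min !lexx !orbT.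
  exists d; first by split; lra.
  split; apply: sqrt_lt_sqr => //.
    by apply: le_lt_trans (ler_norm _) _; apply: D2; lra.
  by apply: D1; lra.
have bd_1 : b + d <= 1 by exact/ltW/(lt_trans bd1).
have [k1 [c1 i1 z1 o1 r1]] := ramp_lt b0 b_bd bd_1.
have [k2 [c2 i2 z2 o2 r2]] := ramp_lt d10 d11 (lexx 1).
pose h x := (-1) * k2 x + k1 x.
have bh : bounded_mfun (h : TR -> R) by exact: bounded_mfunD.
have L1 := bounded_L2 nu c1; have L2' := bounded_L2 nu c2.
have hL := bounded_L2 nu bh.
have h0 : \int[nu]_x h x = 0.
  rewrite RintegralD//; [|exact/L2_integrable/L2Z|exact: L2_integrable].
  by rewrite RintegralZl ?i1 ?i2 ?mulr1 ?addNr//; exact: L2_integrable.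
have ctrh : ctr nu h = h.
  by apply/funext => x; rewrite /ctr /mean h0 mul0r subr0.
(* C bounds [prim_lt] as an operator from L^2(dV) to L^2(dW), through the uniform norm. The
   approximation of h is taken finer by the factor C + 1, which is positive even if C is 0. *)
pose C := Num.sqrt (fine (nu setT)) * Num.sqrt (fine (mu setT)).
have C0 : 0 <= C by rewrite mulr_ge0 ?sqrtr_ge0.
have C1' : 0 < C + 1 by rewrite ltr_wpDl.
have LVh : in_closure nu centered_bounded cprimW h by exact: cprimW_dense.
have [|k Kk kh] := LVh (e / 2 / (C + 1)); first exact: divr_gt0.
exists k => //.
have kL := KL2 _ Kk.
have pL := L2_prim_lt mu (L2_cprimW nu kL).
have hpL := L2_prim_lt mu hL.
rewrite /prim2 -ctrB//; apply: le_lt_trans (nrm_ctr (L2B pL AL)) _.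
apply: le_lt_trans (nrm_triangle pL AL hpL) _.
rewrite [e]splitr; apply: ltrD.
  have dL := L2B (L2_cprimW nu kL) hL.
  rewrite ctrh in kh.
  rewrite -(prim_ltB (L2_cprimW nu kL) hL).
  have := @nrm_le_sup _ TR R mu _ _ (measurable_prim_lt dL) (fun x => prim_lt_bound x dL).
  move=> /le_lt_trans; apply.
  rewrite mulrAC -/C.
  have := nrm_ge0 nu (fun x => cprimW k x - h x); move: kh.
  rewrite ltr_pdivlMr//.
  set n := nrm _ _ => kh n0; apply: le_lt_trans kh.
  by rewrite mulrC ler_wpM2l// lerDl.
have m1 : measurable (`]b, (b + d)]%classic : set TR) by exact: measurable_itv.
have m2 : measurable (`](1 - d), 1]%classic : set TR) by exact: measurable_itv.
have I1 := indic_L2 mu m1; have I2 := indic_L2 mu m2.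
apply: (@le_lt_trans _ _ (nrm mu (fun x => \1_(`]b, (b + d)]) x + \1_(`](1 - d), 1]) x))).
  apply: le_nrm_ae; [exact: L2B|exact: L2D|].
  apply: filterS (ae_measW W) => y /andP[y0 y1].
  rewrite (prim_lt_lin _ L2' L1).
  rewrite iA !indicE !mem_setE !in_itv/= (ltW y1)/= andbT.
  rewrite [leRHS]ger0_norm ?addr_ge0//.
  have [yb|by_] := leP (y : R) b.
    have y2 : (y : R) <= 1 - d by rewrite (le_trans yb)// ltW// (lt_trans b_bd).
    by rewrite (z1 _ yb) (z2 _ y2) mulr0 addr0 subr0 normr0 addr_ge0.
  have [yd|dy] := leP (y : R) (b + d).
    have y2 : (y : R) <= 1 - d by rewrite (le_trans yd)// ltW.
    rewrite (z2 _ y2) mulr0 add0r distrC.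
    by apply: (le_trans (norm_1B (r1 _))); rewrite lerDl ler0n.
  rewrite (o1 _ (ltW dy)) mulN1r (addrC (- _)).
  have [ya|ya] := ltP (1 - d) (y : R); last first.
    by rewrite (z2 _ ya) oppr0 addr0 subrr normr0.
  by rewrite addrAC subrr add0r normrN; have /andP[p0 p1] := r2 y;
    rewrite ger0_norm// (le_trans p1)// lerDr ler0n.
apply: le_lt_trans (nrmD I1 I2) _.
rewrite (nrm_indicW b0 (ltW b_bd) bd_1) (nrm_indicW d10 (ltW d11) (lexx 1)).
by rewrite [e / 2]splitr ltrD.
Qed.

End dense_ranges.

(** * Backward orbits *)

Section backward_orbits.
Context d (X : measurableType d) (R : realType).
Variable m : {finite_measure set X -> \bar R}.
Variables (K : set (X -> R)) (T : (X -> R) -> X -> R) (C : R).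
Hypotheses (C1 : 1 <= C)
  (KL2 : forall k, K k -> L2 m k)
  (TB : forall f g, L2 m f -> L2 m g -> T (fun x => f x - g x) = (fun x => T f x - T g x))
  (Tb : forall f, L2 m f -> bounded_mfun (T f))
  (Tsup : forall f x, L2 m f -> `|T f x| <= C * nrm m f)
  (Tnrm : forall f, L2 m f -> nrm m (T f) <= C * nrm m f)
  (Tdense : forall k e, K k -> 0 < e ->
    exists k', K k' /\ nrm m (fun x => T k' x - k x) < e).

Lemma cvg_half (a : R) : a / 2 ^+ j @[j --> \oo] --> (0 : R).
Proof.
have h : `|2^-1 : R| < 1 by rewrite ger0_norm// invf_lt1// ltr1n.
rewrite (_ : (fun j => a / 2 ^+ j) = geometric a 2^-1); first exact: cvg_geometric.
by apply/funext => j /=; rewrite exprVn.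
Qed.

(** The tail of the geometric bound is c / 2^n. As it depends on v only through c, applying the
    lemma at every point with one c gives uniform convergence. *)
Lemma geometric_cvg (v : nat -> R) (c : R) :
  (forall n, `|v n.+1 - v n| <= c / 2 ^+ n.+1) ->
  exists2 l : R, v n @[n --> \oo] --> l & forall n, `|v n - l| <= c / 2 ^+ n.
Proof.
move=> vc.
have vd n p : `|v (n + p)%N - v n| <= c / 2 ^+ n - c / 2 ^+ (n + p).
  elim: p => [|p IHp]; first by rewrite addn0 !subrr normr0.
  have H := vc (n + p)%N; rewrite addnS.
  have -> : v (n + p).+1 - v n = (v (n + p).+1 - v (n + p)%N) + (v (n + p)%N - v n) by ring.
  apply: (le_trans (ler_normD _ _)); apply: (le_trans (lerD H IHp)).
  have -> : c / 2 ^+ (n + p) = c / 2 ^+ (n + p).+1 + c / 2 ^+ (n + p).+1.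
    by rewrite exprS; field; rewrite expf_neq0.
  by rewrite le_eqVlt; apply/orP; left; apply/eqP; ring.
have c0 : 0 <= c.
  by have := le_trans (normr_ge0 _) (vc 0%N); rewrite expr1 pmulr_lge0.
have cv : cvgn v.
  apply: (@summable_diff_cvgn _ _ c) => n.
  suff H : \sum_(0 <= k < n) `|v k.+1 - v k| <= c - c / 2 ^+ n.
    by apply: (le_trans H); rewrite lerBlDr lerDl divr_ge0// exprn_ge0.
  elim: n => [|n IH]; first by rewrite big_nil expr0 divr1 subrr.
  rewrite big_nat_recr//=; apply: (le_trans (lerD IH (vc n))).
  rewrite le_eqVlt; apply/orP; left; apply/eqP.
  by rewrite exprS; field; rewrite expf_neq0.
exists (limn v) => // n.
have H : `|v n - v k| @[k --> \oo] --> `|v n - limn v|.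
  by apply: cvg_norm; apply: cvgB => //; exact: cvg_cst.
rewrite -(cvg_lim _ H)//; apply: limr_le; first by apply: cvgP H.
exists n => // k /= nk; rewrite distrC -(subnKC nk); apply: (le_trans (vd _ _)).
by rewrite lerBlDr lerDl divr_ge0// exprn_ge0.
Qed.

Lemma iterB j f g : L2 m f -> L2 m g ->
  [/\ L2 m (iter j T f), L2 m (iter j T g) &
  iter j T (fun x => f x - g x) = (fun x => iter j T f x - iter j T g x)].
Proof.
move=> fL gL; elim: j => [//|j [IHf IHg IH]]; split.
- by apply: bounded_L2; exact: Tb.
- by apply: bounded_L2; exact: Tb.
- by rewrite !iterS IH TB.
Qed.

Lemma nrm_iter j f : L2 m f -> nrm m (iter j T f) <= C ^+ j * nrm m f.
Proof.
move=> fL; elim: j => [|j IH]; first by rewrite expr0 mul1r.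
have [jL _ _] := iterB j fL fL; rewrite iterS.
apply: le_trans (Tnrm jL) _; rewrite exprS -mulrA ler_wpM2l//.
exact: le_trans C1.
Qed.

(* Mittag-Leffler: e_0, e_1, ... are chosen with e_n - T e_(n+1) so small that,
   for each n, T^(j+1) e_(n+j+1) converges uniformly in j to the n-th term of
   the orbit. *)
Lemma backward_orbit_dense e0 (eps : R) : K e0 -> 0 < eps ->
  exists g : nat -> X -> R, [/\ forall n, bounded_mfun (g n),
    forall n, g n = T (g n.+1) & nrm m (fun x => g 0%N x - e0 x) <= eps].
Proof.
move=> Ke0 eps0.
have C0 : 0 < C by exact: lt_le_trans C1.
pose M := 1 + Num.sqrt (fine (m setT)).
have M1 : 1 <= M by rewrite lerDl sqrtr_ge0.
have M0 : 0 < M by exact: lt_le_trans M1.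
(* The final error is at most c times the square root of the mass, for the passage to the limit,
   plus c for the first approximation. This is c M = eps / C, at most eps. *)
pose c := eps / M / C.
have c0 : 0 < c by rewrite !divr_gt0.
(* An error made at stage n + j + 1 is amplified by at most C^(j+1) before it reaches the n-th term;
   the power of 2 C absorbs this and leaves at most c / 2^(j+1), uniformly in n. *)
pose delta n := c / (2 * C) ^+ n.+1.
have d0 n : 0 < delta n by rewrite divr_gt0// exprn_gt0// mulr_gt0.
(* The choice function is total; its value outside K is irrelevant because the recursion below never
   leaves K. *)
have /choice[s sP] (p : nat * (X -> R)) : exists k', K p.2 ->
    K k' /\ nrm m (fun x => T k' x - p.2 x) < delta p.1.
  have [Kp|nKp] := pselect (K p.2); last by exists p.2.
  by have [k' ?] := Tdense Kp (d0 p.1); exists k'.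
pose E := fix E n := if n is n'.+1 then s (n', E n') else e0.
have KE n : K (E n).
  by elim: n => [//|n IH]; exact: (sP (n, E n) IH).1.
have EE n : nrm m (fun x => T (E n.+1) x - E n x) < delta n.
  exact: (sP (n, E n) (KE n)).2.
have EL n : L2 m (E n) by exact: KL2.
have TEL n : L2 m (T (E n)) by apply: bounded_L2; exact: Tb.
have dL n := L2B (TEL n.+1) (EL n).
pose u n j := iter j.+1 T (E (n + j.+1)%N).
have uL n j : L2 m (u n j) by have [] := iterB j.+1 (EL (n + j.+1)%N) (EL (n + j.+1)%N).
have uS n j x : u n j.+1 x - u n j x =
    iter j.+1 T (fun x => T (E (n + j.+1).+1) x - E (n + j.+1)%N x) x.
  have [_ _ ->] := iterB j.+1 (TEL (n + j.+1).+1) (EL (n + j.+1)%N).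
  by rewrite /u iterSr addnS.
have ud n x j : `|u n j.+1 x - u n j x| <= c / 2 ^+ j.+1.
  rewrite uS iterS.
  have [jL _ _] := iterB j (dL (n + j.+1)%N) (dL (n + j.+1)%N).
  apply: le_trans (Tsup _ jL) _.
  apply: le_trans (ler_wpM2l (ltW C0) (nrm_iter j (dL (n + j.+1)%N))) _.
  rewrite mulrA -exprS.
  apply: le_trans (ler_wpM2l _ (ltW (EE (n + j.+1)%N))) _; first by rewrite exprn_ge0// ltW.
  have C2 : 0 < 2 * C by rewrite mulr_gt0.
  rewrite /delta ler_pdivlMr ?exprn_gt0//.
  set q := (2 * C) ^+ (n + j.+1).+1.
  have -> : C ^+ j.+1 * (c / q) * 2 ^+ j.+1 = c * (2 * C) ^+ j.+1 / q.
    by rewrite exprMn; move: (q^-1) => r; ring.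
  rewrite ler_pdivrMr ?exprn_gt0// ler_pM2l//.
  apply: ler_weXn2l; last by rewrite ltnS (leq_trans (leqnSn j))// leq_addl.
  by apply: (le_trans C1); rewrite ler_peMl ?ler1n// ltW.
have /choice[g gP] (n : nat) : exists gn : X -> R, forall x,
    u n j x @[j --> \oo] --> gn x /\ forall j, `|u n j x - gn x| <= c / 2 ^+ j.
  have /choice[gn H] (x : X) : exists l : R, u n j x @[j --> \oo] --> l /\
      forall j, `|u n j x - l| <= c / 2 ^+ j.
    by have [l] := geometric_cvg (ud n x); exists l.
  by exists gn.
have mg n : measurable_fun setT (g n).
  apply: (@measurable_fun_cvg _ _ _ _ (u n)) => [j|x _]; last exact: (gP n x).1.
  exact: L2_measurable (uL n j).
have bg n : bounded_mfun (g n).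
  split => //; have [_ [N NP]] := Tb (EL (n + 1)%N).
  exists (c + N) => x; have := (gP n x).2 0%N; rewrite expr0 divr1 distrC => H.
  have -> : g n x = (g n x - u n 0%N x) + u n 0%N x by rewrite subrK.
  by apply: le_trans (ler_normD _ _) _; rewrite lerD// NP.
have gL n := bounded_L2 m (bg n).
have gu n j : nrm m (fun x => u n j x - g n x) <= c / 2 ^+ j * Num.sqrt (fine (m setT)).
  apply: nrm_le_sup; last by move=> x; exact: (gP n x).2.
  by apply: measurable_funB => //; exact: L2_measurable.
exists g; split => // [n|].
  apply/funext => x.
  (* The same sequence has the limits [g n] and [T (g n.+1)]: it equals T applied to [u n.+1 j], and
     T is continuous from L^2 to the uniform norm. *)
  have cu : u n j.+1 x @[j --> \oo] --> g n x by have := (gP n x).1; rewrite -cvg_shiftS.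
  have cu' : u n j.+1 x @[j --> \oo] --> T (g n.+1) x.
    apply/cvgrPdist_le => e e0'.
    have /cvgrPdist_le/(_ e e0')[N _ NP] := cvg_half (C * (c * Num.sqrt (fine (m setT)))).
    exists N => // j Nj; have := NP j Nj; rewrite /= sub0r normrN => H.
    have -> : u n j.+1 = T (u n.+1 j) by rewrite /u iterS addSnnS.
    have := congr1 (fun h => h x) (TB (uL n.+1 j) (gL n.+1)) => /= Ex.
    rewrite distrC -Ex; apply: le_trans (Tsup _ (L2B (uL n.+1 j) (gL n.+1))) _.
    apply: le_trans _ (le_trans (ler_norm _) H).
    by rewrite -mulrA ler_wpM2l ?(ltW C0)// mulrAC.
  by rewrite -(cvg_lim _ cu)// -(cvg_lim _ cu').
have u0E : u 0%N 0%N = T (E 1%N) by [].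
apply: le_trans (nrm_triangle (gL 0%N) (KL2 Ke0) (uL 0%N 0%N)) _.
have H1 := gu 0%N 0%N; rewrite expr0 divr1 nrmC in H1.
have H2 := ltW (EE 0%N).
apply: le_trans (lerD H1 H2) _.
have dc : delta 0%N <= c.
  have C2 : 1 <= 2 * C by apply: (le_trans C1); rewrite ler_peMl ?ler1n// ltW.
  by rewrite /delta expr1 ler_pdivrMr ?mulr_gt0// ler_peMr ?(ltW c0).
apply: le_trans (lerD (lexx _) dc) _.
rewrite -[X in _ + X]mulr1 -mulrDr addrC -/M /c mulrAC divfK ?gt_eqF//.
by rewrite ler_pdivrMr// ler_peMr// ltW.
Qed.

End backward_orbits.

(** * Test functions and the strong domain *)

Section torus_lifts.
Context (R : realType).
Variables (W : cadlag_driver R) (V : caglad_driver R).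
Local Notation TR := (measurableTypeR R).
Local Notation mu := (measW W).
Local Notation nu := (measV V).
Local Notation centered_bounded := (centered_bounded W).
Local Notation cprimW := (cprimW W V).
Local Notation prim2 := (prim2 W V).
Implicit Types (f g h k : R -> R).

Lemma centered_L2 k : centered_bounded k -> L2 mu k.
Proof. by move=> [bk _]; exact: bounded_L2. Qed.

Lemma cprimW_bound f : L2 mu f -> nrm nu (cprimW f) <=
  Num.sqrt (fine (nu setT)) * Num.sqrt (fine (mu setT)) * nrm mu f.
Proof.
move=> fL; apply: le_trans (nrm_ctr (L2_prim_le nu fL)) _.
have := @nrm_le_sup _ TR R nu _ _ (measurable_prim_le fL) (fun x => prim_le_bound x fL).
by rewrite mulrC mulrA.
Qed.

Lemma ctr_bound (m : {finite_measure set TR -> \bar R}) f (M : R) (x : R) :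
  fine (m setT) != 0 -> L2 m f -> (forall x, `|f x| <= M) -> `|ctr m f x| <= M + M.
Proof.
move=> m0 fL fM; apply: le_trans (ler_normB _ _) _; apply: lerD => //.
rewrite /mean normrM normfV (ger0_norm (fine_mT_ge0 m)).
have mp : 0 < fine (m setT) by rewrite lt_neqAle eq_sym m0 fine_mT_ge0.
rewrite ler_pdivrMr//.
apply: (le_trans (le_normr_Rintegral measurableT (L2_integrable fL))).
rewrite -(@Rintegral_cst _ _ _ m setT measurableT).
apply: le_Rintegral => //; first exact/L2_integrable/L2_norm.
exact/L2_integrable/L2_cst.
Qed.

Lemma centered_orbit_dense e0 (eps : R) : centered_bounded e0 -> 0 < eps ->
  exists g : nat -> R -> R, [/\ forall n, centered_bounded (g n),
    forall n, g n = prim2 (g n.+1) & nrm mu (fun x => g 0%N x - e0 x) <= eps].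
Proof.
move=> Ke0 eps0.
pose a := Num.sqrt (fine (nu setT)); pose b := Num.sqrt (fine (mu setT)).
have a0 : 0 <= a by exact: sqrtr_ge0.
have b0 : 0 <= b by exact: sqrtr_ge0.
pose D := a * (a * b).
have D0 : 0 <= D by rewrite !mulr_ge0.
(* D bounds the uncentered operator from L^2(dW) to the uniform norm. The three summands serve 1 <=
   C, the uniform bound, which centering at most doubles, and the L^2 bound, obtained from the
   uniform one with the factor b. *)
pose C := 1 + (D + D) + D * b.
have PB f (x : R) : L2 mu f -> `|prim_lt nu (cprimW f) x| <= D * nrm mu f.
  move=> fL; apply: le_trans (prim_lt_bound x (L2_cprimW V nu fL)) _.
  by rewrite /D -(mulrA a) ler_wpM2l// cprimW_bound.
have [|||||||g [bg gT gE]] := @backward_orbit_dense _ TR R mu centered_bounded prim2 C _ _ _ _ _ _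
   _ e0 eps Ke0 eps0.
- by rewrite /C -addrA lerDl addr_ge0 ?mulr_ge0 ?addr_ge0.
- exact: centered_L2.
- move=> f g fL gL.
  have := prim2_lin V (-1) gL fL.
  rewrite (_ : (fun x => -1 * g x + f x) = (fun x => f x - g x)); last first.
    by apply/funext => x; rewrite mulN1r addrC.
  by move=> ->; apply/funext => x; rewrite mulN1r addrC.
- by move=> f; exact: bounded_prim2.
- move=> f x fL.
  have := @ctr_bound mu (prim_lt nu (cprimW f)) _ x (massW_neq0 W)
    (L2_prim_lt mu (L2_cprimW V nu fL)) (fun x => PB f x fL).
  move=> /le_trans; apply; rewrite -mulrDl ler_wpM2r ?nrm_ge0// /C.
  by rewrite -addrA addrCA lerDl addr_ge0 ?mulr_ge0.
- move=> f fL; apply: le_trans (nrm_ctr (L2_prim_lt mu (L2_cprimW V nu fL))) _.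
  apply: le_trans (@nrm_le_sup _ TR R mu _ _
    (measurable_prim_lt (L2_cprimW V nu fL)) (fun x => PB f x fL)) _.
  rewrite mulrAC ler_wpM2r ?nrm_ge0// /C lerDr addr_ge0 ?addr_ge0//.
- move=> k e Kk e1; have [k' Kk' H] := prim2_dense V (centered_L2 Kk) e1.
  exists k'; split => //; move: H; congr (nrm _ _ < _); apply/funext => x.
  by rewrite /ctr /mean Kk.2 mul0r subr0.
exists g; split => // n; rewrite gT; apply: centered_prim2; exact: bounded_L2.
Qed.

Lemma prim_le_eq f g y : L2 mu f -> L2 mu g -> (forall x, 0 < x < 1 -> f x = g x) ->
  prim_le mu f y = prim_le mu g y.
Proof.
move=> fL gL fg; apply: eq_intW => [||x x01]; last by rewrite fg.
- exact: L2_measurable (L2_mul_indic (measurable_ray_le y) fL).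
- exact: L2_measurable (L2_mul_indic (measurable_ray_le y) gL).
Qed.

Lemma prim_lt_eq f g y : L2 nu f -> L2 nu g -> (forall x, 0 < x < 1 -> f x = g x) ->
  prim_lt nu f y = prim_lt nu g y.
Proof.
move=> fL gL fg; apply: eq_intV => [||x x01]; last by rewrite fg.
- exact: L2_measurable (L2_mul_indic (measurable_ray_lt y) fL).
- exact: L2_measurable (L2_mul_indic (measurable_ray_lt y) gL).
Qed.

Section lift_W.
Variables (k : R -> R) (c : R).
Hypothesis Kk : centered_bounded k.
Let f := per (fun x => prim_le mu k x + c).
Let kL : L2 mu k := centered_L2 Kk.

(** The primitive of a centered function takes equal values at 0 and 1, so periodizing does not
    change it even at 1. *)
Lemma lift_W_eq x : 0 <= x -> x <= 1 -> f x = prim_le mu k x + c.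
Proof. by apply: perE1; rewrite prim_le0// prim_le1// Kk.2. Qed.

Lemma lift_W_prim : is_primW W f k.
Proof.
move=> z y z0 zy y1; rewrite !lift_W_eq ?(le_trans z0)// ?(le_trans zy)//.
by ring.
Qed.

Lemma lift_W_cadlag : cadlag f.
Proof. exact: (cadlag_primW (per_periodic _) Kk.1 lift_W_prim). Qed.

Lemma lift_W_bounded : bounded_mfun (f : TR -> R).
Proof.
by apply: periodic_bounded_mfun; [exact: per_periodic|exact/cadlag_regulated/lift_W_cadlag].
Qed.
End lift_W.

Section lift_V.
Variables (h0 h : R -> R) (c : R).
Hypotheses (bh0 : bounded_mfun (h0 : TR -> R)) (bh : bounded_mfun (h : TR -> R))
  (h01 : forall x, 0 < x < 1 -> h0 x = h x)
  (ph : periodic h 1) (hc : cadlag h) (h0_0 : \int[nu]_x h0 x = 0).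
Let f := per (fun x => prim_lt nu h0 x + c).
Let h0L : L2 nu h0 := bounded_L2 nu bh0.
Let hL : L2 nu h := bounded_L2 nu bh.

Lemma lift_V_eq x : 0 <= x -> x <= 1 -> f x = prim_lt nu h0 x + c.
Proof. by apply: perE1; rewrite prim_lt0// prim_lt1// h0_0. Qed.

(** The integrand [h0] and its periodic version [h] agree dV-almost everywhere and have the same
    primitives; [h] is the one that is right continuous at every point and can serve as a
    derivative. *)
Lemma lift_V_prim : is_primV V f h.
Proof.
move=> z y z0 zy y1; rewrite !lift_V_eq ?(le_trans z0)// ?(le_trans zy)//.
by rewrite !(prim_lt_eq _ h0L hL h01); ring.
Qed.

Lemma lift_V_caglad : caglad f.
Proof. exact: (caglad_primV (per_periodic _) bh lift_V_prim). Qed.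

Lemma lift_V_rderive x : diff_quotient V f x y @[y --> 0^'+] --> h x.
Proof.
apply: (rderive_primV (per_periodic _) ph bh lift_V_prim) => {}x.
by have [] := hc x.
Qed.
End lift_V.

End torus_lifts.

(** * Derivatives of the periodized primitives *)

Section test_and_strong.
Context (R : realType).
Variables (W : cadlag_driver R) (V : caglad_driver R).
Local Notation TR := (measurableTypeR R).
Local Notation mu := (measW W).
Local Notation nu := (measV V).
Local Notation centered_bounded := (centered_bounded W).
Local Notation cprimW := (cprimW W V).
Local Notation prim2 := (prim2 W V).
Implicit Types (f g h k : R -> R).

Lemma is_primW_eq f k k' : bounded_mfun (k : TR -> R) -> bounded_mfun (k' : TR -> R) ->
  (forall x, 0 < x < 1 -> k x = k' x) -> is_primW W f k -> is_primW W f k'.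
Proof.
move=> bk bk' kk' fk z y z0 zy y1.
by rewrite fk// !(prim_le_eq _ (bounded_L2 mu bk) (bounded_L2 mu bk') kk').
Qed.

Lemma per_eq01 f x : 0 < x < 1 -> per f x = f x.
Proof. by move=> /andP[x0 x1]; rewrite perE// ltW. Qed.

Lemma per_cprimW_cadlag k : centered_bounded k -> cadlag (per (cprimW k)).
Proof. by move=> Kk; exact: (lift_W_cadlag (- mean nu (prim_le mu k)) Kk). Qed.

Lemma per_cprimW_bounded k : centered_bounded k -> bounded_mfun (per (cprimW k) : TR -> R).
Proof. by move=> Kk; exact: (lift_W_bounded (- mean nu (prim_le mu k)) Kk). Qed.

Lemma bounded_cprimW k : centered_bounded k -> bounded_mfun (cprimW k : TR -> R).
Proof. by move=> Kk; apply/bounded_ctr/bounded_prim_le/centered_L2. Qed.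

Lemma int_cprimW k : centered_bounded k -> \int[nu]_x cprimW k x = 0.
Proof.
by move=> Kk; apply: int_ctr; [exact: massV_neq0|exact/L2_prim_le/centered_L2].
Qed.

Lemma int_per_cprimW k : centered_bounded k -> \int[nu]_x per (cprimW k) x = 0.
Proof.
move=> Kk; rewrite -(int_cprimW Kk); apply: eq_intV.
- exact: (per_cprimW_bounded Kk).1.
- exact: (bounded_cprimW Kk).1.
- exact: per_eq01.
Qed.

Lemma per_prim2_caglad k : centered_bounded k -> caglad (per (prim2 k)).
Proof.
move=> Kk; apply: (lift_V_caglad (- mean mu (prim_lt nu (cprimW k)))
  (bounded_cprimW Kk) (per_cprimW_bounded Kk)).
- by move=> x x01; rewrite per_eq01.
- exact: int_cprimW.
Qed.

Lemma per_prim2_bounded k : centered_bounded k -> bounded_mfun (per (prim2 k) : TR -> R).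
Proof.
move=> Kk; apply: periodic_bounded_mfun; first exact: per_periodic.
exact/caglad_regulated/per_prim2_caglad.
Qed.

Lemma int_per_prim2 k : centered_bounded k -> \int[mu]_x per (prim2 k) x = 0.
Proof.
move=> Kk; have KT := centered_prim2 V (centered_L2 Kk).
rewrite -KT.2; apply: eq_intW.
- exact: (per_prim2_bounded Kk).1.
- exact: KT.1.1.
- exact: per_eq01.
Qed.

Lemma per_prim2_rderive k x : centered_bounded k ->
  diff_quotient V (per (prim2 k)) x h @[h --> 0^'+] --> per (cprimW k) x.
Proof.
move=> Kk; apply: (lift_V_rderive (- mean mu (prim_lt nu (cprimW k)))
  (bounded_cprimW Kk) (per_cprimW_bounded Kk)).
- by move=> y y01; rewrite per_eq01.
- exact: per_periodic.
- exact: per_cprimW_cadlag.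
- exact: int_cprimW.
Qed.

Lemma rderive_per_prim2 k : centered_bounded k -> rderive V (per (prim2 k)) = per (cprimW k).
Proof. by move=> Kk; apply/funext => x; apply/cvg_lim => //; exact: per_prim2_rderive. Qed.

Lemma rderivable_per_prim2 k : centered_bounded k -> rderivable V (per (prim2 k)).
Proof. by move=> Kk x; apply/cvg_ex; exists (per (cprimW k) x); exact: per_prim2_rderive. Qed.

(** The constant is left free for two uses: minus the dV-mean, which gives the periodization of
    [cprimW], and the constant part of a function known only through its weak derivative. *)
Definition torus_prim k (c : R) := per (fun x => prim_le mu k x + c).

Lemma torus_prim_lderive_cvg k (c x : R) : centered_bounded k ->
  diff_quotient W (torus_prim (prim2 k) c) x h @[h --> 0^'-] --> per (prim2 k) x.
Proof.
move=> Kk; have KT := centered_prim2 V (centered_L2 Kk).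
apply: lderive_primW.
- exact: per_periodic.
- exact: per_periodic.
- exact: per_prim2_bounded.
- apply: (is_primW_eq KT.1 (per_prim2_bounded Kk)); last exact: lift_W_prim.
  by move=> y y01; rewrite per_eq01.
- by move=> y; have [] := per_prim2_caglad Kk y.
Qed.

Lemma lderive_torus_prim k c : centered_bounded k ->
  lderive W (torus_prim (prim2 k) c) = per (prim2 k).
Proof. by move=> Kk; apply/funext => x; apply/cvg_lim => //; exact: torus_prim_lderive_cvg. Qed.

Lemma lderivable_torus_prim k c : centered_bounded k -> lderivable W (torus_prim (prim2 k) c).
Proof. by move=> Kk x; apply/cvg_ex; exists (per (prim2 k) x); exact: torus_prim_lderive_cvg. Qed.

Lemma strong_torus_prim k c : centered_bounded k -> strong_domain W V (torus_prim (prim2 k) c).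
Proof.
move=> Kk; have KT := centered_prim2 V (centered_L2 Kk); split.
- exact: per_periodic.
- exact: lift_W_cadlag.
- by rewrite lderive_torus_prim//; split; [exact: lderivable_torus_prim|exact: per_prim2_caglad].
- rewrite lderive_torus_prim// rderive_per_prim2//; split; first exact: rderivable_per_prim2.
  exact: per_cprimW_cadlag.
Qed.

(** Differentiating walks forward along the orbit: as g_n = T g_(n+1), D_V^+ sends g_n to the
    centered W-primitive of g_(n+1), and D_W^- sends that to g_(n+1). Every derivative is thus of
    one of two known kinds. *)
Lemma orbit_test (g : nat -> R -> R) : (forall n, centered_bounded (g n)) ->
  (forall n, g n = prim2 (g n.+1)) -> test_functions0 W V (per (g 0%N)).
Proof.
move=> Kg gT; split; first exact: per_periodic.
(* The W-primitive of g_n must be seen as a primitive of T g_(n+1), since only integrands in the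
   range of T are known to have a left continuous periodization. *)
have LVlift n : cprimW (g n) = (fun x => prim_le mu (prim2 (g n.+1)) x + - mean nu (prim_le mu (g n))).
  by rewrite -gT.
have ED n : iter_derive W V n.*2 (per (g 0%N)) = per (g n) /\
    iter_derive W V n.*2.+1 (per (g 0%N)) = per (cprimW (g n.+1)).
  have step n' : iter_derive W V n'.*2 (per (g 0%N)) = per (g n') ->
      iter_derive W V n'.*2.+1 (per (g 0%N)) = per (cprimW (g n'.+1)).
    by move=> /= ->; rewrite odd_double gT rderive_per_prim2.
  elim: n => [|n [_ IH]]; first by split; [by []|exact: step].
  suff : iter_derive W V n.+1.*2 (per (g 0%N)) = per (g n.+1).
    by move=> H; split; [exact: H|exact: step].
  rewrite doubleS -/(iter _ _ _) [LHS]/=.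
  move: IH => /= ->; rewrite odd_double/=.
  by rewrite LVlift lderive_torus_prim// -gT.
move=> n; have [E0 E1] := ED n./2; have := odd_double_half n.
case: (odd n); rewrite ?add1n ?add0n => nE.
  have En : iter_derive W V n (per (g 0%N)) = per (cprimW (g n./2.+1)).
    by rewrite -[X in iter_derive _ _ X _]nE.
  rewrite En; split; [exact: per_cprimW_cadlag|exact: int_per_cprimW|].
  by rewrite LVlift; exact: lderivable_torus_prim.
have En : iter_derive W V n (per (g 0%N)) = per (prim2 (g n./2.+1)).
  by rewrite -gT -[X in iter_derive _ _ X _]nE.
rewrite En; split; [exact: per_prim2_caglad|exact: int_per_prim2|exact: rderivable_per_prim2].
Qed.

(** * Integration by parts and the energy *)

Lemma nrm_eqW (f g : TR -> R) : L2 mu f -> L2 mu g ->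
  (forall x : R, 0 < x < 1 -> f x = g x) -> nrm mu f = nrm mu g.
Proof.
move=> fL gL fg; apply/eqP; rewrite eq_le; apply/andP; split.
  by apply: le_nrm_ae => //; apply: filterS (ae_measW W) => x x01; rewrite fg.
by apply: le_nrm_ae => //; apply: filterS (ae_measW W) => x x01; rewrite fg.
Qed.

Lemma ip_eqV (u f g : TR -> R) : L2 nu u -> L2 nu f -> L2 nu g ->
  (forall x : R, 0 < x < 1 -> f x = g x) -> ip nu u f = ip nu u g.
Proof.
move=> uL fL gL fg; apply: eq_intV => [||x x01]; last by rewrite fg.
- by apply: measurable_funM; [exact: L2_measurable uL|exact: L2_measurable fL].
- by apply: measurable_funM; [exact: L2_measurable uL|exact: L2_measurable gL].
Qed.

(** f differs from the V-primitive of h by a constant on (0, 1), and F, having mean zero, is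
    orthogonal to constants; the rest is the adjointness of the primitives. *)
Lemma int_parts (F : TR -> R) f h : L2 mu F -> L2 nu (h : TR -> R) -> L2 mu (f : TR -> R) ->
  is_primV V f h -> \int[mu]_x F x = 0 -> \int[nu]_x h x = 0 ->
  ip nu (prim_le mu F) h = - ip mu F f.
Proof.
move=> FL hL fL fh F0 h0.
rewrite (prim_Fubini FL hL) F0 h0 mul0r sub0r; congr (- _).
have pL := L2_prim_lt mu hL.
pose c := f 0 - prim_lt nu h 0.
have -> : ip mu F (prim_lt nu h) = ip mu F (fun x => prim_lt nu h x + c).
  rewrite (ipDr pL (L2_cst mu c) FL).
  have -> : ip mu F (fun=> c) = 0.
    by rewrite /ip (RintegralZr c measurableT (L2_integrable FL)) F0 mul0r.
  by rewrite addr0.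
have pcL := L2D pL (L2_cst mu c).
apply: eq_intW => [||x /andP[x0 x1]].
- by apply: measurable_funM; [exact: L2_measurable FL|exact: L2_measurable pcL].
- by apply: measurable_funM; [exact: L2_measurable FL|exact: L2_measurable fL].
- by rewrite (prim_lt_sub_const fh (ltW x0) (ltW x1)).
Qed.

Lemma ip_primW f k h : L2 mu (k : TR -> R) -> L2 nu (f : TR -> R) -> L2 nu (h : TR -> R) ->
  is_primW W f k -> \int[nu]_x h x = 0 -> ip nu f h = ip nu (prim_le mu k) h.
Proof.
move=> kL fL hL fk h0.
have pL := L2_prim_le nu kL.
pose c := f 0 - prim_le mu k 0.
have -> : ip nu (prim_le mu k) h = ip nu (fun x => prim_le mu k x + c) h.
  rewrite (ipDl pL (L2_cst nu c) hL).
  have -> : ip nu (fun=> c) h = 0.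
    by rewrite /ip (RintegralZl c measurableT (L2_integrable hL)) h0 mulr0.
  by rewrite addr0.
have pcL := L2D pL (L2_cst nu c).
apply: eq_intV => [||x /andP[x0 x1]].
- by apply: measurable_funM; [exact: L2_measurable fL|exact: L2_measurable hL].
- by apply: measurable_funM; [exact: L2_measurable pcL|exact: L2_measurable hL].
- by rewrite (prim_le_sub_const fk (ltW x0) (ltW x1)).
Qed.

(** In the integration by parts [lderive W f] occurs twice: as the density of f, and as the
    V-primitive of its own right derivative. *)
Lemma strong_energy f : strong_domain W V f ->
  [/\ L2 nu (f : TR -> R), L2 mu (lderive W f : TR -> R),
      \int[mu]_x lderive W f x = 0,
      is_primW W f (lderive W f) &
      energy W V f = nrm nu f ^+ 2 + nrm mu (lderive W f) ^+ 2].
Proof.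
move=> [pf fc [df dc] [ddf ddc]].
have [bF fF F0] := FTC_W pf fc df dc.
have [bh Fh h0] := FTC_V (lderive_periodic W pf) dc ddf ddc.
have bf : bounded_mfun (f : TR -> R).
  by apply: periodic_bounded_mfun => //; exact: cadlag_regulated.
have fL := bounded_L2 nu bf; have FL := bounded_L2 mu bF; have hL := bounded_L2 nu bh.
split; [exact: fL|exact: FL|exact: F0|exact: fF|].
have E : ip nu (rderive V (lderive W f)) f = - ip mu (lderive W f) (lderive W f).
  by rewrite ipC (ip_primW FL fL hL fF h0) (int_parts FL hL FL Fh F0 h0).
transitivity (ip nu f f + ip mu (lderive W f) (lderive W f)); last first.
  by congr (_ + _); apply/esym; exact: nrm_sqr.
have -> : energy W V f = ip nu (fun x => f x - rderive V (lderive W f) x) f by [].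
by rewrite (ipBl fL hL fL) E opprK.
Qed.

Lemma lderiveB f g : lderivable W f -> lderivable W g ->
  (forall x, diff_quotient W (f \- g) x h @[h --> 0^'-] --> lderive W f x - lderive W g x).
Proof.
move=> df dg x.
have -> : diff_quotient W (f \- g) x = (fun t : R => diff_quotient W f x t - diff_quotient W g x t).
  by apply/funext => t; rewrite /diff_quotient /= -mulrBl; congr (_ / _); ring.
by apply: cvgB; [exact: df|exact: dg].
Qed.

Lemma rderiveB f g : rderivable V f -> rderivable V g ->
  (forall x, diff_quotient V (f \- g) x h @[h --> 0^'+] --> rderive V f x - rderive V g x).
Proof.
move=> df dg x.
have -> : diff_quotient V (f \- g) x = (fun t : R => diff_quotient V f x t - diff_quotient V g x t).
  by apply/funext => t; rewrite /diff_quotient /= -mulrBl; congr (_ / _); ring.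
by apply: cvgB; [exact: df|exact: dg].
Qed.

Lemma cadlagB f g : cadlag f -> cadlag g -> cadlag (f \- g).
Proof.
move=> cf cg x; have [f1 f2] := cf x; have [g1 g2] := cg x.
by split; [exact: cvgB|exact: is_cvgB].
Qed.

Lemma cagladB f g : caglad f -> caglad g -> caglad (f \- g).
Proof.
move=> cf cg x; have [f1 f2] := cf x; have [g1 g2] := cg x.
by split; [exact: cvgB|exact: is_cvgB].
Qed.

(** Makes the energy identity available for the differences in the Cauchy condition. *)
Lemma strongB f g : strong_domain W V f -> strong_domain W V g ->
  strong_domain W V (f \- g) /\
  lderive W (f \- g) = (fun x => lderive W f x - lderive W g x).
Proof.
move=> [pf fc [df dc] [ddf ddc]] [pg gc [dg dgc] [ddg ddgc]].
have E : lderive W (f \- g) = (fun x => lderive W f x - lderive W g x).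
  by apply/funext => x; apply/cvg_lim => //; exact: lderiveB.
have E2 : rderive V (fun x => lderive W f x - lderive W g x) =
    (fun x => rderive V (lderive W f) x - rderive V (lderive W g) x).
  by apply/funext => x; apply/cvg_lim => //; exact: rderiveB.
split; last exact: E.
split.
- by move=> x /=; rewrite pf pg.
- exact: cadlagB.
- rewrite E; split; last exact: cagladB.
  by move=> x; apply/cvg_ex; eexists; exact: lderiveB.
- rewrite E; split; last by rewrite E2; exact: cadlagB.
  by move=> x; apply/cvg_ex; eexists; exact: rderiveB.
Qed.

End test_and_strong.

(** * Weak and energetic spaces *)

Section Lspace.
Context d (X : measurableType d) (R : realType).
Variable m : {finite_measure set X -> \bar R}.

Lemma Lspace_L2 (f : LspaceType2 m) : L2 m f.
Proof.
rewrite /L2 inE; apply/andP; split; rewrite inE/=; last exact: Lebesgue_finite.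
exact: (measurable_funPT (repr (LebesgueSpace.sort f) : {mfun X >-> measurableTypeR R})).
Qed.

Local Open Scope quotient_scope.
(** The representative chosen for the class of f agrees with f only almost everywhere, hence the
    conclusion as a distance zero. *)
Lemma L2_Lspace (f : X -> R) : L2 m f -> exists F : LspaceType2 m,
  nrm m (fun x => F x - f x) = 0.
Proof.
move=> fL.
have mf : measurable_fun setT (f : X -> measurableTypeR R) by exact: L2_measurable fL.
pose f1 : {mfun X >-> measurableTypeR R} :=
  @mfun_Sub _ _ X (measurableTypeR R) f (mem_set mf).
pose F0 : {mfun_ m, X >-> measurableTypeR R} := \pi_({mfun_ m, X >-> measurableTypeR R}) f1.
have F0f : {ae m, forall x, F0 x = f x}.
  have /eqmodP/asboolP := reprK F0.
  by apply: filterS => x /(_ I).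
have mF0 : measurable_fun setT (F0 : X -> R) by exact: (measurable_funPT (repr F0)).
have F0L : L2 m (F0 : X -> R).
  apply: sqr_integrable_L2 => //.
  have -> : (\int[m]_x (F0 x ^+ 2)%:E = \int[m]_x (f x * f x)%:E)%E.
    apply: ge0_ae_eq_integral.
    - exact: measurableT.
    - by apply/measurable_EFinP; exact: measurable_funX.
    - by apply/measurable_EFinP; apply: measurable_funM; exact: L2_measurable fL.
    - by move=> x _; rewrite lee_fin sqr_ge0.
    - by move=> x _; rewrite lee_fin -expr2 sqr_ge0.
    - by apply: filterS F0f => x -> _; rewrite expr2.
  by rewrite EFin_ip// ltry.
have fin : finite_norm m 2%:E (F0 : X -> R).
  by have := F0L; rewrite /L2 inE => /andP[_]; rewrite inE.
pose b := @isFinLebesgue.Build d X R m 2%:E (lee1n 2) F0 fin.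
pose F : LspaceType2 m := HB.pack F0 b.
exists F.
apply/eqP; rewrite eq_le nrm_ge0 andbT.
have -> : 0 = nrm m (fun=> 0) by rewrite nrm_cst normr0 mul0r.
apply: le_nrm_ae.
- exact: (L2B F0L fL).
- exact: L2_cst.
- by apply: filterS F0f => x /= ->; rewrite subrr.
Qed.

End Lspace.

(** * The two inclusions *)

Section main.
Context (R : realType).
Variables (W : cadlag_driver R) (V : caglad_driver R).
Local Notation TR := (measurableTypeR R).
Local Notation mu := (measW W).
Local Notation nu := (measV V).
Local Notation centered_bounded := (centered_bounded W).
Local Notation cprimW := (cprimW W V).
Local Notation prim2 := (prim2 W V).
Implicit Types (g h k : R -> R).

Lemma small_eq0 (x C : R) : (forall e : R, 0 < e -> `|x| <= C * e) -> x = 0.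
Proof.
move=> H; apply/eqP; rewrite -normr_le0 leNgt; apply/negP => x0.
have C0 : 0 < C.
  by have := H 1 ltr01; rewrite mulr1; exact: lt_le_trans.
have := H (`|x| / C / 2); rewrite !divr_gt0// => /(_ isT).
rewrite mulrA mulrCA divff ?gt_eqF// mulr1.
by rewrite leNgt ltr_pdivrMr// ltr_pMr// ltr1n.
Qed.

Lemma rderive_addcst (c : R) g : rderive V (cst c \+ g) = rderive V g.
Proof.
apply/funext => x; rewrite /rderive (_ : diff_quotient V (cst c \+ g) x = diff_quotient V g x)//.
by apply/funext => h; rewrite /diff_quotient /=; congr (_ / _); ring.
Qed.

Lemma Lnorm_cvg0 (u : nat -> TR -> R) : (forall n, L2 nu (u n)) ->
  'N[nu]_2%:E[EFin \o u n]%E @[n --> \oo] --> 0%E <->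
  forall e : R, 0 < e -> exists N, forall n, (N <= n)%N -> nrm nu (u n) < e.
Proof.
move=> uL.
have -> : (fun n => 'N[nu]_2%:E[EFin \o u n]%E) = (fun n => (nrm nu (u n))%:E).
  by apply/funext => n; exact: LnormE.
split=> [/fine_cvgP[_ /cvgrPdist_lt H] e e0|H].
  have [N _ NP] := H e e0; exists N => n Nn; have := NP n Nn.
  by rewrite /= sub0r normrN; apply: le_lt_trans; exact: ler_norm.
apply/cvg_EFin; first exact: nearW.
apply/cvgrPdist_lt => e e0; have [N NP] := H e e0.
exists N => // n Nn; rewrite /= sub0r normrN ger0_norm ?nrm_ge0//; exact: NP.
Qed.

Lemma energetic_weak f : energetic_space W V f -> weak_space W V f.
Proof.
move=> [f_ [fS fcv fC]].
have fL : L2 nu f by exact: Lspace_L2.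
pose F_ n := lderive W (f_ n).
have fnL n : L2 nu (f_ n : TR -> R) by have [] := strong_energy (fS n).
have FnL n : L2 mu (F_ n : TR -> R) by have [] := strong_energy (fS n).
have Fn0 n : \int[mu]_x F_ n x = 0 by have [] := strong_energy (fS n).
have fFn n : is_primW W (f_ n) (F_ n) by have [] := strong_energy (fS n).
(* By the energy identity the energy norm of a difference dominates the dW-norm of the difference of
   the derivatives. *)
have FC e : 0 < e -> exists N, forall i j, (N <= i)%N -> (N <= j)%N ->
    nrm mu (fun x => F_ i x - F_ j x) < e.
  move=> /fC[N NP]; exists N => i j Ni Nj; apply: le_lt_trans (NP i j Ni Nj).
  have [Sij Eij] := strongB (fS i) (fS j).
  have [_ _ _ _ E] := strong_energy Sij.
  rewrite /energy_norm E Eij -[leLHS](ger0_norm (nrm_ge0 _ _)) -sqrtr_sqr.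
  by apply: ler_wsqrtr; rewrite lerDr sqr_ge0.
have [F1 [F1L F1c]] := RieszFischer FnL FC.
have [F FF1] := L2_Lspace F1L.
have FL : L2 mu F by exact: Lspace_L2.
have Fc e : 0 < e -> exists N, forall n, (N <= n)%N -> nrm mu (fun x => F x - F_ n x) <= e.
  move=> /F1c[N NP]; exists N => n Nn.
  apply: le_trans (nrm_triangle FL (FnL n) F1L) _.
  by rewrite FF1 add0r nrmC; exact: NP.
have fc e : 0 < e -> exists N, forall n, (N <= n)%N -> nrm nu (fun x => f x - f_ n x) <= e.
  move/Lnorm_cvg0 : fcv => H /H[n|N NP]; first exact: (L2B (fnL n) fL).
  by exists N => n Nn; rewrite nrmC; apply/ltW; exact: NP.
have F0 : \int[mu]_x F x = 0.
  apply: (@small_eq0 _ (Num.sqrt (fine (mu setT)))) => e e0.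
  have [N /(_ N (leqnn N)) NP] := Fc e e0.
  have -> : \int[mu]_x F x = \int[mu]_x (F x - F_ N x).
    by rewrite (RintegralB measurableT (L2_integrable FL) (L2_integrable (FnL N))) Fn0 subr0.
  apply: le_trans (int_le_nrm (L2B FL (FnL N))) _.
  by rewrite ler_wpM2l// sqrtr_ge0.
exists F; split; first exact: F0.
move=> _ [c [g [[pg Hg] ->]]].
have [gc _ gd] := Hg 0%N; have [hc _ _] := Hg 1%N.
have [bh gh h0] := FTC_V pg gc gd hc.
set h := rderive V g in bh gh h0 hc.
rewrite rderive_addcst -/h.
have hL := bounded_L2 nu bh.
have bg : bounded_mfun (g : TR -> R).
  by apply: periodic_bounded_mfun => //; exact: caglad_regulated.
have gL := bounded_L2 mu bg.
(* The constant part of the test function contributes nothing because F has mean zero. *)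
have -> : \int[mu]_x (F x * (cst c \+ g) x) = ip mu F g.
  have -> : \int[mu]_x (F x * (cst c \+ g) x) = ip mu F (fun x => c + g x) by [].
  rewrite (ipDr (L2_cst mu c) gL FL).
  have -> : ip mu F (fun=> c) = 0.
    by rewrite /ip (RintegralZr c measurableT (L2_integrable FL)) F0 mul0r.
  by rewrite add0r.
have -> : \int[nu]_x (f x * h x) = ip nu f h by [].
have En n : ip nu (f_ n) h = - ip mu (F_ n) g.
  rewrite (ip_primW (FnL n) (fnL n) hL (fFn n) h0).
  exact: (int_parts (FnL n) hL gL gh (Fn0 n) h0).
apply/eqP; rewrite -addr_eq0; apply/eqP.
apply: (@small_eq0 _ (nrm nu h + nrm mu g)) => e e0.
have [N1 N1P] := Fc e e0; have [N2 N2P] := fc e e0.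
pose n := maxn N1 N2.
have H1 := N1P n (leq_maxl _ _); have H2 := N2P n (leq_maxr _ _).
(* Subtracting the exact identity for [f_ n] leaves two terms that Cauchy-Schwarz makes small. *)
have -> : ip nu f h + ip mu F g =
    ip nu (fun x => f x - f_ n x) h + ip mu (fun x => F x - F_ n x) g.
  rewrite (ipBl fL (fnL n) hL) (ipBl FL (FnL n) gL) En.
  move: (ip nu f h) (ip mu F g) (ip mu (F_ n) g) => a b d; ring.
apply: le_trans (ler_normD _ _) _; rewrite mulrDl; apply: lerD.
  apply: le_trans (CauchySchwarz (L2B fL (fnL n)) hL) _.
  by rewrite [leLHS]mulrC; apply: ler_wpM2l; [exact: nrm_ge0|exact: H2].
apply: le_trans (CauchySchwarz (L2B FL (FnL n)) gL) _.
by rewrite [leLHS]mulrC; apply: ler_wpM2l; [exact: nrm_ge0|exact: H1].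
Qed.

(** The functions [cprimW (g 0)], for g a backward orbit, are V-derivatives of test functions up to
    null sets; their starting points are dense and [cprimW] is L^2-continuous, so orthogonality
    extends to all k. *)
Lemma orbit_orthogonal u : L2 nu u ->
  (forall g, test_functions0 W V g -> ip nu u (rderive V g) = 0) ->
  forall k, centered_bounded k -> ip nu u (cprimW k) = 0.
Proof.
move=> uL uT k Kk.
have kL := centered_L2 Kk.
pose C := Num.sqrt (fine (nu setT)) * Num.sqrt (fine (mu setT)).
apply: (@small_eq0 _ (nrm nu u * C)) => e e0.
have [g [Kg gT gk]] := centered_orbit_dense V Kk e0.
(* The orbit is prolonged by one step, so that the test function is T g_0 and its V-derivative is
   the W-primitive of g_0. *)
pose g' n := if n is n'.+1 then g n' else prim2 (g 0%N).
have Kg' n : centered_bounded (g' n).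
  by case: n => [|n]; [exact/centered_prim2/centered_L2|exact: Kg].
have gT' n : g' n = prim2 (g' n.+1) by case: n => [|n]; [by []|exact: gT].
have := uT _ (orbit_test Kg' gT').
rewrite [per _](_ : _ = per (prim2 (g 0%N)))// rderive_per_prim2//.
have gL := centered_L2 (Kg 0%N).
have LgL := L2_cprimW V nu gL; have LkL := L2_cprimW V nu kL.
have pgL := bounded_L2 nu (per_cprimW_bounded V (Kg 0%N)).
move=> pg0.
have ug0 : ip nu u (cprimW (g 0%N)) = 0.
  by apply: etrans pg0; apply/esym; exact: (ip_eqV uL pgL LgL (per_eq01 _)).
have E : cprimW (fun x => -1 * g 0%N x + k x) = (fun x => -1 * cprimW (g 0%N) x + cprimW k x).
  exact: cprimW_lin.
have -> : ip nu u (cprimW k) = ip nu u (cprimW (fun x => -1 * g 0%N x + k x)).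
  have A := ipDr (L2Z (-1) LgL) LkL uL; have B := ipZr (-1) LgL uL.
  have B0 := etrans B (etrans (congr1 ( *%R (-1)) ug0) (mulr0 _)).
  apply/esym/(etrans (congr1 (ip nu u) E)).
  exact: (etrans A (etrans (congr1 (+%R^~ _) B0) (add0r _))).
have dL := L2D (L2Z (-1) gL) kL.
apply: le_trans (CauchySchwarz uL (L2_cprimW V nu dL)) _.
rewrite -mulrA ler_wpM2l ?nrm_ge0//.
apply: le_trans (cprimW_bound V dL) _; rewrite -/C ler_wpM2l//.
  by rewrite mulr_ge0 ?sqrtr_ge0.
by move: gk; rewrite nrmC; congr (nrm _ _ <= _); apply/funext => x; rewrite mulN1r addrC.
Qed.

(** The squared norm of the centered u equals its pairing with u. Subtracting from it a close
    element of the range of [cprimW] does not change this pairing, which is therefore arbitrarily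
    small. *)
Lemma orbit_orthogonal_cst u : L2 nu u ->
  (forall g, test_functions0 W V g -> ip nu u (rderive V g) = 0) ->
  nrm nu (ctr nu u) = 0.
Proof.
move=> uL uT; have uK := orbit_orthogonal uL uT.
have cL := L2_ctr uL.
have E : ip nu (ctr nu u) (ctr nu u) = ip nu u (ctr nu u).
  rewrite [LHS](ipBl uL (L2_cst nu (mean nu u)) cL).
  have -> : ip nu (fun=> mean nu u) (ctr nu u) = 0.
    rewrite /ip (RintegralZl _ measurableT (L2_integrable cL)).
    by rewrite (int_ctr (massV_neq0 V) uL) mulr0.
  by rewrite subr0.
apply/eqP; rewrite sqrtr_eq0 E le_eqVlt; apply/orP; left; apply/eqP.
apply: (@small_eq0 _ (nrm nu u)) => e e0.
have LVd : in_closure nu centered_bounded cprimW u by exact: cprimW_dense.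
have [k Kk ke] := LVd e e0.
have kL := centered_L2 Kk.
have LkL := L2_cprimW V nu kL.
have -> : ip nu u (ctr nu u) = ip nu u (fun x => ctr nu u x - cprimW k x).
  by rewrite (ipBr cL LkL uL) (uK k Kk) subr0.
apply: le_trans (CauchySchwarz uL (L2B cL LkL)) _.
by apply: ler_wpM2l; [exact: nrm_ge0|rewrite nrmC; exact: ltW].
Qed.

Lemma weak_energetic f : weak_space W V f -> energetic_space W V f.
Proof.
move=> [F [F0 Fw]].
have fL : L2 nu f by exact: Lspace_L2.
have FL : L2 mu F by exact: Lspace_L2.
have pL := L2_prim_le nu FL.
pose u : TR -> R := fun x => f x - prim_le mu F x.
have uL : L2 nu u by exact: (L2B fL pL).
have uT g : test_functions0 W V g -> ip nu u (rderive V g) = 0.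
  move=> tg; have [pg Hg] := tg.
  have [gc _ gd] := Hg 0%N; have [hc _ _] := Hg 1%N.
  have [bh gh h0] := FTC_V pg gc gd hc.
  set h := rderive V g in bh gh h0 hc *.
  have hL := bounded_L2 nu bh.
  have bg : bounded_mfun (g : TR -> R).
    by apply: periodic_bounded_mfun => //; exact: caglad_regulated.
  have gL := bounded_L2 mu bg.
  rewrite (ipBl fL pL hL) (int_parts FL hL gL gh F0 h0).
  have H : ip nu f h = - ip mu F g.
    apply: Fw; exists 0, g; split => //.
    by apply/funext => x /=; rewrite add0r.
  by rewrite H opprK addNr.
have u0 := orbit_orthogonal_cst uL uT.
(* This is the almost everywhere constant value of u, used as integration constant for the
   approximating sequence. *)
pose c := mean nu u.
have ctrF : ctr mu F = F.
  by apply/funext => x; rewrite /ctr /mean F0 mul0r subr0.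
have Td : in_closure mu centered_bounded prim2 F by exact: prim2_dense.
have /choice[k kP] (n : nat) : exists k, centered_bounded k /\
    nrm mu (fun x => prim2 k x - F x) < n.+1%:R^-1.
  have [|k Kk kn] := Td (n.+1%:R^-1); first by rewrite invr_gt0.
  by exists k; split => //; rewrite ctrF in kn.
have Kk n := (kP n).1.
have TL n : L2 mu (prim2 (k n)) by exact/centered_L2/centered_prim2/centered_L2.
have Tc e : 0 < e -> exists N, forall n, (N <= n)%N -> nrm mu (fun x => prim2 (k n) x - F x) < e.
  move=> e0; have [N _ NP] := near_infty_natSinv_lt (PosNum e0).
  by exists N => n Nn; apply: lt_trans (kP n).2 _; exact: NP.
pose f_ n := torus_prim W (prim2 (k n)) c.
have fS n : strong_domain W V (f_ n) by exact: strong_torus_prim.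
have fnL n : L2 nu (f_ n : TR -> R) by have [] := strong_energy (fS n).
pose C := Num.sqrt (fine (mu setT)) * Num.sqrt (fine (nu setT)).
have C0 : 0 <= C by rewrite mulr_ge0 ?sqrtr_ge0.
have C1 : 0 < C + 1 by rewrite ltr_wpDl.
(* On (0, 1) the error [f_ n - f] is the W-primitive of [prim2 (k n) - F] minus the centered u,
   whose norm is 0. *)
have fb n : nrm nu (fun x => f_ n x - f x) <= C * nrm mu (fun x => prim2 (k n) x - F x).
  have dL := L2B (TL n) FL.
  have pdL := L2_prim_le nu dL.
  have cL := L2_ctr uL.
  have H : nrm nu (fun x => f_ n x - f x) <=
      nrm nu (fun x => prim_le mu (fun x => prim2 (k n) x - F x) x - ctr nu u x).
    apply: le_nrm_ae; [exact: (L2B (fnL n) fL)|exact: (L2B pdL cL)|].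
    apply: filterS (ae_measV V) => x /andP[x0 x1].
    rewrite /f_ /torus_prim (lift_W_eq c (centered_prim2 V (centered_L2 (Kk n))) (ltW x0) (ltW x1)).
    rewrite (prim_leB (TL n) FL) le_eqVlt; apply/orP; left; apply/eqP; congr `|_|.
    rewrite /ctr /u -/c.
    by move: (prim_le mu (prim2 (k n)) x) (prim_le mu F x) (f x) => a1 a2 a3; ring.
  apply: le_trans H _; apply: le_trans (nrmB pdL cL) _; rewrite u0 addr0.
  have := @nrm_le_sup _ TR R nu _ _ (measurable_prim_le dL) (fun x => prim_le_bound x dL).
  by move=> /le_trans; apply; rewrite mulrAC.
have Df n : lderive W (f_ n) = per (prim2 (k n)) by exact: lderive_torus_prim.
clearbody f_.
have fc e : 0 < e -> exists N, forall n, (N <= n)%N -> nrm nu (fun x => f_ n x - f x) < e.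
  move=> e0; have [N NP] := Tc (e / (C + 1)) (divr_gt0 e0 C1).
  exists N => n Nn; apply: le_lt_trans (fb n) _.
  have := NP n Nn; rewrite ltr_pdivlMr//; apply: le_lt_trans.
  by rewrite mulrC ler_wpM2l ?nrm_ge0// lerDl.
exists f_; split => //.
  by apply/Lnorm_cvg0 => [n|]; [exact: (L2B (fnL n) fL)|exact: fc].
move=> e e0.
(* A quarter for each of the two distances to the limit, so that both norms in the energy are below
   e / 2; the root of a^2 + b^2 is at most a + b. *)
have e4 : 0 < e / 2 / 2 by rewrite !divr_gt0.
have [N1 H1] := fc _ e4; have [N2 H2] := Tc _ e4.
exists (maxn N1 N2) => i j; rewrite !geq_max => /andP[i1 i2] /andP[j1 j2].
have [Sij Eij] := strongB (fS i) (fS j).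
have [_ _ _ _ E] := strong_energy Sij.
have A1 : nrm nu (f_ i \- f_ j) < e / 2.
  apply: le_lt_trans (nrm_triangle (fnL i) (fnL j) fL) _.
  by rewrite [e / 2]splitr; apply: ltrD; [exact: H1|rewrite nrmC; exact: H1].
have A2 : nrm mu (lderive W (f_ i \- f_ j)) < e / 2.
  rewrite Eij !Df.
  have pL' n := bounded_L2 mu (per_prim2_bounded V (Kk n)).
  have -> : nrm mu (fun x => per (prim2 (k i)) x - per (prim2 (k j)) x) =
      nrm mu (fun x => prim2 (k i) x - prim2 (k j) x).
    apply: (nrm_eqW (L2B (pL' i) (pL' j)) (L2B (TL i) (TL j))) => x x01.
    exact: (congr2 (fun a b => a - b) (per_eq01 _ x01) (per_eq01 _ x01)).
  apply: le_lt_trans (nrm_triangle (TL i) (TL j) FL) _.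
  by rewrite [e / 2]splitr; apply: ltrD; [exact: H2|rewrite nrmC; exact: H2].
rewrite /energy_norm E; apply: sqrt_lt_sqr => //.
have n1 := nrm_ge0 nu (f_ i \- f_ j).
have n2 := nrm_ge0 mu (lderive W (f_ i \- f_ j)).
move: n1 n2 A1 A2; move: (nrm nu _) (nrm mu _) => a b a0 b0 ae be.
clear -e0 a0 b0 ae be.
apply: (@le_lt_trans _ _ ((a + b) ^+ 2)).
  by rewrite sqrrD mulr2n; have := mulr_ge0 a0 b0; lra.
have abe : a + b < e by lra.
by rewrite ltrXn2r ?nnegrE ?addr_ge0 ?abe // ltW.
Qed.

End main.

Theorem theorem1p4p4 (R : realType) (W : cadlag_driver R) (V : caglad_driver R) :
  weak_space W V = energetic_space W V.
Proof.
by apply/seteqP; split => f; [exact: weak_energetic|exact: energetic_weak].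
Qed.
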